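(* Let $1<p<\infty$, $1\le r<\infty$, and let $\lambda(x)$, $x\ge 1$, be a positive monotone function satisfying $K_1\lambda(2^n)\le\lambda(2^{n+1})\le K_2\lambda(2^n)$ for all $n$, with constants $K_1>0$ and $K_2$. Let $\mathbf{A}=\{a_n\}_{n\ge1}\in NBVS$ and suppose $f(x)=\sum_{k=1}^\infty a_k\cos kx\in L^p$. Put $$I(f,\lambda,r,p):=\int_0^1\lambda\left(\frac1t\right)t^{\,r-2-\frac rp}\left(\int_0^\pi|f(x+t)+f(x-t)-2f(x)|^p\,dx\right)^{r/p}dt .$$ Then $$\sum_{n=1}^\infty\lambda(n)a_n^r\le K\,I(f,\lambda,r,p).$$ If, moreover, $\sum_{n=1}^\infty|\Delta a_n|<\infty$ and $\lambda(x)$ satisfies the additional conditions that, for all $m\ge 1$, $$\sum_{n=1}^m\lambda(n)n^{\frac rp-r}\le K\lambda(m)m^{\frac rp-r+1}$$ and $$\sum_{n=m}^\infty\lambda(n)n^{r(\frac1p-3)}\le K\lambda(m)m^{1+r(\frac1p-3)},$$ then $$I(f,\lambda,r,p)\le K\sum_{n=1}^\infty\lambda(n)a_n^r .$$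
   Context: A sequence $\mathbf{A}=\{a_n\}_{n\ge1}$ of nonnegative real numbers belongs to $NBVS$ if there is a constant $K(\mathbf{A})$, depending only on $\mathbf{A}$, such that $\sum_{m=n}^{2n}|\Delta a_m|\le K(\mathbf{A})(a_n+a_{2n})$ for all $n=1,2,\dots$, where $\Delta a_m=a_m-a_{m+1}$. $L^p$ is the space of $2\pi$-periodic functions that are $p$-power integrable over a period. $K$ denotes a positive constant, not necessarily the same at each occurrence, which may depend on $p$ and $\mathbf{A}$ (and on $r$ and $\lambda$); in the conditions on $\lambda$ it is independent of $m$. *)

(* Defs.v *)
From HB Require Import structures.
From mathcomp Require Import all_boot all_order all_algebra.
From mathcomp Require Import all_classical all_reals all_analysis.

Set Implicit Arguments.
Unset Strict Implicit.
Unset Printing Implicit Defensive.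

Import Order.TTheory GRing.Theory Num.Theory.
Import numFieldNormedType.Exports.

Local Open Scope classical_set_scope.
Local Open Scope ring_scope.

(* Sequences are indexed from 1: the entry [a 0%N] of [a : nat -> R] is never
   used. *)

Definition Delta (R : realType) (a : nat -> R) (n : nat) : R := a n - a n.+1.

Definition NBVS (R : realType) (a : nat -> R) : Prop :=
  (forall n : nat, (1 <= n)%N -> 0 <= a n) /\
  exists K : R, forall n : nat, (1 <= n)%N ->
    \sum_(n <= m < (2 * n).+1) `|Delta a m| <= K * (a n + a (2 * n)%N).

(* [f] is a representative, 2pi-periodic at every point and Borel measurable,
   of its almost-everywhere class. *)
Definition Lp2pi (R : realType) (p : R) (f : R -> R) : Prop :=
  [/\ measurable_fun [set: R] f,
      periodic f (pi *+ 2) &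
      (\int[@lebesgue_measure R]_(x in `[(- pi)%R, pi]) ((`|f x| `^ p)%:E)
         < +oo)%E].

(* The cosine series [\sum_(k >= 1) a_k cos (k x)] is the Fourier series of [f].
   For [f] in L^p with p > 1 this series converges to [f] in L^p-norm and almost
   everywhere. *)
Definition cosine_series_of (R : realType) (f : R -> R) (a : nat -> R) : Prop :=
  [/\ Rintegral (@lebesgue_measure R) `[- pi, pi] f = 0,
      (forall k : nat, (1 <= k)%N ->
         pi^-1 * Rintegral (@lebesgue_measure R) `[- pi, pi]
                   (fun x => f x * cos (k%:R * x)) = a k) &
      (forall k : nat, (1 <= k)%N ->
         pi^-1 * Rintegral (@lebesgue_measure R) `[- pi, pi]
                   (fun x => f x * sin (k%:R * x)) = 0)].

Definition pos_monotone_from1 (R : realType) (lam : R -> R) : Prop :=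
  (forall x : R, 1 <= x -> 0 < lam x) /\
  ((forall x y : R, 1 <= x -> x <= y -> lam x <= lam y) \/
   (forall x y : R, 1 <= x -> x <= y -> lam y <= lam x)).

Definition dyadic_regular (R : realType) (lam : R -> R) : Prop :=
  exists K1 K2 : R, 0 < K1 /\
    forall n : nat,
      K1 * lam (2 ^+ n) <= lam (2 ^+ n.+1) /\
      lam (2 ^+ n.+1) <= K2 * lam (2 ^+ n).

Definition I_int (R : realType) (f lam : R -> R) (r p : R) : \bar R :=
  (\int[@lebesgue_measure R]_(t in `]0%R, 1%R])
     ((lam (1 / t) * t `^ (r - 2 - r / p))%:E *
      (\int[@lebesgue_measure R]_(x in `[0%R, pi])
         ((`|f (x + t) + f (x - t) - 2 * f x| `^ p)%:E)) `^ (r / p)))%E.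

Definition weighted_sum (R : realType) (lam : R -> R) (a : nat -> R) (r : R)
    : \bar R :=
  (\sum_(1 <= n <oo) (lam n%:R * a n `^ r)%:E)%E.

Definition summable_Delta (R : realType) (a : nat -> R) : Prop :=
  (\sum_(1 <= n <oo) (`|Delta a n|)%:E < +oo)%E.

Definition head_condition (R : realType) (lam : R -> R) (r p : R) : Prop :=
  exists K : R, forall m : nat, (1 <= m)%N ->
    \sum_(1 <= n < m.+1) lam n%:R * n%:R `^ (r / p - r)
      <= K * (lam m%:R * m%:R `^ (r / p - r + 1)).

Definition tail_condition (R : realType) (lam : R -> R) (r p : R) : Prop :=
  exists K : R, forall m : nat, (1 <= m)%N ->
    (\sum_(m <= n <oo) (lam n%:R * n%:R `^ (r * (p^-1 - 3)))%:E
      <= (K * (lam m%:R * m%:R `^ (1 + r * (p^-1 - 3))))%:E)%E.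

(* Main.v *)
Require Import Defs.
From mathcomp Require Import all_boot all_order all_algebra.
From mathcomp Require Import all_classical all_reals all_analysis.
From mathcomp Require Import measurable_realfun.
From mathcomp Require Import ring lra.
From mathcomp Require Import zify.

(** Write $\omega_tf(x)=f(x+t)+f(x-t)-2f(x)$ and let
    $U_N(x)=2N/(1+N|\sin(x/2)|)$ be the [peak], which dominates, up to a
    constant, every cosine sum over $[N,2N)$ with coefficients of bounded size
    and variation, and whose $q$-th power has integral of order $N^{q-1}$.

    Lower bound. Membership in [NBVS] bounds $m\,a_m$ by a multiple of the sum
    of $a_k$ over $m/2\le k\le 2m$ ([NBVS_average]). For $1/(m+1)<t\le 1/m$
    that sum is bounded by the integral of $\omega_tf$ against the Dirichlet
    sum of the same window, since $1-\cos kt$ stays away from 0 there;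
    Hölder's inequality and the integral of the peak give $a_m\le
    Cm^{1/p-1}\|\omega_tf\|_p$ ([coef_le_diff_integral]). It remains to raise
    this to the power $r$, to integrate over $]1/(m+1),1/m]$ and to sum over
    $m$ ([weighted_sum_le_I]).

    Upper bound. Let $A_j=a_{2^j}+a_{2^{j+1}}$ and $c_j=2^{j(1-1/p)}A_j$. For
    $t\le 2^{-n}$ the second difference of the block of frequencies
    $[2^j,2^{j+1})$ is at most $CA_j\kappa_{nj}$ times three translated peaks,
    with $\kappa_{nj}=4^{-(n-j)}$ for $j\le n$ and $\kappa_{nj}=1$ otherwise
    ([second_diff_block_le]). Jensen's inequality then bounds the $L^p$ norm of
    $\omega_t$ of a dyadic partial sum by $C\sum_j\kappa_{nj}c_j$
    ([diff_integral_dyadic_sum]). With $w_n=\lambda(2^n)2^{n(r/p-r+1)}$, the two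
    conditions on $\lambda$ say that $w_n\kappa_{nj}^r\le Cq^{|n-j|}w_j$ for some
    $q<1$ ([attenuation_geometric]), so Hardy's inequality [weighted_hardy]
    bounds $\sum_nw_n(\sum_j\kappa_{nj}c_j)^r$ by $\sum_jw_jc_j^r$, hence by
    $\sum_n\lambda(n)a_n^r$ ([block_norm_sum_le]).

    To replace the partial sums by $f$ only almost everywhere convergence is
    needed, thanks to Fatou's lemma. If the weighted sum is finite then so is
    $\sum_jc_j$, and $(1-\cos x)$ times the dyadic partial sums converges
    uniformly, because the factor cancels the peaks. The limit has the Fourier
    coefficients of $(1-\cos x)f$, so that the two agree almost everywhere
    ([dyadic_sum_ae]) by uniqueness of Fourier coefficients
    ([fourier_null_ae]). Uniqueness itself is proved by approximating indicator
    functions of intervals by trigonometric polynomials. *)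

Import Order.TTheory GRing.Theory Num.Theory.
Import numFieldNormedType.Exports.

Set Implicit Arguments.
Unset Strict Implicit.
Unset Printing Implicit Defensive.

Local Open Scope classical_set_scope.
Local Open Scope ring_scope.

(** * Trigonometric sums *)

Section trigonometry.
Context {R : realType}.
Implicit Types (x y u v G M V : R).

Lemma dirichlet_bound x m n :
  `|\sum_(m <= k < n) cos (k%:R * x)| * `|sin (x / 2)| <= 1.
Proof.
have [nm|/ltnW mn] := leqP n m; first by rewrite big_geq// normr0 mul0r.
pose s (k : nat) := sin (k%:R * x - x / 2).
have step (k : nat) : cos (k%:R * x) * sin (x / 2) = (s k.+1 - s k) / 2.
  rewrite /s; have -> : k.+1%:R * x - x / 2 = k%:R * x + x / 2.
    by rewrite -natr1; lra.
  by rewrite sinD sinB; lra.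
rewrite -normrM mulr_suml (eq_bigr (fun k => (s k.+1 - s k) / 2)) => [|k _]//.
rewrite -mulr_suml telescope_sumr//.
by rewrite ler_norml; have := sin_geN1 (n%:R * x - x / 2);
  have := sin_le1 (n%:R * x - x / 2); have := sin_geN1 (m%:R * x - x / 2);
  have := sin_le1 (m%:R * x - x / 2); rewrite /s; lra.
Qed.

(** Summation by parts. *)
Lemma abel_bound (b e : nat -> R) G m n : (m <= n)%N -> 0 <= G ->
  (forall k, `|\sum_(m <= i < k) e i| <= G) ->
  `|\sum_(m <= k < n.+1) b k * e k|
    <= (`|b n| + \sum_(m <= k < n) `|b k - b k.+1|) * G.
Proof.
move=> mn G0 eG.
have -> : \sum_(m <= k < n.+1) b k * e k = b n * (\sum_(m <= k < n.+1) e k)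
    + \sum_(m <= k < n) (b k - b k.+1) * \sum_(m <= i < k.+1) e i.
  elim: n mn => [|n IH].
    rewrite leqn0 => /eqP ->; rewrite !big_nat1 big_geq// addr0//.
  rewrite leq_eqVlt => /predU1P[->|].
    by rewrite !big_nat1 big_geq// addr0.
  rewrite ltnS => mn; rewrite big_nat_recr/= 1?ltnW// IH//.
  rewrite [X in _ = _ * X + _]big_nat_recr/= 1?ltnW//.
  rewrite [X in _ = _ + X]big_nat_recr//=; lra.
rewrite mulrDl (le_trans (ler_normD _ _))// lerD//.
  by rewrite normrM ler_wpM2l.
rewrite mulr_suml (le_trans (ler_norm_sum _ _ _))// ler_sum// => k _.
by rewrite normrM ler_wpM2l.
Qed.

(** A $2\pi$-periodic function comparable to the minimum of [N] and
    $1/|\sin(x/2)|$, which is the size of a cosine sum over $[N, 2N)$. *)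
Definition peak (N : nat) x : R := 2 * N%:R / (1 + N%:R * `|sin (x / 2)|).

Lemma peak_den_gt0 N x : 0 < 1 + N%:R * `|sin (x / 2)|.
Proof. by rewrite ltr_pwDl// mulr_ge0. Qed.

Lemma peak_ge0 N x : 0 <= peak N x.
Proof. by rewrite /peak divr_ge0// ?mulr_ge0// ltW// peak_den_gt0. Qed.

Lemma peakN N x : peak N (- x) = peak N x.
Proof. by rewrite /peak mulNr sinN normrN. Qed.

Lemma peak_periodic N : periodic (peak N) (pi *+ 2).
Proof.
move=> x; rewrite /peak.
have -> : (x + pi *+ 2) / 2 = x / 2 + pi by rewrite mulrDl -[pi *+ 2]mulr_natr mulfK.
by rewrite sinDpi normrN.
Qed.

Lemma le_peak N x M d : 0 <= d -> 0 <= M -> d <= M * N%:R ->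
  d * `|sin (x / 2)| <= M -> d <= M * peak N x.
Proof.
move=> d0 M0 dN ds; rewrite /peak mulrA ler_pdivlMr ?peak_den_gt0//.
have := ler_wpM2l (ler0n R N) ds; lra.
Qed.

(** A cosine sum over $[N, 2N)$ is bounded by the size [M] and the variation [V]
    of its coefficients: trivially by [M * N], and by summation by parts against
    Dirichlet sums. *)
Lemma block_bound (b : nat -> R) N M V x : (0 < N)%N -> 0 <= V ->
  (forall k, (N <= k < 2 * N)%N -> `|b k| <= M) ->
  \sum_(N <= k < (2 * N).-1) `|b k - b k.+1| <= V ->
  `|\sum_(N <= k < 2 * N) b k * cos (k%:R * x)| <= (M + V) * peak N x.
Proof.
move=> N0 V0 bM bV.
have M0 : 0 <= M by rewrite (le_trans _ (bM N _))// leqnn/=; lia.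
apply: le_peak => //; first exact: addr_ge0.
  have H : `|\sum_(N <= k < 2 * N) b k * cos (k%:R * x)| <= M * N%:R.
    rewrite (le_trans (ler_norm_sum _ _ _))//.
    rewrite (@le_trans _ _ (\sum_(N <= k < 2 * N) M))//.
      apply: ler_sum_nat => k kN; rewrite normrM.
      by rewrite -[leRHS]mulr1 ler_pM// ?bM// cos_max.
    by rewrite sumr_const_nat (_ : (2 * N - N)%N = N) ?mulr_natr//; lia.
  by rewrite (le_trans H)// ler_wpM2r// lerDl.
have [s0|s0] := eqVneq (sin (x / 2)) 0.
  by rewrite s0 normr0 mulr0 addr_ge0.
have s_gt0 : 0 < `|sin (x / 2)| by rewrite normr_gt0.
rewrite -ler_pdivlMr//.
have -> : (2 * N = (2 * N).-1.+1)%N by lia.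
apply: (@le_trans _ _ ((`|b (2 * N).-1| + \sum_(N <= k < (2 * N).-1) `|b k - b k.+1|)
   / `|sin (x / 2)|)).
  apply: abel_bound; [lia|by rewrite invr_ge0|].
  move=> k; rewrite -[leRHS]mul1r ler_pdivlMr//; exact: dirichlet_bound.
rewrite ler_wpM2r ?invr_ge0// lerD// bM//; lia.
Qed.

Lemma sin_ge_half y : 0 <= y <= pi / 2 -> y / 2 <= sin y.
Proof.
move=> /andP[y0 ypi].
have [->|yn0] := eqVneq y 0; first by rewrite mul0r sin0.
have {yn0}y0 : 0 < y by rewrite lt_neqAle eq_sym yn0.
have h0 : 0 < y / 2 by lra.
have pi0 : (0 : R) < pi := pi_gt0 _.
have [|c /[!in_itv]/= /andP[c0 cy]] := @MVT R sin cos 0 (y / 2) h0.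
  by apply: continuous_subspaceT => z; exact: continuous_sin.
rewrite sin0 !subr0 => sE.
have cosc : cos (y / 2) <= cos c.
  by rewrite leNgt ltr_cos -?leNgt ?ltW// in_itv/=; apply/andP; split; lra.
have ch : cos (y / 2) ^+ 2 >= 2^-1.
  have := cos_mulr2n (y / 2); have -> : (y / 2) *+ 2 = y by rewrite -mulr_natr; lra.
  have := @cos_ge0_pihalf R y; have -> : - (pi / 2) <= y <= pi / 2 by lra.
  by move=> /(_ isT) ? ?; lra.
have cp : 0 <= cos (y / 2) by apply: cos_ge0_pihalf; lra.
have := sin_mulr2n (y / 2); have -> : (y / 2) *+ 2 = y by rewrite -mulr_natr; lra.
move=> ->; rewrite sE.
have := ler_wpM2r (ltW h0) (ler_wpM2l cp cosc); rewrite -expr2.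
have := ler_wpM2r (ltW h0) ch; rewrite -mulr_natr; lra.
Qed.

Lemma cos_diff_le u v : 0 <= u -> u <= v -> `|cos u - cos v| <= (v - u) * v.
Proof.
move=> u0; rewrite le_eqVlt => /predU1P[->|uv]; first by rewrite !subrr normr0 mul0r.
have sin_le (z : R) : 0 <= z -> `|sin z| <= z.
  rewrite le_eqVlt => /predU1P[<-|z0]; first by rewrite sin0 normr0.
  have [|c _] := @MVT R sin cos 0 z z0.
    by apply: continuous_subspaceT => w; exact: continuous_sin.
  rewrite sin0 !subr0 => ->; rewrite normrM (gtr0_norm z0).
  by rewrite ler_piMl ?cos_max// ltW.
have [|c /[!in_itv]/= /andP[c0 cv]] := @MVT R cos (fun z => - sin z) u v uv.
  by apply: continuous_subspaceT => w; exact: continuous_cos.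
move=> E; rewrite distrC E normrM normrN mulrC (gtr0_norm (x := v - u)) ?subr_gt0//.
rewrite ler_wpM2l ?subr_ge0 1?[u <= v]ltW//.
by have := sin_le c; lra.
Qed.

Lemma one_sub_cos_le u : 0 <= u -> 1 - cos u <= u ^+ 2.
Proof.
move=> u0; have := @cos_diff_le 0 u (lexx _) u0.
by rewrite cos0 subr0 expr2; apply: le_trans; exact: ler_norm.
Qed.

Lemma one_sub_cos_ge0 u : 0 <= 1 - cos u.
Proof. by rewrite subr_ge0 cos_le1. Qed.

Lemma one_sub_cos_ge u : 1 / 4 <= u <= 2 -> 1 - cos (1 / 4 : R) <= 1 - cos u.
Proof.
move=> u2; have := pi_ge2 R => p2.
by rewrite lerD2l lerN2 leNgt ltr_cos -?leNgt ?in_itv/=; lra.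
Qed.

Lemma one_sub_cos_quarter_gt0 : 0 < 1 - cos (1 / 4 : R).
Proof.
have := pi_ge2 R => p2.
by rewrite -[X in X - _]cos0 subr_gt0 ltr_cos ?in_itv/=; lra.
Qed.

Lemma second_diff_cos k x t :
  cos (k%:R * (x + t)) + cos (k%:R * (x - t)) - 2 * cos (k%:R * x)
  = - (2 * (1 - cos (k%:R * t))) * cos (k%:R * x) :> R.
Proof. by rewrite mulrDr mulrBr cosD cosB; lra. Qed.

End trigonometry.

(** * Power inequalities *)

Section power_inequalities.
Context {R : realType}.
Implicit Types (r s y : R).

Lemma powR_tangent r s y : 1 <= r -> 0 <= s -> 0 <= y ->
  r * (s `^ (r - 1) * y) <= y `^ r + (r - 1) * s `^ r.
Proof.
rewrite le_eqVlt => /predU1P[<-|r1] s0 y0.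
  by rewrite subrr powRr0 powRr1// !mul1r mul0r addr0.
have r0 : 0 < r by lra.
have rm : 0 < r - 1 by lra.
have := @conjugate_powR R (s `^ (r - 1)) y (r / (r - 1)) r (powR_ge0 _ _) y0 _ r0.
rewrite divr_gt0// => /(_ isT).
have -> : (r / (r - 1))^-1 + r^-1 = 1 by rewrite invf_div; field; rewrite gt_eqF.
move=> /(_ erefl); rewrite -powRrM.
have -> : (r - 1) * (r / (r - 1)) = r by field; rewrite gt_eqF.
move=> H; have := ler_wpM2l (ltW r0) H.
have -> : r * (s `^ r / (r / (r - 1)) + y `^ r / r) = y `^ r + (r - 1) * s `^ r.
  by field; rewrite !gt_eqF.
by [].
Qed.

(** Jensen's inequality for $x\mapsto x^r$, with weights of arbitrary total
    mass. *)
Lemma jensen_powR (I : eqType) (l : seq I) (P : pred I) (t y : I -> R) r : 1 <= r ->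
  (forall i, 0 <= t i) -> (forall i, 0 <= y i) ->
  (\sum_(i <- l | P i) t i * y i) `^ r
    <= (\sum_(i <- l | P i) t i) `^ (r - 1) * \sum_(i <- l | P i) t i * y i `^ r.
Proof.
move=> r1 t0 y0; have r0 : 0 < r by lra.
set T := \sum_(i <- l | P i) t i; set X := \sum_(i <- l | P i) t i * y i.
have T0 : 0 <= T by exact: sumr_ge0.
have X0 : 0 <= X by apply: sumr_ge0 => i _; rewrite mulr_ge0.
have Z0 : 0 <= \sum_(i <- l | P i) t i * y i `^ r.
  by apply: sumr_ge0 => i _; rewrite mulr_ge0// powR_ge0.
have [X_0|Xn0] := eqVneq X 0.
  by rewrite X_0 powR0 ?gt_eqF// mulr_ge0// powR_ge0.
have [T_0|Tn0] := eqVneq T 0.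
  exfalso; move/eqP: Xn0; apply; rewrite /X; apply: big1_seq => i /andP[Pi li].
  move/eqP : T_0; rewrite /T big_seq_cond psumr_eq0 => [|j _]//.
  move=> /allP/(_ i li); rewrite li Pi/= => /eqP ->; exact: mul0r.
have Tp : 0 < T by rewrite lt_neqAle eq_sym Tn0.
set s := X / T; have s0 : 0 <= s by rewrite divr_ge0.
have XE : X = s * T by rewrite /s divfK.
have key : s `^ r * T <= \sum_(i <- l | P i) t i * y i `^ r.
  have : \sum_(i <- l | P i) t i * (r * (s `^ (r - 1) * y i))
    <= \sum_(i <- l | P i) t i * (y i `^ r + (r - 1) * s `^ r).
    by apply: ler_sum => i _; rewrite ler_wpM2l// powR_tangent.
  rewrite (eq_bigr (fun i => (r * s `^ (r - 1)) * (t i * y i))); last by move=> *; ring.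
  rewrite -mulr_sumr -/X XE.
  have -> : r * s `^ (r - 1) * (s * T) = r * (s * s `^ (r - 1)) * T by ring.
  rewrite mulr_powRB1//.
  rewrite [leRHS](eq_bigr (fun i => t i * y i `^ r + t i * ((r - 1) * s `^ r))); last first.
    by move=> *; ring.
  by rewrite big_split/= -mulr_suml -/T; lra.
rewrite XE powRM// -(mulr_powRB1 (x := T))// mulrA mulrC ler_wpM2l ?powR_ge0//.
Qed.

Lemma powRD_le r s y : 1 <= r -> 0 <= s -> 0 <= y ->
  (s + y) `^ r <= 2 `^ (r - 1) * (s `^ r + y `^ r).
Proof.
move=> r1 s0 y0.
have := @jensen_powR bool [:: true; false] predT (fun=> 1)
  (fun b => if b then s else y) r r1 (fun=> ler01) _.
rewrite !big_cons !big_nil !addr0 !mul1r; apply; by case.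
Qed.

End power_inequalities.

(** * Geometric kernels *)

Section geometric.
Context {R : realType}.
Implicit Types (v w c : nat -> R) (r q C K : R).

(** A positive sequence dominating, up to a constant, all the partial sums
    that precede it grows geometrically. *)
Lemma geometric_head v K : (forall n, 0 < v n) ->
  (forall m, \sum_(0 <= n < m.+1) v n <= K * v m) ->
  exists2 q, 0 < q < 1 & forall n d, v n <= K * q ^+ d * v (n + d)%N.
Proof.
move=> v0 vK.
have K1 : 1 <= K.
  by have := vK 0%N; rewrite big_nat1 -[leLHS]mul1r ler_pM2r.
have q01 : 0 < 1 - (2 * K)^-1 < 1.
  rewrite subr_gt0 ltrBlDr ltrDl invr_gt0 invf_lt1; lra.
exists (1 - (2 * K)^-1) => // n d.
set q := 1 - _; have q0 : 0 <= q by case/andP : q01 => /ltW.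
pose W m := \sum_(0 <= n < m.+1) v n.
have W0 m : 0 <= W m by apply: sumr_ge0 => i _; exact/ltW.
have WS m : W m <= q * W m.+1.
  have E : W m.+1 = W m + v m.+1 by rewrite /W big_nat_recr.
  have H : W m.+1 / (2 * K) <= v m.+1.
    rewrite ler_pdivrMr; last lra.
    rewrite (le_trans (vK _))//.
    by have := mulr_gt0 (lt_le_trans ltr01 K1) (v0 m.+1); lra.
  by rewrite /q mulrBl mul1r [_^-1 * _]mulrC; lra.
have Wd : W n <= q ^+ d * W (n + d)%N.
  elim: d => [|d IH]; first by rewrite expr0 mul1r addn0.
  rewrite (le_trans IH)// addnS exprSr -mulrA ler_wpM2l ?exprn_ge0//.
apply: (@le_trans _ _ (W n)).
  by rewrite /W big_nat_recr//= lerDr sumr_ge0// => i _; exact/ltW.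
by rewrite (le_trans Wd)// [K * _]mulrC -mulrA ler_wpM2l ?exprn_ge0// vK.
Qed.

Lemma geometric_tail v K : (forall n, 0 < v n) ->
  (forall m M, (m <= M)%N -> \sum_(m <= n < M.+1) v n <= K * v m) ->
  exists2 q, 0 < q < 1 & forall n d, v (n + d)%N <= K * q ^+ d * v n.
Proof.
move=> v0 vK.
have K1 : 1 <= K.
  by have := vK 0%N 0%N isT; rewrite big_nat1 -[leLHS]mul1r ler_pM2r.
have q01 : 0 < 1 - (2 * K)^-1 < 1.
  rewrite subr_gt0 ltrBlDr ltrDl invr_gt0 invf_lt1; lra.
exists (1 - (2 * K)^-1) => // n d.
set q := 1 - _; have q0 : 0 <= q by case/andP : q01 => /ltW.
pose T m := \sum_(m <= k < (n + d).+1) v k.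
have TS m : (m <= n + d)%N -> T m.+1 <= q * T m.
  move=> mN.
  have E : T m = v m + T m.+1 by rewrite /T big_ltn.
  have H : T m / (2 * K) <= v m.
    rewrite ler_pdivrMr; last lra.
    rewrite (le_trans (vK _ _ mN))//.
    by have := mulr_gt0 (lt_le_trans ltr01 K1) (v0 m); lra.
  by rewrite /q mulrBl mul1r [_^-1 * _]mulrC; lra.
have Td i : (i <= d)%N -> T (n + i)%N <= q ^+ i * T n.
  elim: i => [|i IH] id; first by rewrite expr0 mul1r addn0.
  rewrite addnS (le_trans (TS _ _))//; first lia.
  by rewrite exprS -mulrA ler_wpM2l// IH// ltnW.
have := Td d (leqnn d); rewrite {1}/T big_nat1 => /le_trans; apply.
by rewrite [K * _]mulrC -mulrA ler_wpM2l ?exprn_ge0// vK// leq_addr.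
Qed.

Lemma geometric_sum_dist q n J : 0 < q < 1 ->
  \sum_(0 <= j < J) q ^+ ((n - j) + (j - n)) <= 2 / (1 - q).
Proof.
move=> /andP[q0 q1]; have q1' : 0 < 1 - q by lra.
rewrite ler_pdivlMr//.
have qn k : 0 <= q ^+ k by rewrite exprn_ge0// ltW.
have qn1 k : q ^+ k <= 1 by rewrite exprn_ile1// ltW.
pose A J := (\sum_(0 <= j < J) q ^+ ((n - j) + (j - n))) * (1 - q).
have AS k : A k.+1 = A k + q ^+ ((n - k) + (k - n)) * (1 - q).
  by rewrite /A big_nat_recr//= mulrDl.
have A1 k : (k <= n.+1)%N -> A k <= q ^+ (n.+1 - k).
  elim: k => [_|k IH kn]; first by rewrite /A big_geq// mul0r.
  rewrite AS (le_trans (lerD (IH _) (lexx _)))//; first lia.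
  have -> : (n.+1 - k = (n - k).+1)%N by lia.
  have -> : (k - n = 0)%N by lia.
  by rewrite subSS addn0 exprS; lra.
have A2 i : A (n.+1 + i)%N <= 2 - q ^+ i.
  elim: i => [|i IH].
    by rewrite addn0 expr0 (le_trans (A1 _ _))// subnn expr0; lra.
  rewrite addnS AS (le_trans (lerD IH (lexx _)))//.
  have -> : (n - (n.+1 + i) + (n.+1 + i - n) = i.+1)%N by lia.
  have := mulr_ge0 (qn i) (sqr_ge0 (1 - q)); rewrite !exprS expr0; lra.
have [Jn|nJ] := leqP J n.+1.
  by rewrite (le_trans (A1 _ Jn))// (le_trans (qn1 _)) //; lra.
have -> : (J = n.+1 + (J - n.+1))%N by lia.
by rewrite (le_trans (A2 _))//; have := qn (J - n.+1)%N; lra.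
Qed.

(** A Hardy inequality: kernels that decay geometrically away from the diagonal,
    relative to the weight, are bounded on weighted $\ell^r$. *)
Lemma weighted_hardy w (k : nat -> nat -> R) r q C : 1 <= r -> 0 < q < 1 -> 0 <= C ->
  (forall n, 0 < w n) -> (forall n j, 0 <= k n j) ->
  (forall n j, w n * k n j `^ r <= C * q ^+ ((n - j) + (j - n)) * w j) ->
  exists2 C', 0 <= C' & forall c M J, (forall j, 0 <= c j) ->
    \sum_(0 <= n < M) w n * (\sum_(0 <= j < J) k n j * c j) `^ r
      <= C' * \sum_(0 <= j < J) w j * c j `^ r.
Proof.
move=> r1 /andP[q0 q1] C0 w0 k0 wk.
have r0 : 0 < r by lra.
pose s : R := Num.sqrt q.
have s0 : 0 < s by rewrite sqrtr_gt0.
have s1 : s < 1 by rewrite -sqrtr1 ltr_sqrt.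
have sq : q = s * s by rewrite -expr2 sqr_sqrtr// ltW.
pose e : R := s `^ r^-1.
have e0 : 0 < e by rewrite powR_gt0.
have er : e `^ r = s by rewrite -powRrM mulVf ?gt_eqF// powRr1// ltW.
have e1 : e < 1.
  rewrite ltNge; apply/negP => e1.
  have : 1 `^ r <= e `^ r by apply: ge0_ler_powR => //; rewrite ?nnegrE ltW.
  by rewrite powR1 er; lra.
have end0 d : 0 < e ^+ d by rewrite exprn_gt0.
have edr d : (e ^+ d) `^ r = s ^+ d.
  by rewrite -powR_mulrn ?ltW// powRAC er powR_mulrn// ltW.
pose D n j := ((n - j) + (j - n))%N.
pose Th := 2 / (1 - e).
have Th0 : 0 <= Th by rewrite /Th divr_ge0//; lra.
exists (Th `^ (r - 1) * C * (2 / (1 - s))).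
  by rewrite !mulr_ge0 ?powR_ge0// invr_ge0; lra.
move=> c M J c0.
have main n : w n * (\sum_(0 <= j < J) k n j * c j) `^ r
    <= Th `^ (r - 1) * C * \sum_(0 <= j < J) s ^+ D n j * (w j * c j `^ r).
  have -> : \sum_(0 <= j < J) k n j * c j
      = \sum_(0 <= j < J) e ^+ D n j * (k n j * c j / e ^+ D n j).
    by apply: eq_bigr => j _; rewrite [RHS]mulrC divfK// gt_eqF.
  apply: (@le_trans _ _ (w n * (Th `^ (r - 1) * \sum_(0 <= j < J)
       e ^+ D n j * (k n j * c j / e ^+ D n j) `^ r))).
    rewrite ler_wpM2l ?(ltW (w0 _))//.
    have y0 j : 0 <= k n j * c j / e ^+ D n j by rewrite !mulr_ge0// invr_ge0 ltW.
    rewrite (le_trans (jensen_powR _ _ r1 _ y0))// => [j|]; first exact/ltW.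
    rewrite ler_wpM2r//.
      by apply: sumr_ge0 => j _; rewrite mulr_ge0 ?powR_ge0// ltW.
    apply: ge0_ler_powR; rewrite ?nnegrE//; [lra| |].
      by apply: sumr_ge0 => j _; exact/ltW.
    by apply: geometric_sum_dist; rewrite e0.
  rewrite mulrCA -mulrA ler_wpM2l ?powR_ge0// !mulr_sumr ler_sum// => j _.
  rewrite powRM ?mulr_ge0 ?invr_ge0 ?(ltW (end0 _))// powRM//.
  have -> : ((e ^+ D n j)^-1) `^ r = (s ^+ D n j)^-1.
    by rewrite -powR_inv1 ?(ltW (end0 _))// powRAC edr powR_inv1// exprn_ge0// ltW.
  have sd : 0 < s ^+ D n j by rewrite exprn_gt0.
  have /(ler_wpM2r (powR_ge0 (c j) r)) := wk n j; rewrite -/(D n j) sq exprMn => H.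
  have e1d : e ^+ D n j <= 1 by rewrite exprn_ile1// ltW.
  apply: (@le_trans _ _ ((w n * k n j `^ r * c j `^ r) / s ^+ D n j)).
    have -> : w n * (e ^+ D n j * (k n j `^ r * c j `^ r / s ^+ D n j)) =
      e ^+ D n j * ((w n * k n j `^ r * c j `^ r) / s ^+ D n j) by ring.
    by rewrite ler_piMl// !mulr_ge0 ?powR_ge0 ?invr_ge0 ?(ltW (w0 _))// ltW.
  by rewrite ler_pdivrMr// (le_trans H)//; lra.
rewrite (le_trans (ler_sum _ (fun n _ => main n)))// -mulr_sumr.
rewrite -[leRHS]mulrA ler_wpM2l ?mulr_ge0 ?powR_ge0//.
rewrite exchange_big/= mulr_sumr ler_sum// => j _.
rewrite -mulr_suml ler_wpM2r ?mulr_ge0 ?powR_ge0 ?(ltW (w0 _))//.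
under eq_bigr do rewrite /D addnC.
by apply: geometric_sum_dist; rewrite s0.
Qed.

End geometric.

(** * Sequences in NBVS and regular weights *)

Section nbvs.
Context {R : realType}.
Implicit Types (a lam : nat -> R).

(** Over a block $[n, 2n]$ the values and the total variation of the sequence
    are controlled by its values at the two ends. *)
Lemma NBVS_block (a : nat -> R) : NBVS a -> exists2 K : R, 1 <= K &
  forall n, (1 <= n)%N ->
    (\sum_(n <= m < (2 * n).+1) `|a m - a m.+1| <= K * (a n + a (2 * n)%N)) /\
    (forall m, (n <= m <= 2 * n)%N -> a m <= K * (a n + a (2 * n)%N)).
Proof.
move=> [a0 [K aK]]; exists (2 + `|K|) => [|n n1].
  by have := normr_ge0 K; lra.
have an := a0 n n1; have a2n : 0 <= a (2 * n)%N by apply: a0; lia.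
have aK' : \sum_(n <= m < (2 * n).+1) `|a m - a m.+1| <= `|K| * (a n + a (2 * n)%N).
  by rewrite (le_trans (aK n n1))// ler_wpM2r ?ler_norm// addr_ge0.
split=> [|m nm].
  by rewrite (le_trans aK')// ler_wpM2r ?addr_ge0// lerDr.
have am : `|a n - a m| <= \sum_(n <= k < (2 * n).+1) `|a k - a k.+1|.
  have -> : a n - a m = \sum_(n <= k < m) (a k - a k.+1).
    rewrite -[RHS]opprK -sumrN (eq_bigr (fun k => a k.+1 - a k)) => [|k _].
      by rewrite telescope_sumr ?opprB//; lia.
    by rewrite opprB.
  rewrite (le_trans (ler_norm_sum _ _ _))// [leRHS](@big_cat_nat _ _ _ m)/=; [|lia|lia].
  by rewrite lerDl sumr_ge0.
have := le_trans (ler_norm (- (a n - a m))) (eq_ind_r (fun x => x <= _) am (normrN _)).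
have := mulr_ge0 (normr_ge0 K) (addr_ge0 an a2n); lra.
Qed.

Lemma sum_even_le (F : nat -> R) l u : (forall k, (2 * l <= k)%N -> 0 <= F k) ->
  \sum_(l <= n < u) F (2 * n)%N <= \sum_(2 * l <= k < 2 * u) F k.
Proof.
move=> F0; elim: u => [|u IH]; first by rewrite muln0 !big_geq.
have [ul|lu] := ltnP u l.
  by rewrite !big_geq//; lia.
rewrite big_nat_recr//=.
have -> : (2 * u.+1 = (2 * u).+2)%N by lia.
rewrite !big_nat_recr/=; [|lia|lia].
by rewrite -addrA lerD// lerDl F0//; lia.
Qed.

(** In [NBVS] the average over a window around [m] dominates, up to a constant,
    the value at [m]. *)
Lemma NBVS_average (a : nat -> R) : NBVS a -> exists2 K : R, 0 < K &
  forall m, (1 <= m)%N ->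
    m%:R * a m <= K * \sum_(uphalf m <= k < (2 * m).+1) a k.
Proof.
move=> aN; have [K K1 aK] := NBVS_block aN; have [a0 _] := aN.
exists (4 * K); first lra.
move=> m m1; set h := uphalf m; set S := \sum_(_ <= _ < _) _.
have hm : (h <= m)%N by rewrite /h; lia.
have h1 : (1 <= h)%N by rewrite /h; lia.
have H : \sum_(h <= n < m.+1) a m <= \sum_(h <= n < m.+1) K * (a n + a (2 * n)%N).
  by apply: ler_sum_nat => n /andP[hn nm]; apply: (aK n _).2 => //; rewrite /h in hn; lia.
have S1 : \sum_(h <= n < m.+1) a n <= S.
  rewrite /S [leRHS](@big_cat_nat _ _ _ m.+1)/=; [|lia|lia].
  by rewrite lerDl big_nat_cond sumr_ge0// => k /andP[/andP[mk _] _]; apply: a0; lia.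
have S2 : \sum_(h <= n < m.+1) a (2 * n)%N <= S.
  rewrite big_nat_recr//=; have -> : S = \sum_(h <= k < 2 * m) a k + a (2 * m)%N.
    by rewrite /S big_nat_recr//=; lia.
  rewrite lerD2r (le_trans (sum_even_le _ _))// => [k hk|]; first by apply: a0; lia.
  rewrite [leRHS](@big_cat_nat _ _ _ (2 * h))/=; [|lia|lia].
  by rewrite lerDr big_nat_cond sumr_ge0// => k /andP[/andP[hk _] _]; apply: a0; lia.
move: H; rewrite sumr_const_nat -mulr_sumr big_split/= => H.
have H2 : a m *+ (m.+1 - h) <= K * (S + S).
  by rewrite (le_trans H)// ler_wpM2l// ?lerD//; lra.
have H3 : m%:R * a m <= 2 * (a m *+ (m.+1 - h)).
  rewrite -[a m *+ _]mulr_natr mulrCA [leRHS]mulrC -natrM ler_wpM2r ?a0//.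
  by rewrite ler_nat /h; lia.
lra.
Qed.

Lemma NBVS_power_window (a : nat -> R) r : 1 <= r -> NBVS a ->
  exists2 K : R, 0 < K & forall n m, (1 <= n)%N -> (n <= m <= 2 * n)%N ->
    a m `^ r <= K * (a n `^ r + a (2 * n)%N `^ r).
Proof.
move=> r1 aN; have [K K1 aK] := NBVS_block aN; have [a0 _] := aN.
exists (K `^ r * 2 `^ (r - 1)).
  by rewrite mulr_gt0// powR_gt0//; lra.
move=> n m n1 nm.
have an := a0 n n1; have a2n : 0 <= a (2 * n)%N by apply: a0; lia.
have am : 0 <= a m by apply: a0; lia.
apply: (@le_trans _ _ ((K * (a n + a (2 * n)%N)) `^ r)).
  apply: ge0_ler_powR; rewrite ?nnegrE//; [lra| |exact: (aK n n1).2].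
  by rewrite mulr_ge0 ?addr_ge0//; lra.
rewrite powRM ?addr_ge0//; last lra.
by rewrite -mulrA ler_wpM2l ?powR_ge0// powRD_le.
Qed.

(** A monotone function regular along the powers of two varies by a bounded
    factor over every interval $[x, 2x]$. *)
Lemma lam_comparable (lam : R -> R) : pos_monotone_from1 lam -> dyadic_regular lam ->
  exists2 L : R, 1 <= L & forall x y, 1 <= x -> x <= y -> y <= 2 * x ->
    lam x <= L * lam y /\ lam y <= L * lam x.
Proof.
move=> [l0 lmon] [K1 [K2 [K10 lK]]].
have K1n0 : K1 != 0 by rewrite gt_eqF.
have K20 : 0 <= K2.
  have [_ H] := lK 0%N.
  have p1 : 0 < lam (2 ^+ 1) by apply: l0; rewrite expr1; lra.
  have p0 : 0 < lam (2 ^+ 0) by apply: l0; rewrite expr0.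
  by rewrite -(pmulr_lge0 K2 p0) (le_trans (ltW p1) H).
exists (1 + K2 ^+ 2 + K1^-1 ^+ 2).
  by have := sqr_ge0 K2; have := sqr_ge0 K1^-1; lra.
move=> x y x1 xy y2.
have [n /andP[nx xn]] : exists n, 2 ^+ n <= x < 2 ^+ n.+1.
  have x0 : 0 <= x by lra.
  have /andP[tx xt] := truncn_itv x0.
  have m1 : (1 <= Num.truncn x)%N.
    rewrite -ltnS -(@ltr_nat R); exact: le_lt_trans xt.
  exists (trunc_log 2 (Num.truncn x)).
  have /andP[b1 b2] := trunc_log_bounds (isT : (1 < 2)%N) m1; apply/andP; split.
    by rewrite (le_trans _ tx)// -natrX ler_nat.
  by rewrite (lt_le_trans xt)// -natrX ler_nat.
have p1 k : 1 <= 2 ^+ k :> R by rewrite -natrX ler1n expn_gt0.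
have lx := l0 x x1; have ly := l0 y (le_trans x1 xy).
have yn : y <= 2 ^+ n.+2 by rewrite exprS; lra.
have xn' := ltW xn.
have [H1 H2] := lK n; have [H3 H4] := lK n.+1.
have A : lam (2 ^+ n.+2) <= K2 ^+ 2 * lam (2 ^+ n).
  by rewrite (le_trans H4)// expr2 -mulrA ler_wpM2l.
have B : lam (2 ^+ n) <= K1^-1 ^+ 2 * lam (2 ^+ n.+2).
  have : K1 ^+ 2 * lam (2 ^+ n) <= lam (2 ^+ n.+2).
    by rewrite (le_trans _ H3)// expr2 -mulrA ler_wpM2l// ltW.
  move/(ler_wpM2l (sqr_ge0 K1^-1)); rewrite mulrA -exprMn mulVf// expr1n mul1r//.
have := mulr_gt0 (lt_le_trans ltr01 (_ : 1 <= 1 + K2 ^+ 2)) lx.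
have sK1 := sqr_ge0 K1^-1; have sK2 := sqr_ge0 K2.
have P1 := mulr_ge0 sK1 (ltW lx); have P2 := mulr_ge0 sK2 (ltW lx).
have P3 := mulr_ge0 sK1 (ltW ly); have P4 := mulr_ge0 sK2 (ltW ly).
move=> _; case: lmon => lmon.
  have M1 := lmon _ _ x1 xy; have M2 := lmon _ _ (p1 n) nx.
  have M3 := lmon _ _ (le_trans x1 xy) yn.
  have := ler_wpM2l sK2 M2; split; lra.
have M1 := lmon _ _ x1 xy; have M2 := lmon _ _ (p1 n) nx.
have M3 := lmon _ _ (le_trans x1 xy) yn.
have := ler_wpM2l sK1 M3; split; lra.
Qed.

End nbvs.

(** * Changes of variable over a period *)

Section change_of_variable.
Context {R : realType}.
Local Notation mu := (@lebesgue_measure R).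
Local Notation II := (`[(- (@pi R))%R, (@pi R)]%classic).

Lemma measurable_shift (t : R) : measurable_fun [set: R] (fun x : R => x + t).
Proof. exact: measurable_funD. Qed.

Lemma lebesgue_measure_shift (t : R) (A : set R) : measurable A ->
  pushforward mu ((fun x : R => x + t) : _ -> measurableTypeR R) A = mu A.
Proof.
move=> mA; apply/esym/lebesgue_measure_unique => //=.
  exact: measurable_shift.
move=> mt _ [[a b]] _ <-.
rewrite /pushforward (_ : _ @^-1` _ = `]a - t, b - t]%classic).
  by rewrite !lebesgue_measure_itv/= !lte_fin ltrD2r; case: ifP => // _; congr EFin; lra.
by apply/seteqP; split => x /=; rewrite !in_itv/= => /andP[? ?]; apply/andP; split; lra.
Qed.

Lemma ge0_integral_shift (t : R) (D : set R) (f : R -> \bar R) : measurable D ->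
  measurable_fun [set: R] f -> (forall x, 0 <= f x)%E ->
  (\int[mu]_(x in D) f x = \int[mu]_(x in (fun x : R => x + t)%R @^-1` D) f (x + t)%R)%E.
Proof.
move=> mD mf f0.
have mfD : measurable_fun D f by exact: measurable_funS mf.
have f0' : {in D, forall y, 0 <= f y}%E by move=> y _.
rewrite -[RHS](@ge0_integral_pushforward _ _ (measurableTypeR R) (measurableTypeR R) R
  _ (measurable_shift t) mu D f mD mfD f0').
apply: eq_measure_integral; first exact: measurable_shift.
move=> mt A mA _; apply: esym; exact: lebesgue_measure_shift.
Qed.

(** Reflection over an arbitrary domain. *)
Lemma ge0_integral_oppD (D : set R) (f : R -> \bar R) : measurable D ->
  measurable_fun [set: R] f -> (forall x, 0 <= f x)%E ->
  (\int[mu]_(x in D) f x = \int[mu]_(x in (fun x : R => - x)%R @^-1` D) f (- x)%R)%E.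
Proof.
move=> mD mf f0.
have mfD : measurable_fun D f by exact: measurable_funS mf.
have f0' : {in D, forall y, 0 <= f y}%E by move=> y _.
have mopp : measurable_fun [set: R] (fun x : R => - x) by exact: oppr_measurable.
rewrite -[RHS](@ge0_integral_pushforward _ _ (measurableTypeR R) (measurableTypeR R) R
  _ mopp mu D f mD mfD f0').
apply: eq_measure_integral => A mA _.
apply: esym.
exact: lebesgue_measureN.
Qed.

Lemma ge0_integral_opp (f : R -> \bar R) :
  measurable_fun [set: R] f -> (forall x, 0 <= f x)%E ->
  (\int[mu]_(x in II) f (- x)%R = \int[mu]_(x in II) f x)%E.
Proof.
move=> mf f0; rewrite [RHS](ge0_integral_oppD _ mf f0)//; congr (integral _ _ _).
by apply/seteqP; split => x /=; rewrite !in_itv/= => /andP[? ?]; apply/andP; split; lra.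
Qed.

Lemma ge0_integral_periodic (f : R -> \bar R) (t : R) :
  measurable_fun [set: R] f -> (forall x, 0 <= f x)%E ->
  (forall x, f (x + pi *+ 2)%R = f x) ->
  (\int[mu]_(x in II) f (x + t)%R = \int[mu]_(x in II) f x)%E.
Proof.
(* the case of a translation to the right gives the other one *)
wlog : f t / 0 <= t.
  move=> H mf f0 fper; have [t0|t0] := leP 0 t; first exact: H.
  rewrite -(H (fun x => f (x + t)) (- t)); [|lra| |by []|].
  - by apply: eq_integral => x _; rewrite subrK.
  - exact: (measurableT_comp mf (measurable_shift t)).
  - by move=> x; rewrite addrAC.
move=> t0 mf f0 fper.
have := pi_gt0 R; set P : R := pi *+ 2 => pi0.
have PE : P = 2 * pi by rewrite /P; lra.
have mfS (D : set R) : measurable_fun D f by exact: measurable_funS mf.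
have mft (D : set R) s : measurable_fun D (fun x : R => f (x + s)%R).
  by apply: measurable_funTS; exact: (measurableT_comp mf (measurable_shift s)).
(* it suffices to treat translations by at most one period *)
wlog tP : t t0 / t <= P.
  move=> H.
  have [n tn] : exists n, t <= P *+ n.
    have tP0 : 0 <= t / P by rewrite divr_ge0//; lra.
    have /andP[_] := truncn_itv tP0.
    rewrite ltr_pdivrMr; last lra.
    by move=> /ltW tn; exists (Num.truncn (t / P)).+1; rewrite -mulr_natl.
  elim: n t t0 tn => [|n IH] t t0 tn; first by apply: H; rewrite // mulr0n in tn; lra.
  have [tP|Pt] := leP t P; first exact: H.
  have -> : (fun x => f (x + t)%R) = (fun x => f (x + (t - P))%R).
    by apply/funext => x; rewrite -(fper (x + (t - P))); congr f; rewrite -/P; lra.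
  by apply: IH; [lra|rewrite mulrS in tn; lra].
pose A := `](- pi)%R, (- pi + t)%R]%classic : set R.
pose B := `](- pi + t)%R, pi]%classic : set R.
pose C := `]pi, (pi + t)%R]%classic : set R.
have closed0 (g : R -> \bar R) (a b : R) : measurable_fun setT g ->
    (\int[mu]_(x in `[a, b]) g x = \int[mu]_(x in `]a, b]) g x)%E.
  by move=> mg; rewrite integral_itv_obnd_cbnd//; exact: measurable_funS mg.
rewrite !closed0//.
have -> : (\int[mu]_(x in `](- pi)%R, pi]) f (x + t)%R = \int[mu]_(x in B `|` C) f x)%E.
  have mBC : measurable (B `|` C) by apply: measurableU; exact: measurable_itv.
  rewrite [RHS](ge0_integral_shift t mBC mf f0).
  congr (integral _ _ _); apply/seteqP; split; rewrite /B /C => x /=; rewrite !in_itv/=.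
    move=> /andP[x1 x2]; have [xp|xp] := leP ((x : R) + t) pi; [left|right];
      by apply/andP; split; lra.
  by case=> /andP[x1 x2]; apply/andP; split; lra.
have -> : `](- pi)%R, pi]%classic = A `|` B.
  apply/seteqP; split; rewrite /A /B => x /=; rewrite !in_itv/=.
    move=> /andP[x1 x2]; have [xp|xp] := leP (x : R) (- pi + t); [left|right];
      by apply/andP; split; lra.
  by case=> /andP[x1 x2]; apply/andP; split; lra.
have splitU (X Y : set R) : measurable X -> measurable Y -> [disjoint X & Y] ->
    (\int[mu]_(x in X `|` Y) f x = \int[mu]_(x in X) f x + \int[mu]_(x in Y) f x)%E.
  by move=> mX mY XY; apply: ge0_integral_setU => //; exact: mfS.
rewrite (splitU B C) ?(splitU A B); try exact: measurable_itv; first last.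
- rewrite disj_set2E; apply/eqP/seteqP; split; rewrite /A /B /C => x //=.
  by rewrite !in_itv/= => -[/andP[? ?] /andP[? ?]]; lra.
- rewrite disj_set2E; apply/eqP/seteqP; split; rewrite /A /B /C => x //=.
  by rewrite !in_itv/= => -[/andP[? ?] /andP[? ?]]; lra.
rewrite addeC; congr (_ + _)%E.
rewrite (ge0_integral_shift P)//; last exact: measurable_itv.
have -> : (fun x : R => x + P) @^-1` C = A.
  apply/seteqP; split; rewrite /A /C => x /=; rewrite !in_itv/= => /andP[? ?];
    by apply/andP; split; lra.
by apply: eq_integral => x _; rewrite fper.
Qed.

Lemma integral_shift_periodic (f : R -> \bar R) (t : R) :
  measurable_fun [set: R] f ->
  (forall x, f (x + pi *+ 2)%R = f x) ->
  (\int[mu]_(x in II) f (x + t)%R = \int[mu]_(x in II) f x)%E.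
Proof.
move=> mf fper; rewrite [LHS]integralE [RHS]integralE; congr (_ - _)%E.
- rewrite -(ge0_integral_periodic t (measurable_funepos mf) (funepos_ge0 f)).
    by apply: eq_integral => x _; rewrite !unlock.
  by move=> x; rewrite unlock fper.
- rewrite -(ge0_integral_periodic t (measurable_funeneg mf) (funeneg_ge0 f)).
    by apply: eq_integral => x _; rewrite !unlock.
  by move=> x; rewrite unlock fper.
Qed.

Lemma integral_opp (f : R -> \bar R) : measurable_fun [set: R] f ->
  (\int[mu]_(x in II) f (- x)%R = \int[mu]_(x in II) f x)%E.
Proof.
move=> mf; rewrite [LHS]integralE [RHS]integralE; congr (_ - _)%E.
- rewrite -(ge0_integral_opp (measurable_funepos mf) (funepos_ge0 f)).
  by apply: eq_integral => x _; rewrite !unlock.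
- rewrite -(ge0_integral_opp (measurable_funeneg mf) (funeneg_ge0 f)).
  by apply: eq_integral => x _; rewrite !unlock.
Qed.

Lemma integrable_shift_periodic (f : R -> R) (t : R) :
  measurable_fun [set: R] f -> periodic f (pi *+ 2) ->
  mu.-integrable II (EFin \o f) -> mu.-integrable II (EFin \o (fun x => f (x + t))).
Proof.
move=> mf fper /integrableP[_ fi]; apply/integrableP; split.
  apply/measurable_EFinP; apply: measurable_funTS.
  exact: (measurableT_comp mf (measurable_shift t)).
rewrite (ge0_integral_periodic (f := fun x => `|(f x)%:E|%E) t)//.
- by apply: measurableT_comp => //; exact/measurable_EFinP.
- by move=> x; rewrite fper.
Qed.

Lemma integrable_opp (f : R -> R) : measurable_fun [set: R] f ->
  mu.-integrable II (EFin \o f) -> mu.-integrable II (EFin \o (fun x => f (- x))).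
Proof.
move=> mf /integrableP[_ fi]; apply/integrableP; split.
  apply/measurable_EFinP; apply: measurable_funTS.
  exact: (measurableT_comp mf).
rewrite (ge0_integral_opp (f := fun x => `|(f x)%:E|%E))//.
by apply: measurableT_comp => //; exact/measurable_EFinP.
Qed.

Lemma integrable_bounded (D : set R) (f g : R -> R) M : measurable D ->
  mu.-integrable D (EFin \o f) -> measurable_fun D g ->
  (forall x, D x -> `|g x| <= M) ->
  mu.-integrable D (EFin \o (fun x => f x * g x)).
Proof.
move=> mD fi mg gM.
apply: (@le_integrable _ _ _ mu D mD _ (fun x => M%:E * (f x)%:E)%E).
- apply/measurable_EFinP; apply: measurable_funM => //.
  by apply/measurable_EFinP; case/integrableP: fi.
- move=> x Dx; rewrite /= lee_fin !normrM [leRHS]mulrC ler_wpM2l//.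
  by rewrite (le_trans (gM x Dx)) // ler_norm.
- exact: integrableZl.
Qed.

End change_of_variable.

(** * Uniqueness of Fourier coefficients *)

Section uniqueness.
Context {R : realType}.
Local Notation mu := (@lebesgue_measure R).
Local Notation II := (`[(- (@pi R))%R, (@pi R)]%classic).
Implicit Types (h g : R -> R) (k n : nat) (u x : R).

Lemma measurable_cos_affine (D : set R) (a b : R) :
  measurable_fun D (fun x : R => cos (a * x + b)).
Proof.
apply: measurable_funTS; apply: continuous_measurable_fun => x.
apply: (@continuous_comp _ _ _ (fun x : R => a * x + b) cos).
  by apply: cvgD; [exact: mulrl_continuous|exact: cvg_cst].
exact: continuous_cos.
Qed.

Lemma measurable_cos_nat (D : set R) k : measurable_fun D (fun x : R => cos (k%:R * x)).
Proof.
have -> : (fun x : R => cos (k%:R * x)) = (fun x => cos (k%:R * x + 0)).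
  by apply/funext => x; rewrite addr0.
exact: measurable_cos_affine.
Qed.

Lemma measurable_II : measurable II. Proof. exact: measurable_itv. Qed.

(** Integrable functions on $[-\pi,\pi]$ all of whose Fourier coefficients
    vanish. The arbitrary phase [th] covers sines and cosines together. *)
Definition fourier_null h := mu.-integrable II (EFin \o h) /\
  forall k (th : R), \int[mu]_(x in II) (h x * cos (k%:R * x + th)) = 0.

Lemma integrable_mul_cos h (a b : R) : mu.-integrable II (EFin \o h) ->
  mu.-integrable II (EFin \o (fun x => h x * cos (a * x + b))).
Proof.
move=> hi; apply: (integrable_bounded (M := 1) measurable_II hi).
  exact: measurable_cos_affine.
by move=> x _; exact: cos_max.
Qed.

Lemma integrableD_fun h g : mu.-integrable II (EFin \o h) ->
  mu.-integrable II (EFin \o g) -> mu.-integrable II (EFin \o (fun x => h x + g x)).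
Proof.
move=> hi gi; rewrite (_ : EFin \o _ = ((EFin \o h) \+ (EFin \o g))%E)//.
exact: integrableD.
Qed.

Lemma integrableZ_fun h (c : R) : mu.-integrable II (EFin \o h) ->
  mu.-integrable II (EFin \o (fun x => c * h x)).
Proof.
move=> hi; rewrite (_ : EFin \o _ = (fun x => c%:E * (EFin \o h) x)%E)//.
exact: integrableZl.
Qed.

Lemma fourier_nullD h g : fourier_null h -> fourier_null g ->
  fourier_null (fun x => h x + g x).
Proof.
move=> [hi h0] [gi g0]; split; first exact: integrableD_fun.
move=> k th; under eq_Rintegral do rewrite mulrDl.
by rewrite RintegralD ?h0 ?g0 ?addr0//; exact: integrable_mul_cos.
Qed.

Lemma fourier_nullZ h (c : R) : fourier_null h -> fourier_null (fun x => c * h x).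
Proof.
move=> [hi h0]; split; first exact: integrableZ_fun.
move=> k th; under eq_Rintegral do rewrite -mulrA.
by rewrite RintegralZl ?h0 ?mulr0//; exact: integrable_mul_cos.
Qed.

Lemma fourier_null_mul_cos h (c : R) : fourier_null h ->
  fourier_null (fun x => h x * cos (x - c)).
Proof.
move=> [hi h0]; split.
  have -> : (fun x => h x * cos (x - c)) = (fun x => h x * cos (1 * x + - c)).
    by apply/funext => x; rewrite mul1r.
  exact: integrable_mul_cos.
case=> [|k] th.
  transitivity (\int[mu]_(x in II) (cos th * (h x * cos (1%:R * x + (- c))))).
    by apply: eq_Rintegral => x _; rewrite mul0r add0r mul1r; ring.
  by rewrite RintegralZl ?h0 ?mulr0//; exact: integrable_mul_cos.
transitivity (\int[mu]_(x in II) (2^-1 * (h x * cos (k.+2%:R * x + (th - c))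
    + h x * cos (k%:R * x + (th + c))))).
  apply: eq_Rintegral => x _.
  have -> : k.+2%:R * x + (th - c) = (k.+1%:R * x + th) + (x - c).
    by rewrite -(natr1 k.+1); ring.
  have -> : k%:R * x + (th + c) = (k.+1%:R * x + th) - (x - c).
    by rewrite -(natr1 k); ring.
  have prod2 (A B : R) : cos (A + B) + cos (A - B) = 2 * (cos A * cos B).
    by rewrite cosD cosB; ring.
  by rewrite -mulrDr prod2; field.
rewrite RintegralZl//; last by apply: integrableD_fun; exact: integrable_mul_cos.
by rewrite RintegralD ?h0 ?addr0 ?mulr0//; exact: integrable_mul_cos.
Qed.

(** Multipliers that preserve the vanishing of all Fourier coefficients; they
    form an algebra containing the translates of the cosine. *)
Definition null_multiplier g := forall h, fourier_null h -> fourier_null (fun x => h x * g x).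

Lemma null_multiplier_cst (c : R) : null_multiplier (fun=> c).
Proof.
move=> h hn; have -> : (fun x => h x * c) = (fun x => c * h x).
  by apply/funext => x; rewrite mulrC.
exact: fourier_nullZ.
Qed.

Lemma null_multiplierD g1 g2 : null_multiplier g1 -> null_multiplier g2 ->
  null_multiplier (fun x => g1 x + g2 x).
Proof.
move=> m1 m2 h hn.
have -> : (fun x => h x * (g1 x + g2 x)) = (fun x => h x * g1 x + h x * g2 x).
  by apply/funext => x; rewrite mulrDr.
by apply: fourier_nullD; [exact: m1|exact: m2].
Qed.

Lemma null_multiplierM g1 g2 : null_multiplier g1 -> null_multiplier g2 ->
  null_multiplier (fun x => g1 x * g2 x).
Proof.
move=> m1 m2 h hn.
have -> : (fun x => h x * (g1 x * g2 x)) = (fun x => h x * g1 x * g2 x).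
  by apply/funext => x; rewrite mulrA.
exact: (m2 _ (m1 _ hn)).
Qed.

Lemma null_multiplierX g n : null_multiplier g -> null_multiplier (fun x => g x ^+ n).
Proof.
move=> m; elim: n => [|n IH].
  have -> : (fun x => g x ^+ 0) = (fun=> 1) by apply/funext => x; rewrite expr0.
  exact: null_multiplier_cst.
have -> : (fun x => g x ^+ n.+1) = (fun x => g x * g x ^+ n).
  by apply/funext => x; rewrite exprS.
exact: null_multiplierM.
Qed.

(** Polynomials with values in $[0,1]$ on $[0,1]$ that tend there to the
    indicator function of $[0,1/2)$, off the point $1/2$. *)
Definition step_poly n u : R := (1 - u ^+ n) ^+ (2 ^ n).

Lemma step_poly01 n u : 0 <= u <= 1 -> 0 <= step_poly n u <= 1.
Proof.
move=> /andP[u0 u1]; have un : 0 <= u ^+ n <= 1 by rewrite exprn_ge0//= exprn_ile1.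
by rewrite exprn_ge0 ?exprn_ile1//; lra.
Qed.

Lemma step_poly_ge n u : 0 <= u <= 1 -> 1 - (2 * u) ^+ n <= step_poly n u.
Proof.
move=> /andP[u0 u1]; have un : 0 <= u ^+ n <= 1 by rewrite exprn_ge0//= exprn_ile1.
have bern (y : R) m : 0 <= y <= 1 -> 1 - m%:R * y <= (1 - y) ^+ m.
  move=> /andP[y0 y1]; elim: m => [|m IH]; first by rewrite expr0 mul0r subr0.
  have my : 0 <= m%:R * (y * y) by rewrite !mulr_ge0.
  have y1' : 0 <= 1 - y by lra.
  by have := ler_wpM2l y1' IH; rewrite exprS -natr1; lra.
by rewrite exprMn -natrX; exact: bern.
Qed.

Lemma step_poly_le n u : 0 < u <= 1 -> step_poly n u <= ((2 * u)^-1) ^+ n.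
Proof.
move=> /andP[u0 u1]; have un : 0 <= u ^+ n <= 1.
  by have u0' := ltW u0; rewrite exprn_ge0//= exprn_ile1.
have bern (y : R) m : 0 <= y <= 1 -> (1 - y) ^+ m * (1 + m%:R * y) <= 1.
  move=> /andP[y0 y1]; elim: m => [|m IH]; first by rewrite expr0 mul0r addr0 mulr1.
  have y1' : 0 <= 1 - y by lra.
  apply: le_trans IH; rewrite exprSr -mulrA ler_wpM2l ?exprn_ge0//.
  have my : 0 <= m%:R * (y * y) by rewrite !mulr_ge0.
  by have := mulr_ge0 y0 y0; rewrite -natr1; lra.
have un0 : 0 < (2 * u) ^+ n by rewrite exprn_gt0; lra.
rewrite exprVn -[leRHS]mul1r ler_pdivlMr//.
apply: le_trans (bern _ (2 ^ n)%N un); rewrite /step_poly ler_wpM2l//.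
  by rewrite exprn_ge0//; lra.
by rewrite exprMn natrX lerDr.
Qed.

Lemma step_poly_cvg1 u : 0 <= u < 1 / 2 -> step_poly n u @[n --> \oo] --> (1 : R).
Proof.
move=> /andP[u0 u1]; have u01 : 0 <= u <= 1 by lra.
apply: (@squeeze_cvgr _ _ _ _ (fun n => 1 - (2 * u) ^+ n) (fun=> 1)).
- apply: nearW => n; rewrite step_poly_ge//=.
  by have /andP[] := step_poly01 n u01.
- rewrite -[X in _ --> X]subr0; apply: cvgB; first exact: cvg_cst.
  by apply: cvg_expr; rewrite ger0_norm; lra.
- exact: cvg_cst.
Qed.

Lemma step_poly_cvg0 u : 1 / 2 < u <= 1 -> step_poly n u @[n --> \oo] --> (0 : R).
Proof.
move=> /andP[u0 u1]; have u01 : 0 <= u <= 1 by lra.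
apply: (@squeeze_cvgr _ _ _ _ (fun=> 0) (fun n => ((2 * u)^-1) ^+ n)).
- apply: nearW => n; rewrite step_poly_le ?andbT; last lra.
  by have /andP[] := step_poly01 n u01.
- exact: cvg_cst.
- apply: cvg_expr; rewrite ger0_norm ?invr_ge0 ?invf_lt1; lra.
Qed.

Lemma cos_lt_window (d y : R) : 0 <= d <= pi -> d < `|y| < 2 * pi - d -> cos y < cos d.
Proof.
move=> /andP[d0 dpi] /andP[y1 y2]; rewrite -(cos_norm y).
have [yp|yp] := leP `|y| pi.
  by rewrite ltr_cos// ?in_itv/=; lra.
have -> : cos `|y| = cos (2 * pi - `|y|).
  have -> : 2 * pi - `|y| = - `|y| + pi *+ 2 by ring.
  by rewrite cosD2pi cosN.
by rewrite ltr_cos// ?in_itv/=; lra.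
Qed.

(** The interval $[-\pi, b]$ is the set where $\cos(x-c)\ge\cos d$, for [c] its
    midpoint and [d] its half-length; its indicator function is thus, off
    finitely many points, a bounded limit of trigonometric polynomials, obtained
    by composing [step_poly] with an affine function of $\cos(x-c)$. *)
Lemma fourier_null_interval h (b : R) : - pi < b < pi -> fourier_null h ->
  (\int[mu]_(x in `[(- pi)%R, b]) (h x)%:E = 0)%E.
Proof.
move=> /andP[b1 b2] hn; have [hi _] := hn.
pose c := (b - pi) / 2; pose d := (b + pi) / 2.
have d01 : 0 <= d <= pi by rewrite /d; lra.
pose u x := (1 + (cos d - cos (x - c)) / 2) / 2 : R.
have u01 x : 0 <= u x <= 1.
  have := cos_le1 d; have := cos_geN1 d; have := cos_le1 (x - c).
  by have := cos_geN1 (x - c); rewrite /u; lra.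
have um : null_multiplier u.
  have -> : u = (fun x => (1 / 2 + cos d / 4) + (- (1 / 4)) * cos (x - c)).
    by apply/funext => x; rewrite /u; lra.
  apply: null_multiplierD; first exact: null_multiplier_cst.
  apply: null_multiplierM; first exact: null_multiplier_cst.
  by move=> g; exact: fourier_null_mul_cos.
have sm n : null_multiplier (fun x => step_poly n (u x)).
  apply: null_multiplierX.
  have -> : (fun x => 1 - u x ^+ n) = (fun x => 1 + (- 1) * u x ^+ n).
    by apply/funext => x; rewrite mulN1r.
  apply: null_multiplierD; first exact: null_multiplier_cst.
  apply: null_multiplierM; first exact: null_multiplier_cst.
  exact: null_multiplierX.
have int0 n : (\int[mu]_(x in II) (h x * step_poly n (u x))%:E = 0)%E.
  have [si s0] := sm n h hn.
  have := s0 0%N 0; rewrite /Rintegral; under eq_integral do rewrite mul0r add0r cos0 mulr1.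
  move=> E; have fin : (\int[mu]_(x in II) (h x * step_poly n (u x))%:E)%E \is a fin_num.
    exact: integrable_fin_num.
  by rewrite -(fineK fin) E.
pose f (n : nat) x := (h x * step_poly n (u x))%:E.
pose f' := (EFin \o h) \_ `[(- pi)%R, b].
have [] := @dominated_convergence _ _ _ mu II measurable_II f f' (fun x => `|(h x)%:E|%E).
- by move=> n; have [/integrableP[]] := sm n h hn.
- apply: (measurable_funS measurableT) => //; apply/(measurable_restrictT _ _).1 => //.
  apply: measurable_funS (measurable_int _ hi) => //= x /=.
  by rewrite !in_itv/= => /andP[-> xb]/=; lra.
- have Z : mu.-negligible [set - pi; pi; b].
    apply/negligibleP; first by apply: measurableU; [apply: measurableU|]; exact: measurable_set1.
    by apply: countable_lebesgue_measure0; exact: finite_set_countable.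
  apply: negligibleS Z => x /=; apply: contra_notP => xZ /itvP xI.
  have x1 : - pi < x by rewrite lt_neqAle xI andbT; apply/eqP => E; apply: xZ; left; left.
  have x2 : x < pi by rewrite lt_neqAle xI andbT; apply/eqP => E; apply: xZ; left; right.
  have x3 : x != b by apply/eqP => E; apply: xZ; right.
  rewrite /f /f' patchE; case: ifPn => xb.
    have {xb x3} xb : x < b.
      by rewrite lt_neqAle x3; move: xb; rewrite inE/= in_itv/= => /andP[].
    rewrite /= -[X in _ --> X%:E]mulr1; apply: cvg_EFin; first exact: nearW.
    apply: cvgM; first exact: cvg_cst.
    apply: step_poly_cvg1; have /andP[-> _]/= := u01 x.
    suff : cos d < cos (x - c) by rewrite /u; lra.
    have xcd : `|x - c| < d by rewrite ltr_norml /c /d; apply/andP; split; lra.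
    rewrite -(cos_norm (x - c)) ltr_cos// in_itv/= ?normr_ge0//=.
    by case/andP: d01 => _; apply: le_trans; exact: ltW.
  have {xb x3} xb : b < x.
    move: xb; rewrite notin_setE/= in_itv/= (ltW x1)/= => /negP; rewrite -ltNge//.
  have -> : point = (h x * 0)%:E :> \bar R by rewrite mulr0.
  apply: cvg_EFin; first exact: nearW.
  apply: cvgM; first exact: cvg_cst.
  apply: step_poly_cvg0; have /andP[_ ->]/= := u01 x; rewrite andbT.
  suff : cos (x - c) < cos d by rewrite /u; lra.
  by apply: cos_lt_window => //; rewrite ger0_norm /c /d; lra.
- exact: integrable_abse.
- apply: aeW => x n _; rewrite /f lee_fin normrM ler_piMr//.
  by have /andP[s0 s1] := step_poly01 n (u01 x); rewrite ger0_norm.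
move=> _ _; under eq_fun do rewrite int0.
move=> /(cvg_unique (@ereal_hausdorff R) (cvg_cst 0%E)) /esym.
rewrite /f' -integral_mkcondr => <-; congr (integral _ _ _).
apply/esym/setIidr => x /=; rewrite !in_itv/= => /andP[-> xb]/=; lra.
Qed.

(** An integrable function on a period all of whose Fourier coefficients vanish
    is zero almost everywhere: its integrals over intervals vanish, and the
    Lebesgue differentiation theorem applies. *)
Lemma fourier_null_ae h : fourier_null h -> {ae mu, forall x, II x -> h x = 0}.
Proof.
move=> hn; have [hi _] := hn.
pose h0 := h \_ II.
have h0l : locally_integrable [set: R] h0 by exact: integrable_locally.
have Z : mu.-negligible [set - pi; pi].
  apply/negligibleP; first by apply: measurableU; exact: measurable_set1.
  by apply: countable_lebesgue_measure0; exact: finite_set_countable.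
have Z' : {ae mu, forall x, x != - pi /\ x != pi}.
  apply: negligibleS Z => x /=; apply: contra_notP => xZ.
  by split; apply/eqP => E; apply: xZ; [left|right].
move: (lebesgue_differentiation h0l) Z'; apply: (@filterS2 _ _ (ae_filter_ringOfSetsType mu)) => x lx [x1 x2] /= /[dup] xI /itvP xI'.
have {}x1 : - pi < x by rewrite lt_neqAle eq_sym x1 xI'.
have {}x2 : x < pi by rewrite lt_neqAle x2 xI'.
pose F y := \int[mu]_(t in [set` Interval (BLeft (- pi)) (BRight y)]) h0 t.
have F0 y : - pi < y < pi -> F y = 0.
  move=> /[dup] yp /andP[y1 y2]; rewrite /F.
  have -> : \int[mu]_(t in `[- pi, y]) h0 t = \int[mu]_(t in `[- pi, y]) h t.
    apply: eq_Rintegral => t; rewrite inE/= in_itv/= => /andP[t1 t2].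
    by rewrite /h0 patchE mem_set//= in_itv/= t1/=; lra.
  by rewrite /Rintegral fourier_null_interval.
have [] := @FTC1_lebesgue_pt R h0 (BLeft (- pi)) x pi x2 _ _ lx.
- apply: eq_integrable hi => //= t tI; by rewrite /h0 patchE tI.
- exact: x1.
move=> _; rewrite -/F /h0 patchE mem_set// => <-.
have F0x : \forall y \near x, F y = cst 0 y.
  have /near_in_itvoo : x \in `]- pi, pi[ by rewrite in_itv/= x1.
  by apply: filterS => y; rewrite in_itv/= => yp; exact: F0.
by rewrite derive1E (near_eq_derive _ F0x) derive_cst.
Qed.

End uniqueness.

(** * The integral of the peak *)

Section peak_integral.
Context {R : realType}.
Local Notation mu := (@lebesgue_measure R).
Local Notation II := (`[(- (@pi R))%R, (@pi R)]%classic).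
Local Notation I0 := (`[0%R, (@pi R)]%classic).

Lemma measurable_I0 : measurable I0. Proof. exact: measurable_itv. Qed.

Lemma continuous_peak N : continuous (@peak R N).
Proof.
move=> x; apply: cvgM; first exact: cvg_cst.
apply: cvgV; first by rewrite gt_eqF// peak_den_gt0.
apply: cvgD; first exact: cvg_cst.
apply: cvgM; first exact: cvg_cst.
apply: cvg_norm.
apply: (@continuous_comp _ _ _ (fun x : R => x / 2) sin).
  exact: mulrr_continuous.
exact: continuous_sin.
Qed.

Lemma measurable_peak N (D : set R) : measurable_fun D (peak N).
Proof. by apply: measurable_funTS; apply: continuous_measurable_fun; exact: continuous_peak. Qed.

Lemma integral_powR_affine (c q b : R) : 0 < c -> 1 < q -> 0 < b ->
  (\int[mu]_(x in `[0%R, b]) ((1 + c * x) `^ (- q))%:E <= ((c * (q - 1))^-1)%:E)%E.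
Proof.
move=> c0 q1 b0.
have pos (x : R) : 0 <= x -> 0 < 1 + c * x by move=> x0; rewrite ltr_pwDl// mulr_ge0// ltW.
pose F x := (c * (1 - q))^-1 * (1 + c * x) `^ (1 - q).
have dF (x : R) : 0 <= x -> is_derive x 1 F ((1 + c * x) `^ (- q)).
  move=> x0.
  have H1 : is_derive x 1 (fun y : R => 1 + c * y) c.
    have -> : (fun y : R => 1 + c * y) = cst 1 + c *: id by apply/funext.
    have H := is_deriveD (is_derive_cst (1 : R) x 1) (is_deriveZ c (is_derive_id x (1 : R))).
    by move: H; rewrite add0r [c *: 1]mulr1.
  have H2 := is_derive1_powR (1 - q) (pos x x0).
  have H3 := @is_derive1_comp R (@powR R ^~ (1 - q)) (fun y : R => 1 + c * y) x _ _ H2 H1.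
  have -> : F = (c * (1 - q))^-1 *: ((@powR R ^~ (1 - q)) \o (fun y : R => 1 + c * y)).
    by apply/funext.
  apply: is_derive_eq; rewrite /GRing.scale/=.
  have -> : 1 - q - 1 = - q by lra.
  by field; lra.
have cF (x : R) : 0 <= x -> {for x, continuous F}.
  by move=> x0; apply: differentiable_continuous; apply/derivable1_diffP; have [] := dF x x0.
rewrite (@continuous_FTC2 _ _ F _ _ b0).
- rewrite -EFinB lee_fin /F mulr0 addr0 powR1.
  have -> : (c * (1 - q))^-1 = - (c * (q - 1))^-1.
    by rewrite -invrN -mulrN opprB.
  have K0 : 0 <= (c * (q - 1))^-1 by rewrite invr_ge0 mulr_ge0; lra.
  by have := mulr_ge0 K0 (powR_ge0 (1 + c * b) (1 - q)); lra.
- apply: continuous_in_subspaceT => x; rewrite inE/= in_itv/= => /andP[x0 _].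
  apply: (@continuous_comp _ _ _ (fun y : R => 1 + c * y) (@powR R ^~ (- q))).
    by apply: cvgD; [exact: cvg_cst|exact: mulrl_continuous].
  apply: differentiable_continuous; apply/derivable1_diffP.
  by have [] := is_derive1_powR (- q) (pos x x0).
- split.
  + by move=> x; rewrite in_itv/= => /andP[x0 _]; have [] := dF x (ltW x0).
  + by apply: cvg_at_right_filter; exact: cF.
  + by apply: cvg_at_left_filter; apply: cF; exact: ltW.
- move=> x; rewrite in_itv/= => /andP[x0 _].
  by rewrite derive1E; have [_ ->] := dF x (ltW x0).
Qed.

Lemma ge0_integral_fold (g : R -> \bar R) : measurable_fun [set: R] g ->
  (forall x, 0 <= g x)%E ->
  (\int[mu]_(x in II) g x = \int[mu]_(x in I0) g x + \int[mu]_(x in I0) g (- x)%R)%E.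
Proof.
move=> mg g0; have pi0 := pi_gt0 R.
have mgS (D : set R) : measurable_fun D g by exact: measurable_funS mg.
have -> : II = `[(- (@pi R))%R, 0%R[%classic `|` I0.
  apply/seteqP; split => x /=; rewrite !in_itv/=.
    move=> /andP[x1 x2]; have [x0|x0] := leP 0 (x : R); [right|left];
      by apply/andP; split; lra.
  by case=> /andP[x1 x2]; apply/andP; split; lra.
rewrite ge0_integral_setU//; [|exact: mgS|]; last first.
  rewrite disj_set2E; apply/eqP/seteqP; split => x //=.
  by rewrite !in_itv/= => -[/andP[? ?] /andP[? ?]]; lra.
rewrite addeC; congr (_ + _)%E.
rewrite integral_itv_bndo_bndc; last exact: mgS.
rewrite (ge0_integral_oppD _ mg g0)//.
congr (integral _ _ _); apply/seteqP; split => x /=; rewrite !in_itv/=;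
  by move=> /andP[? ?]; apply/andP; split; lra.
Qed.

(** The constant in the bound of the integral of the [q]-th power of [peak]. *)
Definition peak_const (q : R) : R := 16 * 2 `^ q / (q - 1).

Lemma peak_const_gt0 q : 1 < q -> 0 < peak_const q.
Proof. by move=> q1; rewrite /peak_const divr_gt0 ?mulr_gt0 ?powR_gt0//; lra. Qed.

Lemma integral_peak_powR (N : nat) (q : R) : (0 < N)%N -> 1 < q ->
  (\int[mu]_(x in II) (peak N x `^ q)%:E <= (peak_const q * N%:R `^ (q - 1))%:E)%E.
Proof.
move=> N0 q1; have q0 : 0 < q by lra.
have pi0 := pi_gt0 R.
have Nr0 : (0 : R) < N%:R by rewrite ltr0n.
have mp (D : set R) : measurable_fun D (fun x => (peak N x `^ q)%:E).
  apply/measurable_EFinP; apply: (@measurableT_comp _ _ _ _ _ _ (@powR R ^~ q)).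
    exact: measurable_powR.
  exact: measurable_peak.
rewrite ge0_integral_fold//; last by move=> x; rewrite lee_fin powR_ge0.
under [X in (_ + X)%E]eq_integral do rewrite peakN.
have H : (\int[mu]_(x in I0) (peak N x `^ q)%:E
    <= (8 * 2 `^ q / (q - 1) * N%:R `^ (q - 1))%:E)%E.
  have c0 : (0 : R) < N%:R / 4 by rewrite divr_gt0.
  apply: (@le_trans _ _ (\int[mu]_(x in I0)
      (((2 * N%:R) `^ q)%:E * ((1 + N%:R / 4 * x) `^ (- q))%:E))%E).
    apply: ge0_le_integral => //.
    - by move=> x _; rewrite lee_fin powR_ge0.
    - exact: mp.
    - apply/measurable_EFinP; apply: measurable_funM => //.
      apply: (@measurableT_comp _ _ _ _ _ _ (@powR R ^~ (- q))); first exact: measurable_powR.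
      apply: measurable_funD => //; exact: measurable_funM.
    - move=> x /=; rewrite in_itv/= => /andP[x0 xpi]; rewrite -EFinM lee_fin /peak.
      have d0 : 0 < 1 + N%:R / 4 * x by rewrite ltr_pwDl// mulr_ge0// ltW.
      rewrite powRN -(powR_inv1 (powR_ge0 _ _)) powRAC -powRM ?mulr_ge0 ?powR_ge0//.
      rewrite powR_inv1; last exact: ltW.
      apply: ge0_ler_powR; rewrite ?nnegrE; [exact: ltW|exact: (peak_ge0 N x)| |].
        by rewrite mulr_ge0 ?mulr_ge0// invr_ge0 ltW.
      rewrite ler_wpM2l ?mulr_ge0// lef_pV2 ?posrE ?peak_den_gt0// lerD2l.
      rewrite -mulrA ler_wpM2l//.
      have := @sin_ge_half R (x / 2); have -> : 0 <= x / 2 <= pi / 2 by lra.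
      by move=> /(_ isT) s; rewrite (le_trans _ (ler_norm _))//; lra.
  rewrite ge0_integralZl//; last 2 first.
  - apply/measurable_EFinP.
    apply: (@measurableT_comp _ _ _ _ _ _ (@powR R ^~ (- q))); first exact: measurable_powR.
    apply: measurable_funD => //; exact: measurable_funM.
  - by move=> x _; rewrite lee_fin powR_ge0.
  apply: (@le_trans _ _ (((2 * N%:R) `^ q)%:E * (((N%:R / 4) * (q - 1))^-1)%:E)%E).
    by rewrite lee_wpmul2l ?lee_fin ?powR_ge0// integral_powR_affine.
  rewrite -EFinM lee_fin powRM// -(mulr_powRB1 (x := N%:R) (p := q))//.
  set A := 2 `^ q; set B := N%:R `^ (q - 1).
  have AB : 0 <= A * B by rewrite mulr_ge0 ?powR_ge0.
  have -> : A * (N%:R * B) * (N%:R / 4 * (q - 1))^-1 = 4 * (A * B / (q - 1)).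
    by field; rewrite !gt_eqF//; lra.
  have -> : 8 * A / (q - 1) * B = 8 * (A * B / (q - 1)) by ring.
  by rewrite ler_wpM2r ?divr_ge0//; lra.
apply: (le_trans (leeD H H)).
by rewrite -EFinD lee_fin /peak_const; lra.
Qed.

(** Hölder's inequality on the period $[-\pi,\pi]$. *)
Lemma hoelder_period (f g : R -> R) (p q : R) :
  measurable_fun [set: R] f -> measurable_fun [set: R] g ->
  0 < p -> 0 < q -> p^-1 + q^-1 = 1 ->
  (\int[mu]_(x in II) `|f x * g x|%:E
    <= (\int[mu]_(x in II) (`|f x| `^ p)%:E) `^ p^-1
       * (\int[mu]_(x in II) (`|g x| `^ q)%:E) `^ q^-1)%E.
Proof.
move=> mf mg p0 q0 pq.
have mII : measurable II by exact: measurable_itv.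
have mres (h : R -> R) : measurable_fun [set: R] h -> measurable_fun [set: R] (h \_ II).
  by move=> mh; apply/(measurable_restrictT _ _).1 => //; exact: measurable_funS mh.
have := @hoelder _ _ _ mu (f \_ II) (g \_ II) p q (mres _ mf) (mres _ mg) p0 q0 pq.
rewrite Lnorm1 unlock.
have E (h : R -> R) (s : R) : s != 0 ->
  (\int[mu]_x (`|(h \_ II) x|%:E `^ s) = \int[mu]_(x in II) (`|h x| `^ s)%:E)%E.
  move=> s0; rewrite [RHS]integral_mkcond; apply: eq_integral => x _.
  rewrite poweR_EFin !patchE; case: ifPn => // _.
  by rewrite normr0 powR0.
rewrite /= !E ?gt_eqF//; apply: le_trans.
rewrite integral_mkcond le_eqVlt; apply/orP; left; apply/eqP.
apply: eq_integral => x _; rewrite !patchE; case: ifPn => //= _.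
by rewrite mulr0 normr0.
Qed.

End peak_integral.

(** * Second differences *)

Section second_difference.
Context {R : realType}.
Local Notation mu := (@lebesgue_measure R).
Local Notation II := (`[(- (@pi R))%R, (@pi R)]%classic).
Local Notation I0 := (`[0%R, (@pi R)]%classic).
Implicit Types (f : R -> R) (p t : R).

(** The symmetric second difference of step [t]. *)
Definition second_diff f t x : R := f (x + t) + f (x - t) - 2 * f x.

(** The inner integral of [I_int], over the half period $[0,\pi]$. *)
Definition diff_integral f p t : \bar R :=
  (\int[mu]_(x in I0) (`|second_diff f t x| `^ p)%:E)%E.

Lemma measurable_second_diff f t (D : set R) : measurable_fun [set: R] f ->
  measurable_fun D (second_diff f t).
Proof.
move=> mf; apply: measurable_funTS; apply: measurable_funB.
  apply: measurable_funD; first exact: (measurableT_comp mf (measurable_shift t)).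
  exact: (measurableT_comp mf (measurable_shift (- t))).
exact: measurable_funM.
Qed.

Lemma measurable_second_diff_powR f p t (D : set R) : measurable_fun [set: R] f ->
  measurable_fun D (fun x => (`|second_diff f t x| `^ p)%:E).
Proof.
move=> mf; apply/measurable_EFinP; apply: (@measurableT_comp _ _ _ _ _ _ (@powR R ^~ p)).
  exact: measurable_powR.
by apply: measurableT_comp => //; exact: measurable_second_diff.
Qed.

Lemma diff_integral_ge0 f p t : (0 <= diff_integral f p t)%E.
Proof. by apply: integral_ge0 => x _; rewrite lee_fin powR_ge0. Qed.

Lemma measurable_diff_integral f p (D : set R) : measurable_fun [set: R] f ->
  measurable_fun D (diff_integral f p).
Proof.
move=> mf; apply: measurable_funTS.
pose g (z : R * R) : \bar R := (`|second_diff f z.1 z.2| `^ p * \1_I0 z.2)%:E.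
have mfc (h : R * R -> R) : measurable_fun setT h -> measurable_fun setT (f \o h).
  by move=> mh; exact: (measurableT_comp mf mh).
have mg : measurable_fun [set: R * R] g.
  apply/measurable_EFinP; apply: measurable_funM.
    apply: (@measurableT_comp _ _ _ _ _ _ (@powR R ^~ p)); first exact: measurable_powR.
    apply: measurableT_comp => //; apply: measurable_funB.
      apply: measurable_funD; first by apply: mfc; exact: measurable_funD.
      by apply: mfc; exact: measurable_funB.
    by apply: measurable_funM => //; exact: mfc.
  by apply: measurableT_comp => //; exact: measurable_indic.
have g0 z : (0 <= g z)%E by rewrite lee_fin mulr_ge0 ?powR_ge0.
have := @measurable_fun_fubini_tonelli_F _ _ _ _ R mu g mg g0.
congr (measurable_fun _ _); apply/funext => t.
rewrite /fubini_F /diff_integral [RHS]integral_mkcond; apply: eq_integral => x _.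
rewrite /g/= patchE indicE; case: ifPn => xI; first by rewrite mulr1.
by rewrite mulr0.
Qed.

Lemma Lp2pi_integrable p f : 1 < p -> Lp2pi p f -> mu.-integrable II (EFin \o f).
Proof.
move=> p1 [mf fper fi].
have mII : measurable II by exact: measurable_itv.
have mfp : measurable_fun II (fun x => (`|f x| `^ p)%:E).
  apply/measurable_EFinP; apply: measurable_funTS.
  apply: (@measurableT_comp _ _ _ _ _ _ (@powR R ^~ p)); first exact: measurable_powR.
  by apply: measurableT_comp.
apply: (@le_integrable _ _ _ mu II mII _ (fun x => (1 + `|f x| `^ p)%:E)).
- by apply/measurable_EFinP; exact: measurable_funS mf.
- move=> x _; rewrite /= lee_fin [leRHS]ger0_norm ?addr_ge0 ?powR_ge0//.
  have [f1|f1] := leP 1 `|f x|.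
    by rewrite (le_trans (le1r_powR f1 (ltW p1)))// lerDr.
  by rewrite (le_trans (ltW f1))// lerDl powR_ge0.
- apply: (@eq_integrable _ _ _ mu II mII (cst 1%:E \+ (fun x => (`|f x| `^ p)%:E))%E) => //.
  apply: integrableD => //.
    apply: (@continuous_compact_integrable R (cst 1)); first exact: segment_compact.
    by apply: continuous_subspaceT => x; exact: cvg_cst.
  apply/integrableP; split => //.
  apply: le_lt_trans fi; apply: ge0_le_integral => //=.
  - by apply/measurable_EFinP; apply: measurableT_comp => //; exact/measurable_EFinP.
  - by move=> x _; rewrite lee_fin ger0_norm// powR_ge0.
Qed.

End second_difference.

(** * Fourier coefficients of second differences *)

Section fourier.
Context {R : realType}.
Local Notation mu := (@lebesgue_measure R).
Local Notation II := (`[(- (@pi R))%R, (@pi R)]%classic).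
Local Notation I0 := (`[0%R, (@pi R)]%classic).
Implicit Types (f F : R -> R) (a : nat -> R) (p t th : R) (k : nat).

Lemma cos_periodicn x k th :
  cos (k%:R * (x + pi *+ 2) + th) = cos (k%:R * x + th) :> R.
Proof.
have -> : k%:R * (x + pi *+ 2) + th = (k%:R * x + th) + (pi *+ 2) *+ k.
  by rewrite -mulr_natl; ring.
by rewrite (periodicn (@cosD2pi R)).
Qed.

(** The Fourier coefficients of a cosine series, in all phases at once. *)
Lemma cosine_series_coef f a k th : mu.-integrable II (EFin \o f) ->
  cosine_series_of f a ->
  \int[mu]_(x in II) (f x * cos (k%:R * x + th))
    = if (k == 0)%N then 0 else pi * a k * cos th.
Proof.
move=> fi [f0 fc fs].
have pi0 : pi != 0 :> R by rewrite gt_eqF// pi_gt0.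
have ci (c : R) : mu.-integrable II (EFin \o (fun x => f x * cos (k%:R * x + c))).
  exact: integrable_mul_cos.
have cE : \int[mu]_(x in II) (f x * cos (k%:R * x + 0))
    = if (k == 0)%N then 0 else pi * a k.
  case: k {ci} => [|k] /=.
    rewrite -[RHS]f0; apply: eq_Rintegral => x _.
    by rewrite mul0r addr0 cos0 mulr1.
  rewrite -fc// mulrA divff// mul1r.
  by apply: eq_Rintegral => x _; rewrite addr0.
have sE : \int[mu]_(x in II) (f x * cos (k%:R * x + - (pi / 2))) = 0.
  case: k {ci cE} => [|k] /=.
    transitivity (\int[mu]_(x in II) (0 * f x)).
      by apply: eq_Rintegral => x _; rewrite mul0r add0r cosN cos_pihalf mulrC.
    by rewrite RintegralZl// mul0r.
  transitivity (\int[mu]_(x in II) (f x * sin (k.+1%:R * x))).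
    by apply: eq_Rintegral => x _; rewrite cosBpihalf.
  have := fs k.+1 isT => /(congr1 (fun z => pi * z)).
  by rewrite mulrA divff// mul1r mulr0.
transitivity (\int[mu]_(x in II) (cos th * (f x * cos (k%:R * x + 0))
    + (- sin th) * (f x * cos (k%:R * x + - (pi / 2))))).
  by apply: eq_Rintegral => x _; rewrite addr0 cosBpihalf cosD; ring.
rewrite RintegralD//; [|exact: integrableZ_fun|exact: integrableZ_fun].
rewrite !RintegralZl// cE sE mulr0 addr0.
by case: ifP => _; rewrite ?mulr0// mulrC.
Qed.

Lemma integral_shift_cos f t k th : measurable_fun [set: R] f -> periodic f (pi *+ 2) ->
  \int[mu]_(x in II) (f (x + t) * cos (k%:R * x + th))
    = \int[mu]_(x in II) (f x * cos (k%:R * x + (th - k%:R * t))).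
Proof.
move=> mf fper; rewrite /Rintegral; congr fine.
rewrite -[RHS](@integral_shift_periodic _ (fun x => (f x * cos (k%:R * x + (th - k%:R * t)))%:E) t).
- apply: eq_integral => x _; congr (_ * cos _)%:E; ring.
- by apply/measurable_EFinP; apply: measurable_funM => //; exact: measurable_cos_affine.
- by move=> x; rewrite fper cos_periodicn.
Qed.

Lemma cosine_series_even f a : measurable_fun [set: R] f ->
  mu.-integrable II (EFin \o f) -> cosine_series_of f a ->
  {ae mu, forall x, II x -> f x - f (- x) = 0}.
Proof.
move=> mf fi fa; apply: fourier_null_ae.
have fi' := integrable_opp mf fi.
have Zi : mu.-integrable II (EFin \o (fun x => (- 1) * f (- x))) by exact: integrableZ_fun.
have E : (fun x => f x - f (- x)) = (fun x => f x + (- 1) * f (- x)).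
  by apply/funext => x; rewrite mulN1r.
rewrite E; split; first exact: integrableD_fun.
move=> k th; under eq_Rintegral do rewrite mulrDl.
rewrite RintegralD//; [|exact: integrable_mul_cos|exact: integrable_mul_cos].
under [X in _ + X = _]eq_Rintegral do rewrite -mulrA.
rewrite RintegralZl//; last exact: integrable_mul_cos.
have -> : \int[mu]_(x in II) (f (- x) * cos (k%:R * x + th))
    = \int[mu]_(x in II) (f x * cos (k%:R * x + (- th))).
  rewrite /Rintegral; congr fine.
  rewrite -[RHS](@integral_opp _ (fun x => (f x * cos (k%:R * x + - th))%:E)).
    by apply: eq_integral => x _; rewrite -(cosN (k%:R * x + th)); congr (_ * cos _)%:E; ring.
  by apply/measurable_EFinP; apply: measurable_funM => //; exact: measurable_cos_affine.
by rewrite !(cosine_series_coef _ _ fi fa) cosN; case: ifP => _; ring.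
Qed.

(** A $2\pi$-periodic function vanishing almost everywhere on a period has the
    same property after any translation. *)
Lemma ae_periodic_shift F t : measurable_fun [set: R] F -> periodic F (pi *+ 2) ->
  {ae mu, forall x, II x -> F x = 0} -> {ae mu, forall x, II x -> F (x + t) = 0}.
Proof.
move=> mF Fper F0.
have mII : measurable II by exact: measurable_itv.
have mE (G : R -> R) : measurable_fun [set: R] G -> measurable_fun II (EFin \o G).
  by move=> mG; apply/measurable_EFinP; exact: measurable_funS mG.
have mFt : measurable_fun [set: R] (fun x => F (x + t)).
  exact: (measurableT_comp mF (measurable_shift t)).
have I1 : (\int[mu]_(x in II) `|(F x)%:E| = 0)%E.
  apply/(ae_eq_integral_abs mu mII (mE _ mF)).
  by move: F0; apply: (@filterS _ _ (ae_filter_ringOfSetsType mu)) => x /= F0 /F0 ->.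
have I2 : (\int[mu]_(x in II) `|(F (x + t))%:E| = 0)%E.
  rewrite -[RHS]I1 -[RHS](@ge0_integral_periodic _ (fun x => `|(F x)%:E|%E) t)//.
  - by apply: measurableT_comp => //; exact/measurable_EFinP.
  - by move=> x; rewrite Fper.
move/(ae_eq_integral_abs mu mII (mE _ mFt)) : I2.
by apply: (@filterS _ _ (ae_filter_ringOfSetsType mu)) => x /= H /H [].
Qed.

(** The function is even almost everywhere, so that its second differences have
    the same integral over both halves of the period. *)
Lemma second_diff_integral_period f a p t : 1 < p -> Lp2pi p f -> cosine_series_of f a ->
  (\int[mu]_(x in II) (`|second_diff f t x| `^ p)%:E = 2%:E * diff_integral f p t)%E.
Proof.
move=> p1 fp fa; have [mf fper _] := fp; have fi := Lp2pi_integrable p1 fp.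
rewrite ge0_integral_fold; last 2 first.
- exact: measurable_second_diff_powR.
- by move=> x; rewrite lee_fin powR_ge0.
have -> : (2%:E * diff_integral f p t = diff_integral f p t + diff_integral f p t)%E.
  by rewrite mule_natl mule2n.
suff -> : (\int[mu]_(x in I0) (`|second_diff f t (- x)%R| `^ p)%:E
    = diff_integral f p t)%E by [].
pose F x := f x - f (- x).
have mF : measurable_fun [set: R] F.
  by apply: measurable_funB => //; exact: (measurableT_comp mf).
have Fper : periodic F (pi *+ 2).
  by move=> x; rewrite /F fper opprD -(fper (- x - pi *+ 2)) subrK.
have F0 : {ae mu, forall x, II x -> F x = 0} := cosine_series_even mf fi fa.
have F1 := ae_periodic_shift t mF Fper F0.
have F2 := ae_periodic_shift (- t) mF Fper F0.
apply: ge0_ae_eq_integral => //.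
- have m1 : measurable_fun [set: R] (fun x => (`|second_diff f t x| `^ p)%:E).
    exact: measurable_second_diff_powR.
  have m2 : measurable_fun [set: R] (fun x : R => - x) by exact: oppr_measurable.
  by apply: measurable_funTS; exact: (measurableT_comp m1 m2).
- exact: measurable_second_diff_powR.
move: F0 F1 F2; apply: (@filterS3 _ _ (ae_filter_ringOfSetsType mu)) => x F0 F1 F2 xI.
have xII : II x by move: xI; rewrite /= !in_itv/= => /andP[? ?]; apply/andP; split; lra.
move/(_ xII)/eqP : F0; rewrite subr_eq0 => /eqP F0.
move/(_ xII)/eqP : F1; rewrite subr_eq0 opprD => /eqP F1.
move/(_ xII)/eqP : F2; rewrite subr_eq0 opprD opprK => /eqP F2.
congr (`|_| `^ _)%:E; rewrite /second_diff -F0 -F1 -F2; lra.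
Qed.

Lemma integrable_second_diff f t : measurable_fun [set: R] f -> periodic f (pi *+ 2) ->
  mu.-integrable II (EFin \o f) -> mu.-integrable II (EFin \o second_diff f t).
Proof.
move=> mf fper fi.
have H1 := integrable_shift_periodic t mf fper fi.
have H2 := integrable_shift_periodic (- t) mf fper fi.
have H3 : mu.-integrable II (EFin \o (fun x => (- 2) * f x)) by exact: integrableZ_fun.
have := integrableD_fun (integrableD_fun H1 H2) H3.
congr (integrable _ _ _); apply/funext => x /=; rewrite /second_diff mulNr//.
Qed.

Lemma second_diff_coef f a p t k : 1 < p -> Lp2pi p f -> cosine_series_of f a ->
  (0 < k)%N ->
  \int[mu]_(x in II) (second_diff f t x * cos (k%:R * x))
    = - (2 * pi) * ((1 - cos (k%:R * t)) * a k).
Proof.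
move=> p1 fp fa k0; have [mf fper _] := fp; have fi := Lp2pi_integrable p1 fp.
have H1 := integrable_mul_cos k%:R 0 (integrable_shift_periodic t mf fper fi).
have H2 := integrable_mul_cos k%:R 0 (integrable_shift_periodic (- t) mf fper fi).
have H3 := integrable_mul_cos k%:R 0 fi.
transitivity (\int[mu]_(x in II) ((f (x + t) * cos (k%:R * x + 0)
    + f (x - t) * cos (k%:R * x + 0)) + (- 2) * (f x * cos (k%:R * x + 0)))).
  by apply: eq_Rintegral => x _; rewrite /second_diff addr0; ring.
rewrite RintegralD//; [|exact: integrableD_fun|exact: integrableZ_fun].
rewrite RintegralD// RintegralZl// !integral_shift_cos//.
rewrite !(cosine_series_coef _ _ fi fa) (gtn_eqF k0).
rewrite cos0 !add0r mulrN opprK cosN; ring.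
Qed.

Lemma second_diff_coef_sum f a p t l u : 1 < p -> Lp2pi p f -> cosine_series_of f a ->
  (0 < l)%N ->
  \int[mu]_(x in II) (second_diff f t x * \sum_(l <= k < u) cos (k%:R * x))
    = - (2 * pi) * \sum_(l <= k < u) (1 - cos (k%:R * t)) * a k.
Proof.
move=> p1 fp fa l0; have [mf fper _] := fp; have fi := Lp2pi_integrable p1 fp.
have si := integrable_second_diff t mf fper fi.
elim: u => [|u IH].
  rewrite big_geq// mulr0.
  transitivity (\int[mu]_(x in II) (0 * f x)).
    by apply: eq_Rintegral => x _; rewrite big_geq// mulr0 mul0r.
  by rewrite RintegralZl// mul0r.
have [ul|lu] := ltnP u l.
  rewrite big_geq// mulr0.
  transitivity (\int[mu]_(x in II) (0 * f x)).
    by apply: eq_Rintegral => x _; rewrite big_geq// mulr0 mul0r.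
  by rewrite RintegralZl// mul0r.
rewrite big_nat_recr//= mulrDr -IH -(second_diff_coef t p1 fp fa); last exact: leq_trans lu.
rewrite -RintegralD//.
- by apply: eq_Rintegral => x _; rewrite big_nat_recr//= mulrDr.
- apply: (integrable_bounded (M := (u - l)%:R)) => //.
    apply: measurable_sum => k.
    exact: measurable_cos_nat.
  move=> x _; rewrite (le_trans (ler_norm_sum _ _ _))//.
  apply: (@le_trans _ _ (\sum_(l <= k < u) 1)); first by apply: ler_sum => k _; exact: cos_max.
  by rewrite sumr_const_nat.
- have := integrable_mul_cos u%:R 0 si.
  by congr (integrable _ _ _); apply/funext => x /=; rewrite addr0.
Qed.

End fourier.

(** * Bound of a coefficient by a second difference *)

Section lower_bound.
Context {R : realType}.
Local Notation mu := (@lebesgue_measure R).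
Local Notation II := (`[(- (@pi R))%R, (@pi R)]%classic).
Local Notation I0 := (`[0%R, (@pi R)]%classic).
Implicit Types (f lam : R -> R) (a : nat -> R) (p r t : R) (k m : nat).

Lemma window_bounds m : (0 < m)%N -> [/\ (0 < uphalf m)%N,
  ((2 * m).+1 - uphalf m <= 2 * m)%N &
  forall k, (uphalf m <= k)%N -> [/\ (0 < k)%N, (m <= 2 * k)%N & (m.+1 <= 4 * k)%N]].
Proof. by move=> m0; split; [lia|lia|move=> k mk; split; lia]. Qed.

(** Hölder's inequality for the product of the second difference with the
    Dirichlet sum over the window $[m/2, 2m]$. The frequencies [k] of the window
    occur with the positive weights $1-\cos kt$, and these are bounded below. *)
Lemma window_sum_le f a p t m : 1 < p -> (0 < m)%N -> NBVS a ->
  Lp2pi p f -> cosine_series_of f a -> m.+1%:R^-1 < t <= m%:R^-1 ->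
  ((\sum_(uphalf m <= k < (2 * m).+1) a k)%:E
    <= ((1 - cos (1 / 4))^-1 * (peak_const (p / (p - 1)) `^ (1 - p^-1) * (4 * m%:R) `^ p^-1))%:E
       * diff_integral f p t `^ p^-1)%E.
Proof.
move=> p1 m0 [a0 _] fp fa /andP[t1 t2]; have [mf fper _] := fp.
have fi := Lp2pi_integrable p1 fp.
have p0 : 0 < p by lra.
have pi0 := pi_gt0 R; have pi2 := pi_ge2 R.
set q := p / (p - 1).
have q1 : 1 < q by rewrite /q ltr_pdivlMr; lra.
have q0 : 0 < q by lra.
have pq : p^-1 + q^-1 = 1 by rewrite /q invf_div; field; lra.
have qV : q^-1 = 1 - p^-1 by lra.
have mr0 : (0 : R) < m%:R by rewrite ltr0n.
set h := uphalf m.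
have [h1 hsize hk] : [/\ (0 < h)%N, ((2 * m).+1 - h <= 2 * m)%N &
    forall k, (h <= k)%N -> [/\ (0 < k)%N, (m <= 2 * k)%N & (m.+1 <= 4 * k)%N]].
  exact: window_bounds.
pose D x : R := \sum_(h <= k < (2 * m).+1) cos (k%:R * x).
set S := \sum_(_ <= _ < _) _; set c0 := 1 - cos (1 / 4).
have c00 : 0 < c0 := one_sub_cos_quarter_gt0.
have mD : measurable_fun [set: R] D.
  apply: measurable_sum => k.
  exact: measurable_cos_nat.
have Dpeak x : `|D x| <= peak (2 * m) x.
  rewrite -[leRHS]mul1r; apply: le_peak => //; rewrite ?mul1r; last exact: dirichlet_bound.
  rewrite (le_trans (ler_norm_sum _ _ _))//.
  apply: (@le_trans _ _ (\sum_(h <= k < (2 * m).+1) 1)).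
    by apply: ler_sum => k _; exact: cos_max.
  by rewrite sumr_const_nat ler_nat.
have S0 : 0 <= S.
  by rewrite /S big_nat_cond sumr_ge0// => k /andP[/andP[/hk[k1 _ _] _] _]; exact: a0.
(* every angle [k t] in the window lies in [1/4, 2], away from the zeros of [1 - cos] *)
have low : c0 * S <= \sum_(h <= k < (2 * m).+1) (1 - cos (k%:R * t)) * a k.
  rewrite mulr_sumr; apply: ler_sum_nat => k /andP[/hk[k1 mk' mk4] km].
  have ak : 0 <= a k by exact: a0.
  rewrite ler_wpM2r// one_sub_cos_ge//; apply/andP; split.
    have t1' : 1 <= m.+1%:R * t.
      by rewrite mulrC -ler_pdivrMr ?ltr0n// mul1r ltW.
    have t0 : 0 <= t by rewrite (le_trans _ (ltW t1))// invr_ge0.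
    have mm : (m.+1%:R : R) <= 4 * k%:R by rewrite -natrM ler_nat.
    by have := ler_wpM2r t0 mm; lra.
  have km' : (k%:R : R) <= 2 * m%:R by rewrite -natrM ler_nat.
  have t0 : 0 <= t by rewrite (le_trans _ (ltW t1))// invr_ge0.
  have := ler_wpM2r t0 km'; have : m%:R * t <= 1.
    by rewrite mulrC -ler_pdivlMr// mul1r.
  lra.
have sD : mu.-integrable II (EFin \o (fun x => second_diff f t x * D x)).
  apply: (integrable_bounded (M := 2 * (2 * m)%:R)) => //.
  - exact: integrable_second_diff.
  - exact: measurable_funS mD.
  - move=> x _; rewrite (le_trans (Dpeak x))// /peak ler_pdivrMr ?peak_den_gt0//.
    by rewrite ler_peMr ?mulr_ge0// lerDl mulr_ge0.
have step1 : ((2 * (c0 * S))%:E <= ((2 * pi) * (c0 * S))%:E)%E.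
  have cS := mulr_ge0 (ltW c00) S0.
  by rewrite lee_fin ler_wpM2r//; lra.
have step2 : (((2 * pi) * (c0 * S))%:E <= \int[mu]_(x in II) `|second_diff f t x * D x|%:E)%E.
  have fin : (\int[mu]_(x in II) `|second_diff f t x * D x|%:E)%E \is a fin_num.
    by have /(integrable_fin_num) := integrable_norm sD; apply.
  rewrite -(fineK fin) lee_fin.
  have := le_normr_Rintegral _ sD; rewrite (second_diff_coef_sum _ _ p1 fp fa h1) => /(_ _) H.
  apply: le_trans (H _); last by [].
  rewrite normrM normrN (ger0_norm (x := 2 * pi)); last lra.
  by rewrite ler_wpM2l ?(le_trans low (ler_norm _))//; lra.
have step3 := hoelder_period (@measurable_second_diff R f t setT mf) mD p0 q0 pq.
have step4 : ((\int[mu]_(x in II) (`|D x| `^ q)%:E) `^ q^-1 <=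
    (peak_const q `^ (1 - p^-1) * (2 * m%:R) `^ p^-1)%:E)%E.
  have H : (\int[mu]_(x in II) (`|D x| `^ q)%:E
      <= (peak_const q * (2 * m)%:R `^ (q - 1))%:E)%E.
    apply: le_trans (integral_peak_powR _ q1); last by rewrite muln_gt0.
    apply: ge0_le_integral => //.
    - apply/measurable_EFinP; apply: measurable_funTS.
      apply: (@measurableT_comp _ _ _ _ _ _ (@powR R ^~ q)); first exact: measurable_powR.
      exact: measurableT_comp.
    - apply/measurable_EFinP; apply: (@measurableT_comp _ _ _ _ _ _ (@powR R ^~ q)).
        exact: measurable_powR.
      exact: measurable_peak.
    - move=> x _; rewrite lee_fin; apply: ge0_ler_powR; rewrite ?nnegrE ?peak_ge0//.
      exact: ltW.
  apply: (@le_trans _ _ ((peak_const q * (2 * m)%:R `^ (q - 1))%:E `^ q^-1)%E).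
    have qV0 : 0 <= q^-1 by rewrite invr_ge0 ltW.
    apply: gt0_ler_poweR; rewrite ?in_itv/= ?andbT ?leey//.
      by rewrite integral_ge0// => x _; rewrite lee_fin powR_ge0.
    by rewrite lee_fin mulr_ge0 ?powR_ge0// ltW// peak_const_gt0.
  rewrite poweR_EFin lee_fin powRM ?powR_ge0//; last by rewrite ltW// peak_const_gt0.
  rewrite qV -powRrM natrM.
  have -> : (q - 1) * (1 - p^-1) = p^-1 by rewrite -qV mulrBl divff ?gt_eqF// mul1r; lra.
  by [].
have step5 : ((\int[mu]_(x in II) (`|second_diff f t x| `^ p)%:E) `^ p^-1
    = (2 `^ p^-1)%:E * diff_integral f p t `^ p^-1)%E.
  by rewrite (second_diff_integral_period t p1 fp fa) poweRM ?diff_integral_ge0// poweR_EFin.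
rewrite step5 in step3.
have step6 := le_trans step1 (le_trans step2 step3).
have P0 : 0 <= peak_const q `^ (1 - p^-1) * (2 * m%:R) `^ p^-1.
  by rewrite mulr_ge0 ?powR_ge0.
set J := (diff_integral f p t `^ p^-1)%E in step6 *.
have J0 : (0 <= J)%E by exact: poweR_ge0.
have {}step6 : ((2 * (c0 * S))%:E <= (2 `^ p^-1 * (peak_const q `^ (1 - p^-1) * (2 * m%:R) `^ p^-1))%:E * J)%E.
  apply: (le_trans step6); rewrite EFinM [leRHS]muleC [leRHS]muleA [(J * _)%E]muleC.
  by rewrite lee_wpmul2l// mule_ge0// lee_fin powR_ge0.
have E4 : 2 `^ p^-1 * (peak_const q `^ (1 - p^-1) * (2 * m%:R) `^ p^-1)
   = peak_const q `^ (1 - p^-1) * (4 * m%:R) `^ p^-1.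
  have -> : 4 * m%:R = 2 * (2 * m%:R) :> R by ring.
  rewrite [in RHS]powRM ?mulr_ge0//; ring.
rewrite E4 in step6.
have J2 : ((c0 * S)%:E <= (peak_const q `^ (1 - p^-1) * (4 * m%:R) `^ p^-1)%:E * J)%E.
  apply: le_trans step6; rewrite lee_fin; have := mulr_ge0 (ltW c00) S0; lra.
have -> : S = c0^-1 * (c0 * S) by rewrite mulrA mulVf ?mul1r// gt_eqF.
rewrite EFinM [X in (_ <= X * _)%E]EFinM -muleA lee_wpmul2l//.
by rewrite lee_fin invr_ge0 ltW.
Qed.

Lemma coef_le_diff_integral a p : 1 < p -> NBVS a -> exists2 C, 0 < C &
  forall f m t, (0 < m)%N -> Lp2pi p f -> cosine_series_of f a ->
  m.+1%:R^-1 < t <= m%:R^-1 ->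
  ((a m)%:E <= (C * m%:R `^ (p^-1 - 1))%:E * diff_integral f p t `^ p^-1)%E.
Proof.
move=> p1 aN; have [K K0 aK] := NBVS_average aN.
set q := p / (p - 1).
have q1 : 1 < q by rewrite /q ltr_pdivlMr; lra.
have c00 : 0 < 1 - cos (1 / 4) :> R := one_sub_cos_quarter_gt0.
exists (K * ((1 - cos (1 / 4))^-1 * (peak_const q `^ (1 - p^-1) * 4 `^ p^-1))).
  by rewrite !mulr_gt0 ?invr_gt0 ?powR_gt0// peak_const_gt0.
move=> f m t m0 fp fa tm.
have mr0 : (0 : R) < m%:R by rewrite ltr0n.
have := window_sum_le p1 m0 aN fp fa tm; rewrite -/q.
set J := (diff_integral f p t `^ p^-1)%E => H.
have {}H : ((m%:R * a m)%:E <= (K * ((1 - cos (1 / 4))^-1 * (peak_const q `^ (1 - p^-1) * (4 * m%:R) `^ p^-1)))%:E * J)%E.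
  apply: (@le_trans _ _ (K * \sum_(uphalf m <= k < (2 * m).+1) a k)%:E).
    by rewrite lee_fin aK.
  by rewrite EFinM [X in (_ <= X * _)%E]EFinM -muleA lee_wpmul2l// lee_fin ltW.
have -> : a m = m%:R^-1 * (m%:R * a m) by rewrite mulrA mulVf ?mul1r// gt_eqF.
apply: (@le_trans _ _ ((m%:R^-1)%:E * ((K * ((1 - cos (1 / 4))^-1 * (peak_const q `^ (1 - p^-1) * (4 * m%:R) `^ p^-1)))%:E * J))%E).
  by rewrite EFinM lee_wpmul2l// lee_fin invr_ge0 ltW.
rewrite muleA -EFinM le_eqVlt; apply/orP; left; apply/eqP; congr (_%:E * _)%E.
have -> : m%:R `^ (p^-1 - 1) = m%:R `^ p^-1 / m%:R :> R.
  by rewrite powRB ?powRr1 ?(ltW mr0)// (gt_eqF mr0) implybT.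
by rewrite powRM ?(ltW mr0)//; ring.
Qed.

End lower_bound.

(** * The lower bound of the integral *)

Section partition.
Context {R : realType}.
Local Notation mu := (@lebesgue_measure R).
Implicit Types (f lam : R -> R) (a : nat -> R) (p r t : R) (k m n : nat).

Lemma powR_comparable (x y e : R) : 0 < x -> x <= y -> y <= 2 * x ->
  x `^ e <= 2 `^ `|e| * y `^ e /\ y `^ e <= 2 `^ `|e| * x `^ e.
Proof.
move=> x0 xy y2; have y0 : 0 < y by exact: lt_le_trans xy.
have two1 : 1 <= 2 `^ `|e| :> R.
  by rewrite -[leLHS](powRr0 2); apply: ler_powR => //; lra.
have pos (z : R) : 0 <= z `^ e by exact: powR_ge0.
have up : forall s (z w : R), 0 <= s -> 0 < z -> z <= w -> z `^ s <= w `^ s.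
  by move=> s z w s0 z0 zw; apply: ge0_ler_powR; rewrite ?nnegrE//; lra.
have [e0|e0] := leP 0 e.
  rewrite (ger0_norm e0) in two1 *.
  have H := up e x y e0 x0 xy; have := up e y (2 * x) e0 y0 y2.
  rewrite powRM ?(ltW x0)// => H2; split => //.
  by rewrite (le_trans H)// ler_peMl.
have e0' : 0 <= - e by lra.
have inv (z : R) : z `^ e = (z `^ (- e))^-1 by rewrite -powRN opprK.
have p' (z : R) : 0 < z -> 0 < z `^ (- e) by move=> z0; exact: powR_gt0.
have H := up (- e) x y e0' x0 xy; have := up (- e) y (2 * x) e0' y0 y2.
rewrite (ltr0_norm e0) in two1 *.
rewrite powRM ?(ltW x0)// => H2.
rewrite !inv; split.
  by rewrite ler_pdivlMr ?p'// mulrC ler_pdivrMr ?p'//.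
have xyV : (y `^ (- e))^-1 <= (x `^ (- e))^-1 by rewrite lef_pV2 ?posrE ?p'.
by rewrite (le_trans xyV)// ler_peMl// invr_ge0 ltW// p'.
Qed.

(** The interval $]0,1]$ is cut along a sequence decreasing from 1 to 0. *)
Lemma integral_unit_partition (u : nat -> R) (g : R -> \bar R) :
  u 0%N = 1 -> (forall n, 0 < u n) -> (forall n, u n.+1 <= u n) ->
  u n @[n --> \oo] --> (0 : R) ->
  measurable_fun (`]0%R, 1%R]%classic : set R) g -> (forall x, 0 <= g x)%E ->
  (\int[mu]_(t in `]0%R, 1%R]) g t = \sum_(n <oo) \int[mu]_(t in `](u n.+1), (u n)]) g t)%E.
Proof.
move=> u0 upos udec ucvg mg g0.
have umon n m : (n <= m)%N -> u m <= u n.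
  elim: m => [|m IH]; first by rewrite leqn0 => /eqP ->.
  rewrite leq_eqVlt => /predU1P[->//|]; rewrite ltnS => /IH.
  exact: le_trans.
have E : `]0%R, 1%R]%classic = \bigcup_n `](u n.+1), (u n)]%classic.
  apply/seteqP; split => [x|x [n _]] /=; rewrite !in_itv/=; last first.
    move=> /andP[x1 x2]; rewrite (lt_trans (upos _) x1)/=.
    by rewrite (le_trans x2)// -u0 umon.
  move=> /andP[x0 x1].
  have ex : exists n, u n < x.
    have : \forall n \near \oo, u n < x.
      by apply: (@cvgr_lt _ _ _ _ _ _ ucvg).
    by move=> [N _ HN]; exists N; apply: HN => /=.
  case: (ex_minnP ex) => -[|m] um mmin; first by move: um; rewrite u0; lra.
  exists m => //=; rewrite in_itv/= um leNgt; apply/negP => /mmin.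
  by rewrite ltnn.
rewrite E ge0_integral_bigcup// -?E//.
apply/trivIsetP => i j _ _; wlog ij : i j / (i < j)%N.
  move=> H ij; have [lt|lt|e] := ltngtP i j; first exact: H.
    by rewrite setIC; apply: H => //; rewrite eq_sym.
  by rewrite e eqxx in ij.
move=> _; apply/seteqP; split => x //=; rewrite !in_itv/= => -[/andP[x1 _] /andP[_ x2]].
by have := umon _ _ ij; lra.
Qed.

Lemma measurable_lam_inv lam : pos_monotone_from1 lam ->
  measurable_fun (`]0%R, 1%R]%classic : set R) (fun t => lam (1 / t)).
Proof.
move=> [_ lmon].
apply: (measurability _ (RGenOInfty.measurableE R)) => //= _ [_ [y ->] <-].
apply: is_interval_measurable => s t /= [].
rewrite !in_itv/= !andbT => /andP[s0 s1] ys [/andP[t0 t1] yt] z /andP[sz zt].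
have z0 : 0 < z by exact: lt_le_trans sz.
have z1 : z <= 1 by exact: le_trans t1.
have V (w : R) : 0 < w -> w <= 1 -> 1 <= 1 / w by move=> w0 w1; rewrite ler_pdivlMr// mul1r.
have Vm (v w : R) : 0 < v -> v <= w -> 1 / w <= 1 / v.
  by move=> v0 vw; rewrite !div1r lef_pV2// posrE//; exact: lt_le_trans vw.
split; first by rewrite in_itv/= z0 z1.
rewrite in_itv/= andbT.
case: lmon => lmon.
  by apply: lt_le_trans yt _; apply: lmon; [exact: V|exact: Vm].
by apply: lt_le_trans ys _; apply: lmon; [exact: V|exact: Vm].
Qed.

(** The integrand of [I_int]. *)
Definition I_integrand f lam r p t : \bar R :=
  ((lam (1 / t) * t `^ (r - 2 - r / p))%:E * diff_integral f p t `^ (r / p))%E.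

Lemma measurable_I_integrand f lam r p : pos_monotone_from1 lam ->
  measurable_fun [set: R] f -> measurable_fun (`]0%R, 1%R]%classic : set R) (I_integrand f lam r p).
Proof.
move=> hl mf; apply: emeasurable_funM.
  apply/measurable_EFinP; apply: measurable_funM; first exact: measurable_lam_inv.
  by apply: measurable_funTS; exact: measurable_powR.
apply: (@measurableT_comp _ _ _ _ _ _ (fun x => x `^ (r / p))%E).
  exact: measurable_poweR.
exact: measurable_diff_integral.
Qed.

Lemma I_integrand_ge0 f lam r p t : pos_monotone_from1 lam -> 0 < t <= 1 ->
  (0 <= I_integrand f lam r p t)%E.
Proof.
move=> [l0 _] /andP[t0 t1]; apply: mule_ge0; last exact: poweR_ge0.
by rewrite lee_fin mulr_ge0 ?powR_ge0// ltW// l0// ler_pdivlMr// mul1r.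
Qed.

Lemma integral_I_partition f lam r p (u : nat -> R) : pos_monotone_from1 lam ->
  measurable_fun [set: R] f ->
  u 0%N = 1 -> (forall n, 0 < u n) -> (forall n, u n.+1 <= u n) ->
  u n @[n --> \oo] --> (0 : R) ->
  I_int f lam r p
    = (\sum_(n <oo) \int[mu]_(t in `](u n.+1), (u n)]) I_integrand f lam r p t)%E.
Proof.
move=> hl mf u0 upos udec ucvg.
(* outside of ]0,1] the integrand has no sign, so that it is first cut off *)
pose g := I_integrand f lam r p \_ `]0%R, 1%R]%classic.
have umon n : u n <= 1 by elim: n => [|n IH]; rewrite ?u0// (le_trans (udec n)).
have -> : I_int f lam r p = (\int[mu]_(t in `]0%R, 1%R]) g t)%E.
  by apply: eq_integral => t tI; rewrite /g patchE tI.
rewrite (@integral_unit_partition u)//.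
- apply: eq_eseriesr => n _; apply: eq_integral => t; rewrite inE/= in_itv/= => /andP[t1 t2].
  rewrite /g patchE mem_set//= in_itv/= (lt_trans (upos _) t1)/=.
  exact: le_trans (umon n).
- apply: (measurable_funS measurableT) => //; apply/(measurable_restrictT _ _).1 => //.
  exact: measurable_I_integrand.
- move=> t; rewrite /g patchE; case: ifPn => // /set_mem/=; rewrite in_itv/= => tI.
  exact: I_integrand_ge0.
Qed.

Lemma nneseries_from1 (h : nat -> R) : (forall n, (0 < n)%N -> 0 <= h n) ->
  (\sum_(1 <= n <oo) (h n)%:E = \sum_(n <oo) (h n.+1)%:E)%E.
Proof.
move=> h0; pose g n := (if n is n'.+1 then h n else 0)%:E.
have -> : (\sum_(1 <= n <oo) (h n)%:E = \sum_(1 <= n <oo) g n)%E.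
  by congr (limn _); apply/funext => n; apply: eq_big_nat => -[].
rewrite -(@nneseries_addn _ g 1); last by case=> [|n]; rewrite lee_fin// h0.
by apply: eq_eseriesr => n _; rewrite addn1.
Qed.

Lemma succ_le_double n : (n.+2 <= 2 * n.+1)%N.
Proof. lia. Qed.

(** The first inequality: $]0,1]$ is cut at the points $1/m$, and on
    $]1/(m+1),1/m]$ the integrand dominates a multiple of $m^2\lambda(m)a_m^r$. *)
Lemma weighted_sum_le_I (p r : R) lam a : 1 < p -> 1 <= r ->
  pos_monotone_from1 lam -> dyadic_regular lam -> NBVS a ->
  exists K : R, 0 < K /\
     forall f : R -> R, Lp2pi p f -> cosine_series_of f a ->
       (weighted_sum lam a r <= K%:E * I_int f lam r p)%E.
Proof.
move=> p1 r1 hl hdy aN; have [a0 _] := aN; have [l0 _] := hl.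
have [C C0 aC] := coef_le_diff_integral p1 aN.
have [L L1 lamL] := lam_comparable hl hdy.
have L0 : 0 < L by lra.
have p0 : 0 < p by lra.
pose e := r - 2 - r / p.
pose K0 : R := C `^ r * (L * 2 `^ `|e|).
have K00 : 0 < K0 by rewrite !mulr_gt0 ?powR_gt0.
exists (2 * K0); split; first by rewrite mulr_gt0.
move=> f fp fa; have [mf _ _] := fp.
rewrite (@integral_I_partition _ _ _ _ (fun n => n.+1%:R^-1))//; last 3 first.
- exact: invr1.
- by move=> n; rewrite lef_pV2 ?posrE// ler_nat.
- exact: cvg_harmonic.
have tpos n t : n.+2%:R^-1 < t <= n.+1%:R^-1 -> 0 < t <= 1.
  move=> /andP[t1 t2]; rewrite (lt_trans _ t1) ?invr_gt0//=.
  by rewrite (le_trans t2)// invf_le1// ler1n.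
rewrite /weighted_sum -nneseriesZl; last first.
  move=> n _; apply: integral_ge0 => t /=; rewrite in_itv/= => tn.
  by apply: I_integrand_ge0 => //; exact: tpos tn.
have lam0 n : 0 <= lam n.+1%:R by rewrite ltW// l0// ler1n.
rewrite nneseries_from1; last first.
  by case=> // n _; rewrite mulr_ge0 ?powR_ge0.
apply: lee_nneseries => [n _ _|n _]; first by rewrite lee_fin mulr_ge0 ?powR_ge0.
set m := n.+1; have m0 : (0 < m)%N by [].
have mr0 : (0 : R) < m%:R by rewrite ltr0n.
have mr1 : (1 : R) <= m%:R by rewrite ler1n.
have am : 0 <= a m by exact: a0.
pose E := `](m.+1%:R^-1 : R), m%:R^-1]%classic.
have mE : measurable E by exact: measurable_itv.
have ES : E `<=` `]0%R, 1%R]%classic by move=> t /=; rewrite !in_itv/= => /tpos.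
have mG : measurable_fun E (I_integrand f lam r p).
  exact: measurable_funS (measurable_I_integrand r p hl mf).
have G0 t : E t -> (0 <= I_integrand f lam r p t)%E.
  by rewrite /E/= in_itv/= => /tpos; exact: I_integrand_ge0.
pose c := lam m%:R * a m `^ r * (m%:R ^+ 2).
have c0 : 0 <= c by rewrite /c mulr_ge0 ?sqr_ge0// mulr_ge0 ?powR_ge0//; exact: lam0.
have pointwise t : E t -> (c%:E <= K0%:E * I_integrand f lam r p t)%E.
  rewrite /E/= in_itv/= => tm; have /andP[t0 t1] := tpos _ _ tm.
  have := aC f m t m0 fp fa tm; case/andP: tm => mt tm.
  set J := diff_integral f p t => H.
  have {}H : ((a m `^ r)%:E <= (C `^ r * m%:R `^ (r / p - r))%:E * J `^ (r / p))%E.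
    have J0 : (0 <= J)%E by exact: diff_integral_ge0.
    have Cm : 0 <= C * m%:R `^ (p^-1 - 1) by rewrite mulr_ge0 ?powR_ge0// ltW.
    have -> : (J `^ (r / p) = (J `^ p^-1) `^ r)%E by rewrite -poweRrM mulrC.
    have -> : C `^ r * m%:R `^ (r / p - r) = (C * m%:R `^ (p^-1 - 1)) `^ r.
      rewrite powRM ?powR_ge0 ?(ltW C0)// -powRrM; congr (_ * _ `^ _).
      by rewrite mulrBl mul1r mulrC.
    rewrite -!poweR_EFin -poweRM ?lee_fin ?poweR_ge0//.
    apply: gt0_ler_poweR; rewrite ?in_itv/= ?leey ?andbT ?lee_fin//; first by lra.
    by rewrite mule_ge0 ?lee_fin ?poweR_ge0.
  have Jr0 : (0 <= J `^ (r / p))%E by exact: poweR_ge0.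
  have tV : m%:R <= 1 / t by rewrite ler_pdivlMr// mulrC -ler_pdivlMr// mul1r.
  have tV2 : 1 / t <= 2 * m%:R.
    rewrite ler_pdivrMr//.
    have m1t : 1 <= m.+1%:R * t.
      by rewrite mulrC -ler_pdivrMr ?ltr0n// mul1r ltW.
    have mm : (m.+1%:R : R) <= 2 * m%:R by rewrite -natrM ler_nat succ_le_double.
    by rewrite (le_trans m1t)// ler_wpM2r// ltW.
  have [lam1 _] := lamL m%:R (1 / t) mr1 tV tV2.
  have [_ pw] : t `^ e <= 2 `^ `|e| * m%:R^-1 `^ e /\ m%:R^-1 `^ e <= 2 `^ `|e| * t `^ e.
    apply: powR_comparable => //.
    rewrite ler_pdivrMr// in tV2.
    by rewrite -[leLHS]mul1r ler_pdivrMr//; lra.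
  have mexp : m%:R `^ (r / p - r) * m%:R ^+ 2 = m%:R^-1 `^ e.
    rewrite -(powR_inv1 (ltW mr0)) -powRrM -powR_mulrn ?(ltW mr0)//.
    rewrite -powRD; last by rewrite (gt_eqF mr0) implybT.
    by congr (_ `^ _); rewrite /e; lra.
  have l1 : 0 <= lam (1 / t) by rewrite ltW// l0// (le_trans mr1).
  apply: (@le_trans _ _ ((lam m%:R * m%:R ^+ 2)%:E * (a m `^ r)%:E)%E).
    by rewrite -EFinM lee_fin /c le_eqVlt; apply/orP; left; apply/eqP; ring.
  apply: (@le_trans _ _ ((lam m%:R * m%:R ^+ 2)%:E *
      ((C `^ r * m%:R `^ (r / p - r))%:E * J `^ (r / p)))%E).
    by rewrite lee_wpmul2l// lee_fin mulr_ge0 ?sqr_ge0//; exact: lam0.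
  rewrite /I_integrand -/J -/e !muleA -!EFinM lee_wpmul2r// lee_fin.
  have -> : lam m%:R * m%:R ^+ 2 * (C `^ r * m%:R `^ (r / p - r))
      = C `^ r * (lam m%:R * m%:R^-1 `^ e) by rewrite -mexp; ring.
  have -> : K0 * (lam (1 / t) * t `^ e)
      = C `^ r * ((L * lam (1 / t)) * (2 `^ `|e| * t `^ e)) by rewrite /K0; ring.
  have lm : 0 <= lam m%:R := lam0 n.
  by rewrite ler_wpM2l ?powR_ge0// ler_pM ?powR_ge0.
have int_le : (\int[mu]_(t in E) c%:E <= K0%:E * \int[mu]_(t in E) I_integrand f lam r p t)%E.
  rewrite -ge0_integralZl// ?lee_fin ?(ltW K00)//.
  apply: ge0_le_integral => //; first exact: measurable_funeM.
have mm : m.+1%:R^-1 < m%:R^-1 :> R by rewrite ltf_pV2 ?posrE// ltr_nat.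
have muE : mu E = (m%:R^-1 - m.+1%:R^-1)%:E.
  by rewrite /E lebesgue_measure_itv/= lte_fin mm -EFinB.
have {}int_le : ((c * (m%:R^-1 - m.+1%:R^-1))%:E
    <= K0%:E * \int[mu]_(t in E) I_integrand f lam r p t)%E.
  apply: le_trans int_le.
  rewrite integral_cst//; change ((c * (m%:R^-1 - m.+1%:R^-1))%:E <= c%:E * mu E)%E.
  by rewrite muE -EFinM.
have -> : (2 * K0)%:E = (2%:E * K0%:E)%E by rewrite EFinM.
rewrite -muleA; apply: (@le_trans _ _ (2%:E * (c * (m%:R^-1 - m.+1%:R^-1))%:E)%E).
  rewrite -EFinM lee_fin /c.
  have S0 : (m.+1%:R : R) != 0 by rewrite gt_eqF.
  have -> : 2 * (lam m%:R * a m `^ r * m%:R ^+ 2 * (m%:R^-1 - m.+1%:R^-1))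
     = lam m%:R * a m `^ r * ((2 * m%:R) / m.+1%:R).
    have E1 : m.+1%:R = m%:R + 1 :> R by rewrite natr1.
    by rewrite E1 in S0 *; field; rewrite S0 gt_eqF.
  rewrite ler_peMr ?mulr_ge0 ?powR_ge0 ?lam0//.
  by rewrite ler_pdivlMr// mul1r -natrM ler_nat succ_le_double.
by rewrite lee_wpmul2l.
Qed.

End partition.

(** * Second differences of dyadic blocks *)

Section blocks.
Context {R : realType}.
Local Notation mu := (@lebesgue_measure R).
Local Notation II := (`[(- (@pi R))%R, (@pi R)]%classic).
Local Notation I0 := (`[0%R, (@pi R)]%classic).
Implicit Types (f lam : R -> R) (a : nat -> R) (p r t x : R) (k m n j J : nat).

(** The part of the cosine series with frequencies in $[2^j, 2^{j+1})$. *)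
Definition dyadic_block a j x : R := \sum_(2 ^ j <= k < 2 * 2 ^ j) a k * cos (k%:R * x).

(** The partial sum of the first [J] dyadic blocks. *)
Definition dyadic_sum a J x : R := \sum_(0 <= j < J) dyadic_block a j x.

(** For a sequence in [NBVS], up to a constant, a bound of both the size and the
    variation of the coefficients over the block $[2^j, 2^{j+1})$. *)
Definition block_size a j : R := a (2 ^ j)%N + a (2 * 2 ^ j)%N.

(** Attenuation of the second difference of step at most $2^{-n}$ on the block
    [j]; the exponent is a truncated subtraction, so that there is none for
    [n <= j]. *)
Definition attenuation n j : R := 4^-1 ^+ (n - j).

Lemma attenuation_ge0 n j : 0 <= attenuation n j.
Proof. by rewrite exprn_ge0. Qed.

Lemma block_size_ge0 a j : NBVS a -> 0 <= block_size a j.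
Proof.
move=> [a0 _]; have j0 : (0 < 2 ^ j)%N by rewrite expn_gt0.
by rewrite addr_ge0 ?a0 ?muln_gt0.
Qed.

Lemma second_diff_block a j t x : second_diff (dyadic_block a j) t x
  = \sum_(2 ^ j <= k < 2 * 2 ^ j) (- (2 * (1 - cos (k%:R * t))) * a k) * cos (k%:R * x).
Proof.
rewrite /second_diff /dyadic_block mulr_sumr -sumrN -!big_split/=.
apply: eq_bigr => k _; have := second_diff_cos k x t => E.
have -> : - (2 * (1 - cos (k%:R * t))) * a k * cos (k%:R * x)
  = a k * (- (2 * (1 - cos (k%:R * t))) * cos (k%:R * x)) by ring.
by rewrite -E; ring.
Qed.

Lemma second_diff_sum a J t x : second_diff (dyadic_sum a J) t x
  = \sum_(0 <= j < J) second_diff (dyadic_block a j) t x.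
Proof. by rewrite /second_diff /dyadic_sum mulr_sumr -sumrN -!big_split. Qed.

Lemma block_variation_le a K N : (0 < N)%N ->
  (\sum_(N <= m < (2 * N).+1) `|a m - a m.+1| <= K * (a N + a (2 * N)%N)) ->
  \sum_(N <= k < (2 * N).-1) `|a k - a k.+1| <= K * (a N + a (2 * N)%N).
Proof.
move=> N0; apply: le_trans.
by rewrite [leRHS](@big_cat_nat _ _ _ (2 * N).-1)/= ?lerDl ?sumr_ge0//; lia.
Qed.

Lemma nat_double_pred N k : (0 < N)%N -> (N <= k < (2 * N).-1)%N ->
  (N <= k.+1 < 2 * N)%N /\ (k.+1 <= 2 * N)%N.
Proof. lia. Qed.

Lemma dyadic_block_le a : NBVS a -> exists2 K, 0 < K & forall j x,
  `|dyadic_block a j x| <= K * block_size a j * peak (2 ^ j) x.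
Proof.
move=> aN; have [K K1 aK] := NBVS_block aN; have [a0 _] := aN.
exists (2 * K) => [|j x]; first lra.
set N := (2 ^ j)%N; have N0 : (0 < N)%N by rewrite expn_gt0.
have [varN coefN] := aK N N0.
have A0 : 0 <= block_size a j := block_size_ge0 j aN.
rewrite -/N in A0.
have KA : 0 <= K * block_size a j by rewrite mulr_ge0//; lra.
have -> : 2 * K * block_size a j = K * block_size a j + K * block_size a j by ring.
apply: block_bound => //.
  move=> k /andP[Nk kN]; rewrite ger0_norm ?a0 ?(leq_trans N0)//.
  by apply: coefN; rewrite Nk ltnW.
exact: block_variation_le varN.
Qed.

(** When the step is below the wavelength of the block, the second difference
    multiplies the coefficients by $-2(1-\cos kt)$, which is of the order of
    $(2^jt)^2$ in size and in variation. *)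
Lemma second_diff_block_small a : NBVS a -> exists2 K, 0 < K & forall j t x,
  0 <= t -> (2 ^ j)%:R * t <= 1 ->
  `|second_diff (dyadic_block a j) t x|
    <= K * ((2 ^ j)%:R * t) ^+ 2 * block_size a j * peak (2 ^ j) x.
Proof.
move=> aN; have [K K1 aK] := NBVS_block aN; have [a0 _] := aN.
exists (20 * K) => [|j t x t0]; first lra.
set N := (2 ^ j)%N; have N0 : (0 < N)%N by rewrite expn_gt0.
have [varN coefN] := aK N N0.
have A0 : 0 <= block_size a j := block_size_ge0 j aN.
have KA : 0 <= K * block_size a j by rewrite mulr_ge0//; lra.
set T := N%:R * t => T1; have T0 : 0 <= T by rewrite mulr_ge0.
have T20 : 0 <= T ^+ 2 by exact: sqr_ge0.
have TKA : 0 <= T ^+ 2 * (K * block_size a j) by rewrite mulr_ge0.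
have kT k : (k <= 2 * N)%N -> k%:R * t <= 2 * T.
  by move=> kN; rewrite /T mulrA -natrM ler_wpM2r// ler_nat.
have kt0 k : 0 <= k%:R * t by rewrite mulr_ge0.
have cosk k : (k <= 2 * N)%N -> 1 - cos (k%:R * t) <= 4 * T ^+ 2.
  move=> kN; rewrite (le_trans (one_sub_cos_le (kt0 k)))//.
  have -> : 4 * T ^+ 2 = (2 * T) ^+ 2 by ring.
  by apply: lerXn2r; rewrite ?nnegrE ?mulr_ge0// kT.
have ak k : (N <= k <= 2 * N)%N -> 0 <= a k <= K * block_size a j.
  move=> /[dup] kN /andP[Nk _]; rewrite a0 ?(leq_trans N0)//=.
  exact: coefN.
rewrite second_diff_block.
have -> : 20 * K * T ^+ 2 * block_size a j
  = 8 * (T ^+ 2 * (K * block_size a j)) + 12 * (T ^+ 2 * (K * block_size a j)) by ring.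
apply: block_bound => //; first by rewrite mulr_ge0.
  move=> k /andP[Nk kN]; have /andP[ak0 akK] : 0 <= a k <= K * block_size a j.
    by apply: ak; rewrite Nk ltnW.
  have c0 := one_sub_cos_ge0 (k%:R * t).
  rewrite mulNr normrN ger0_norm; last by rewrite !mulr_ge0.
  have := ler_pM c0 ak0 (cosk k (ltnW kN)) akK; lra.
apply: (@le_trans _ _ (\sum_(N <= k < (2 * N).-1)
    (8 * T ^+ 2 * `|a k - a k.+1| + 4 * (N%:R * t ^+ 2) * (K * block_size a j)))).
  apply: ler_sum_nat => k /(nat_double_pred N0)[/andP[Nk1 k1N] kN].
  have /andP[ak0 akK] : 0 <= a k.+1 <= K * block_size a j by apply: ak; rewrite Nk1.
  have c0 := one_sub_cos_ge0 (k%:R * t).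
  have ck := cosk k (ltnW (ltnW k1N)).
  have -> : - (2 * (1 - cos (k%:R * t))) * a k - - (2 * (1 - cos (k.+1%:R * t))) * a k.+1
    = - (2 * (1 - cos (k%:R * t)) * (a k - a k.+1))
      + 2 * (cos (k%:R * t) - cos (k.+1%:R * t)) * a k.+1 by ring.
  rewrite (le_trans (ler_normD _ _))// lerD//.
    rewrite normrN normrM ger0_norm ?mulr_ge0//.
    by rewrite ler_wpM2r//; lra.
  rewrite !normrM (ger0_norm ak0) (ger0_norm (x := 2))//.
  have dcos : `|cos (k%:R * t) - cos (k.+1%:R * t)| <= 2 * (N%:R * t ^+ 2).
    apply: (le_trans (cos_diff_le (kt0 k) _)); first by rewrite ler_wpM2r// ler_nat.
    have -> : k.+1%:R * t - k%:R * t = t by rewrite -natr1; ring.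
    have := ler_wpM2l t0 (kT k.+1 kN); rewrite /T; lra.
  have -> : 4 * (N%:R * t ^+ 2) * (K * block_size a j)
     = (2 * (2 * (N%:R * t ^+ 2))) * (K * block_size a j) by ring.
  by rewrite ler_pM ?mulr_ge0// ler_wpM2l.
rewrite big_split/= -mulr_sumr sumr_const_nat -mulr_natl.
have v1 : \sum_(N <= k < (2 * N).-1) `|a k - a k.+1| <= K * block_size a j.
  exact: block_variation_le varN.
have v2 : ((2 * N).-1 - N)%:R * (4 * (N%:R * t ^+ 2) * (K * block_size a j))
    <= 4 * (T ^+ 2 * (K * block_size a j)).
  have -> : 4 * (T ^+ 2 * (K * block_size a j))
     = N%:R * (4 * (N%:R * t ^+ 2) * (K * block_size a j)) by rewrite /T; ring.
  rewrite ler_wpM2r ?mulr_ge0 ?sqr_ge0//; first lra.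
  by rewrite ler_nat; clear; lia.
have := ler_wpM2l T20 v1; lra.
Qed.

(** The three translates of the peak that dominate a second difference. *)
Definition peak3 (N : nat) t x : R := peak N x + peak N (x + t) + peak N (x - t).

Lemma peak3_ge0 N t x : 0 <= peak3 N t x.
Proof. by rewrite !addr_ge0 ?peak_ge0. Qed.

Lemma measurable_peak_shift N t (D : set R) :
  measurable_fun D (fun x => peak N (x + t)).
Proof.
have mp : measurable_fun [set: R] (@peak R N) by exact: measurable_peak.
by apply: measurable_funTS; exact: (measurableT_comp mp (measurable_shift t)).
Qed.

Lemma measurable_peak3 N t (D : set R) : measurable_fun D (peak3 N t).
Proof.
apply: measurable_funTS.
apply: measurable_funD; first apply: measurable_funD; first exact: measurable_peak.
  exact: measurable_peak_shift.
exact: measurable_peak_shift.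
Qed.

Lemma second_diff_block_le a : NBVS a -> exists2 K, 0 < K & forall n j t x,
  0 <= t <= 2^-1 ^+ n ->
  `|second_diff (dyadic_block a j) t x|
    <= K * (attenuation n j * block_size a j * peak3 (2 ^ j) t x).
Proof.
move=> aN; have [K1 K10 H1] := dyadic_block_le aN.
have [K2 K20 H2] := second_diff_block_small aN.
exists (2 * K1 + K2); first lra.
move=> n j t x /andP[t0 tn].
have A0 : 0 <= block_size a j := block_size_ge0 j aN.
have p1 := peak_ge0 (2 ^ j) x; have p2 := peak_ge0 (2 ^ j) (x + t).
have p3 := peak_ge0 (2 ^ j) (x - t).
have [jn|nj] := leqP j n.
  have T1 : (2 ^ j)%:R * t <= 2^-1 ^+ (n - j).
    rewrite -(ler_pM2l (x := 2^-1 ^+ j)) ?exprn_gt0// -exprD subnKC//.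
    by rewrite natrX mulrA -exprMn mulVf// expr1n mul1r.
  have T2 : (2 ^ j)%:R * t <= 1 by rewrite (le_trans T1)// exprn_ile1//; lra.
  have T0 : 0 <= (2 ^ j)%:R * t by rewrite mulr_ge0.
  rewrite (le_trans (H2 j t x t0 T2))//.
  have sq : ((2 ^ j)%:R * t) ^+ 2 <= attenuation n j.
    have -> : attenuation n j = (2^-1 ^+ (n - j)) ^+ 2.
      by rewrite /attenuation -exprM mulnC exprM; congr (_ ^+ _); field.
    by apply: lerXn2r; rewrite ?nnegrE ?exprn_ge0.
  have -> : K2 * ((2 ^ j)%:R * t) ^+ 2 * block_size a j * peak (2 ^ j) x
     = K2 * (((2 ^ j)%:R * t) ^+ 2 * block_size a j * peak (2 ^ j) x) by ring.
  rewrite ler_pM//; first lra.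
  - by rewrite !mulr_ge0// sqr_ge0.
  - lra.
  - rewrite ler_pM ?mulr_ge0 ?sqr_ge0//; first by rewrite ler_wpM2r.
    by rewrite /peak3; lra.
have -> : attenuation n j = 1.
  by rewrite /attenuation (_ : (n - j)%N = 0%N) ?expr0//; apply/eqP; rewrite subn_eq0 ltnW.
rewrite mul1r /second_diff (le_trans (ler_normB _ _))//.
rewrite (le_trans (lerD (ler_normD _ _) (lexx _)))// normrM (ger0_norm (x := 2))//.
have h1 := H1 j x; have h2 := H1 j (x + t); have h3 := H1 j (x - t).
have m1 := mulr_ge0 A0 p1; have m2 := mulr_ge0 A0 p2; have m3 := mulr_ge0 A0 p3.
have n1 := mulr_ge0 (ltW K10) m1; have n2 := mulr_ge0 (ltW K10) m2.
have n3 := mulr_ge0 (ltW K10) m3.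
have o1 := mulr_ge0 (ltW K20) m1; have o2 := mulr_ge0 (ltW K20) m2.
have o3 := mulr_ge0 (ltW K20) m3.
rewrite /peak3; lra.
Qed.

Lemma integral_peak3_powR p : 1 < p -> exists2 K, 0 < K & forall N t, (0 < N)%N ->
  (\int[mu]_(x in I0) (peak3 N t x `^ p)%:E <= (K * N%:R `^ (p - 1))%:E)%E.
Proof.
move=> p1; have p0 : 0 < p by lra.
pose D := 2 `^ (p - 1) : R; have D0 : 0 < D by rewrite powR_gt0.
have c0 := peak_const_gt0 p1.
exists (3 * (D * D + D) * peak_const p).
  by have DD := addr_gt0 (mulr_gt0 D0 D0) D0; apply: mulr_gt0 => //; exact: mulr_gt0.
move=> N t N0.
pose g s x := (peak N (x + s) `^ p)%:E.
have mg s (E : set R) : measurable_fun E (g s).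
  apply: measurable_funTS; apply/measurable_EFinP.
  apply: (@measurableT_comp _ _ _ _ _ _ (@powR R ^~ p)); first exact: measurable_powR.
  exact: measurable_peak_shift.
have g0 s x : (0 <= g s x)%E by rewrite lee_fin powR_ge0.
have gint s : (\int[mu]_(x in I0) g s x <= (peak_const p * N%:R `^ (p - 1))%:E)%E.
  apply: le_trans (integral_peak_powR N0 p1).
  have <- := @ge0_integral_periodic _ (fun x => (peak N x `^ p)%:E) s.
  - apply: ge0_subset_integral => //; first exact: (mg s II).
    move=> x /=; rewrite !in_itv/= => /andP[x0 ->].
    by rewrite andbT (le_trans _ x0)// oppr_le0 pi_ge0.
  - have := mg 0 setT; congr (measurable_fun _ _); apply/funext => x.
    by rewrite /g addr0.
  - by move=> x; rewrite lee_fin powR_ge0.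
  - by move=> x; rewrite peak_periodic.
pose c := D * D + D.
have c_gt0 : 0 < c by rewrite addr_gt0// mulr_gt0.
apply: (@le_trans _ _ (\int[mu]_(x in I0) (c%:E * (g 0%R x + g t x + g (- t)%R x)))%E).
  apply: ge0_le_integral => //.
  - by move=> x _; rewrite lee_fin powR_ge0.
  - apply: measurable_funTS; apply/measurable_EFinP.
    apply: (@measurableT_comp _ _ _ _ _ _ (@powR R ^~ p)); first exact: measurable_powR.
    exact: measurable_peak3.
  - apply: measurable_funeM; apply: emeasurable_funD; last exact: mg.
    by apply: emeasurable_funD; exact: mg.
  - move=> x _; rewrite /g addr0 -!EFinD -EFinM lee_fin /peak3.
    have q1 := peak_ge0 N x; have q2 := peak_ge0 N (x + t); have q3 := peak_ge0 N (x - t).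
    have h1 := powRD_le (ltW p1) (addr_ge0 q1 q2) q3.
    have h2 := ler_wpM2l (ltW D0) (powRD_le (ltW p1) q1 q2).
    have w1 := powR_ge0 (peak N x) p; have w2 := powR_ge0 (peak N (x + t)) p.
    have w3 := powR_ge0 (peak N (x - t)) p.
    have z1 := mulr_ge0 (ltW D0) w1; have z2 := mulr_ge0 (ltW D0) w2.
    have z3 := mulr_ge0 (mulr_ge0 (ltW D0) (ltW D0)) w3.
    by rewrite -/D in h1 h2; rewrite /c; lra.
have mS : measurable_fun I0 (fun x => g 0%R x + g t x)%E.
  by apply: emeasurable_funD; exact: mg.
have mSS : measurable_fun I0 (fun x => g 0%R x + g t x + g (- t)%R x)%E.
  by apply: emeasurable_funD; [exact: mS|exact: mg].
rewrite (ge0_integralZl mu measurable_I0 mSS); last 2 first.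
- by move=> x _; apply: adde_ge0; [apply: adde_ge0|]; exact: g0.
- by rewrite lee_fin ltW.
have gg0 x : I0 x -> (0 <= g 0%R x + g t x)%E.
  by move=> _; apply: adde_ge0; exact: g0.
rewrite (ge0_integralD mu measurable_I0 gg0 mS (fun x _ => g0 (- t)%R x) (mg _ _)).
rewrite (ge0_integralD mu measurable_I0 (fun x _ => g0 0%R x) (mg _ _) (fun x _ => g0 t x) (mg _ _)).
apply: (@le_trans _ _ (c%:E * (3 * (peak_const p * N%:R `^ (p - 1)))%:E)%E).
  rewrite lee_wpmul2l ?lee_fin ?(ltW c_gt0)//.
  apply: (le_trans (leeD (leeD (gint 0) (gint t)) (gint (- t)))).
  by rewrite -!EFinD lee_fin; lra.
by rewrite -EFinM lee_fin le_eqVlt; apply/orP; left; apply/eqP; rewrite /c; ring.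
Qed.

(** The natural $L^p$ size of a block, up to constants. *)
Definition block_norm a p j : R := (2 ^ j)%:R `^ (1 - p^-1) * block_size a j.

Lemma block_norm_ge0 a p j : NBVS a -> 0 <= block_norm a p j.
Proof. by move=> aN; rewrite mulr_ge0 ?powR_ge0// block_size_ge0. Qed.

(** The blocks are combined by Jensen's inequality with the weights
    [attenuation n j * block_norm a p j], which avoids the triangle inequality
    in $L^p$. *)
Lemma diff_integral_dyadic_sum a p : 1 < p -> NBVS a -> exists2 K, 0 < K &
  forall n J t, 0 <= t <= 2^-1 ^+ n ->
  (diff_integral (dyadic_sum a J) p t
    <= (K * (\sum_(0 <= j < J) attenuation n j * block_norm a p j) `^ p)%:E)%E.
Proof.
move=> p1 aN; have [K K0 HK] := second_diff_block_le aN.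
have [D D0 HD] := integral_peak3_powR p1.
have p0 : 0 < p by lra.
exists (K `^ p * D); first by rewrite mulr_gt0 ?powR_gt0.
move=> n J t tn.
pose th j := attenuation n j * block_norm a p j.
pose s j : R := (2 ^ j)%:R `^ (1 - p^-1).
pose y j x := peak3 (2 ^ j) t x / s j.
have N0 j : (0 < 2 ^ j)%N by rewrite expn_gt0.
have Nr j : (0 : R) < (2 ^ j)%:R by rewrite ltr0n.
have s0 j : 0 < s j by rewrite powR_gt0.
have th0 j : 0 <= th j by rewrite mulr_ge0 ?attenuation_ge0 ?block_norm_ge0.
have y0 j x : 0 <= y j x by rewrite divr_ge0 ?peak3_ge0// ltW.
set B := \sum_(0 <= j < J) _; have B0 : 0 <= B by apply: sumr_ge0 => j _; exact: th0.
have pw x : `|second_diff (dyadic_sum a J) t x| `^ p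
    <= K `^ p * B `^ (p - 1) * \sum_(0 <= j < J) th j * y j x `^ p.
  apply: (@le_trans _ _ ((K * \sum_(0 <= j < J) th j * y j x) `^ p)).
    apply: ge0_ler_powR; rewrite ?nnegrE//; first exact: ltW.
      by rewrite mulr_ge0 ?(ltW K0)// sumr_ge0// => j _; rewrite mulr_ge0.
    rewrite second_diff_sum (le_trans (ler_norm_sum _ _ _))// mulr_sumr ler_sum// => j _.
    rewrite (le_trans (HK n j t x tn))// ler_wpM2l ?(ltW K0)//.
    rewrite /th /y /block_norm -/(s j) le_eqVlt; apply/orP; left; apply/eqP.
    by field; rewrite gt_eqF.
  rewrite powRM ?(ltW K0)//; last by rewrite sumr_ge0// => j _; rewrite mulr_ge0.
  by rewrite -mulrA ler_wpM2l ?powR_ge0// jensen_powR// ltW.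
have my j (E : set R) : measurable_fun E (fun x => (y j x `^ p)%:E).
  apply: measurable_funTS; apply/measurable_EFinP.
  apply: (@measurableT_comp _ _ _ _ _ _ (@powR R ^~ p)); first exact: measurable_powR.
  by apply: measurable_funM => //; exact: measurable_peak3.
have yint j : (\int[mu]_(x in I0) (y j x `^ p)%:E <= D%:E)%E.
  have E x : (y j x `^ p)%:E = (((s j)^-1 `^ p)%:E * (peak3 (2 ^ j) t x `^ p)%:E)%E.
    by rewrite -EFinM /y powRM ?peak3_ge0 ?invr_ge0 ?(ltW (s0 j))// mulrC.
  have mp3 : measurable_fun I0 (fun x => (peak3 (2 ^ j) t x `^ p)%:E).
    have := measurable_funeM ((s j `^ p)%:E) (my j I0).
    congr (measurable_fun _ _); apply/funext => x.
    rewrite E muleA -EFinM -powRM ?invr_ge0 ?(ltW (s0 j))// divff ?gt_eqF//.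
    by rewrite powR1 mul1r.
  under eq_integral do rewrite E.
  rewrite ge0_integralZl//; last 2 first.
  - by move=> x _; rewrite lee_fin powR_ge0.
  - by rewrite lee_fin powR_ge0.
  apply: (@le_trans _ _ (((s j)^-1 `^ p)%:E * (D * (2 ^ j)%:R `^ (p - 1))%:E)%E).
    by rewrite lee_wpmul2l ?lee_fin ?powR_ge0// HD.
  rewrite -EFinM lee_fin le_eqVlt; apply/orP; left; apply/eqP.
  have -> : (s j)^-1 `^ p = ((2 ^ j)%:R `^ (p - 1))^-1.
    rewrite -(powR_inv1 (ltW (s0 j))) /s -!powRrM -powRN; congr (_ `^ _).
    by field; rewrite gt_eqF.
  by field; rewrite gt_eqF// powR_gt0.
apply: (@le_trans _ _ (\int[mu]_(x in I0)
    ((K `^ p * B `^ (p - 1))%:E * (\sum_(0 <= j < J) (th j)%:E * (y j x `^ p)%:E)))%E).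
  apply: ge0_le_integral => //.
  - apply: measurable_second_diff_powR; apply: measurable_sum => j.
    apply: measurable_sum => k; apply: measurable_funM => //.
    exact: measurable_cos_nat.
  - by apply: measurable_funeM; apply: emeasurable_sum => j; apply: measurable_funeM; exact: my.
  - move=> x _; under eq_bigr do rewrite -EFinM.
    by rewrite sumEFin -EFinM lee_fin.
rewrite ge0_integralZl//; last 3 first.
- by apply: emeasurable_sum => j; apply: measurable_funeM; exact: my.
- by move=> x _; apply: sume_ge0 => j _; rewrite mule_ge0 ?lee_fin// powR_ge0.
- by rewrite lee_fin mulr_ge0 ?powR_ge0.
rewrite ge0_integral_sum//; last 2 first.
- by move=> j; apply: measurable_funeM; exact: my.
- by move=> j x _; rewrite mule_ge0 ?lee_fin// powR_ge0.
apply: (@le_trans _ _ ((K `^ p * B `^ (p - 1))%:E * (\sum_(0 <= j < J) (th j)%:E * D%:E))%E).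
  rewrite lee_wpmul2l ?lee_fin ?mulr_ge0 ?powR_ge0//.
  apply: lee_sum => j _; rewrite (ge0_integralZl mu measurable_I0 (my j I0)).
  - by rewrite lee_wpmul2l ?lee_fin.
  - by move=> x _; rewrite lee_fin powR_ge0.
  - by rewrite lee_fin.
under eq_bigr do rewrite -EFinM.
rewrite sumEFin -EFinM lee_fin -mulr_suml -/B.
have <- : B * B `^ (p - 1) = B `^ p by exact: mulr_powRB1.
by rewrite le_eqVlt; apply/orP; left; apply/eqP; ring.
Qed.

End blocks.

(** * Dyadic masses of the weight *)

Section weights.
Context {R : realType}.
Implicit Types (lam : R -> R) (a : nat -> R) (p r e : R) (n m j J M : nat).

(** The mass, up to constants, of [lam k * k `^ e] over the block
    $[2^n, 2^{n+1})$. *)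
Definition dyadic_mass lam e n : R := lam (2 ^ n)%:R * (2 ^ n)%:R `^ (e + 1).

Lemma dyadic_mass_gt0 lam e n : pos_monotone_from1 lam -> 0 < dyadic_mass lam e n.
Proof.
move=> [l0 _]; rewrite mulr_gt0// ?powR_gt0 ?ltr0n ?expn_gt0//.
by rewrite l0// ler1n expn_gt0.
Qed.

Lemma sum_dyadic (F : nat -> R) m M : (m <= M)%N ->
  \sum_(m <= n < M) \sum_(2 ^ n <= k < 2 ^ n.+1) F k = \sum_(2 ^ m <= k < 2 ^ M) F k.
Proof.
elim: M => [|M IH]; first by rewrite leqn0 => /eqP ->; rewrite !big_geq.
rewrite leq_eqVlt => /predU1P[->|]; first by rewrite !big_geq.
rewrite ltnS => mM; rewrite big_nat_recr//= IH// -big_cat_nat//=.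
  by rewrite leq_exp2l.
by rewrite leq_exp2l.
Qed.

Lemma dyadic_mass_le_sum lam e : pos_monotone_from1 lam -> dyadic_regular lam ->
  exists2 C, 0 < C & forall n,
    dyadic_mass lam e n <= C * \sum_(2 ^ n <= k < 2 ^ n.+1) lam k%:R * k%:R `^ e.
Proof.
move=> hl hdy; have [l0 _] := hl.
have [L L1 lamL] := lam_comparable hl hdy.
have L0 : 0 < L by lra.
exists (L * 2 `^ `|e|) => [|n]; first by rewrite mulr_gt0// powR_gt0.
set N := (2 ^ n)%N; have N0 : (0 < N)%N by rewrite expn_gt0.
have Nr : (0 : R) < N%:R by rewrite ltr0n.
have Nr1 : (1 : R) <= N%:R by rewrite ler1n.
have -> : (2 ^ n.+1 = N + N)%N by rewrite expnS mul2n addnn.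
have -> : dyadic_mass lam e n = \sum_(N <= k < N + N) lam N%:R * N%:R `^ e.
  rewrite sumr_const_nat addnK /dyadic_mass -/N -[RHS]mulr_natr -[RHS]mulrA; congr (_ * _).
  by rewrite powRD ?powRr1 ?(ltW Nr)// (gt_eqF Nr) implybT.
rewrite mulr_sumr; apply: ler_sum_nat => k /andP[Nk kN].
have kr : (N%:R : R) <= k%:R by rewrite ler_nat.
have k2 : (k%:R : R) <= 2 * N%:R by rewrite -natrM ler_nat mul2n -addnn ltnW.
have [H1 _] := lamL _ _ Nr1 kr k2.
have [H2 _] := powR_comparable e Nr kr k2.
have -> : L * 2 `^ `|e| * (lam k%:R * k%:R `^ e)
  = (L * lam k%:R) * (2 `^ `|e| * k%:R `^ e) by ring.
by rewrite ler_pM ?powR_ge0// ltW// l0.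
Qed.

Lemma dyadic_mass_succ lam e : pos_monotone_from1 lam -> dyadic_regular lam ->
  exists2 C, 0 < C & forall n, dyadic_mass lam e n.+1 <= C * dyadic_mass lam e n.
Proof.
move=> hl hdy; have [l0 _] := hl.
have [L L1 lamL] := lam_comparable hl hdy.
have L0 : 0 < L by lra.
exists (L * 2 `^ `|e + 1|) => [|n]; first by rewrite mulr_gt0// powR_gt0.
have N0 : (0 : R) < (2 ^ n)%:R by rewrite ltr0n expn_gt0.
have N1 : (1 : R) <= (2 ^ n)%:R by rewrite ler1n expn_gt0.
have E : (2 ^ n.+1)%:R = 2 * (2 ^ n)%:R :> R by rewrite expnS natrM.
have le1 : (2 ^ n)%:R <= (2 ^ n.+1)%:R :> R by rewrite E; lra.
have le2 : (2 ^ n.+1)%:R <= 2 * (2 ^ n)%:R :> R by rewrite E.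
have [_ H1] := lamL _ _ N1 le1 le2.
have [_ H2] := powR_comparable (e + 1) N0 le1 le2.
rewrite /dyadic_mass.
have -> : L * 2 `^ `|e + 1| * (lam (2 ^ n)%:R * (2 ^ n)%:R `^ (e + 1))
  = (L * lam (2 ^ n)%:R) * (2 `^ `|e + 1| * (2 ^ n)%:R `^ (e + 1)) by ring.
by rewrite ler_pM ?powR_ge0// ltW// l0// (le_trans N1).
Qed.

(** Growth of the masses under the condition on the heads of the sums. *)
Lemma head_geometric lam r p : pos_monotone_from1 lam -> dyadic_regular lam ->
  head_condition lam r p -> exists K q, [/\ 0 <= K, 0 < q < 1 & forall n d,
    dyadic_mass lam (r / p - r) n <= K * q ^+ d * dyadic_mass lam (r / p - r) (n + d)%N].
Proof.
move=> hl hdy [K HK]; set e := r / p - r.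
have [C C0 HC] := dyadic_mass_le_sum e hl hdy.
have [D D0 HD] := dyadic_mass_succ e hl hdy.
have w0 n := dyadic_mass_gt0 e n hl.
have [l0 _] := hl.
have F0 k : (0 < k)%N -> 0 <= lam k%:R * k%:R `^ e.
  by move=> k0; rewrite mulr_ge0 ?powR_ge0// ltW// l0// ler1n.
have bound m : \sum_(0 <= n < m.+1) dyadic_mass lam e n
    <= (C * `|K| * D) * dyadic_mass lam e m.
  apply: (@le_trans _ _ (C * \sum_(2 ^ 0 <= k < 2 ^ m.+1) lam k%:R * k%:R `^ e)).
    by rewrite -sum_dyadic// mulr_sumr; apply: ler_sum => n _; exact: HC.
  rewrite -!mulrA ler_wpM2l ?(ltW C0)//.
  apply: (@le_trans _ _ (\sum_(1 <= k < (2 ^ m.+1).+1) lam k%:R * k%:R `^ e)).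
    by rewrite [leRHS]big_nat_recr ?expn_gt0//= lerDl F0// expn_gt0.
  apply: (le_trans (HK _ _)); first by rewrite expn_gt0.
  rewrite -/e; change (K * dyadic_mass lam e m.+1 <= `|K| * (D * dyadic_mass lam e m)).
  apply: (@le_trans _ _ (`|K| * dyadic_mass lam e m.+1)).
    by rewrite ler_wpM2r ?ler_norm// ltW.
  by rewrite ler_wpM2l.
have [q q01 Hq] := geometric_head w0 bound.
exists (C * `|K| * D), q; split => //.
by rewrite !mulr_ge0// ltW.
Qed.

(** Decay of the masses under the condition on the tails of the sums. *)
Lemma tail_geometric lam r p : pos_monotone_from1 lam -> dyadic_regular lam ->
  tail_condition lam r p -> exists K q, [/\ 0 <= K, 0 < q < 1 & forall n d,
    dyadic_mass lam (r * (p^-1 - 3)) (n + d)%N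
      <= K * q ^+ d * dyadic_mass lam (r * (p^-1 - 3)) n].
Proof.
move=> hl hdy [K HK]; set e := r * (p^-1 - 3).
have [C C0 HC] := dyadic_mass_le_sum e hl hdy.
have w0 n := dyadic_mass_gt0 e n hl.
have [l0 _] := hl.
have F0 k : (0 < k)%N -> 0 <= lam k%:R * k%:R `^ e.
  by move=> k0; rewrite mulr_ge0 ?powR_ge0// ltW// l0// ler1n.
have bound m M : (m <= M)%N -> \sum_(m <= n < M.+1) dyadic_mass lam e n
    <= (C * `|K|) * dyadic_mass lam e m.
  move=> mM; have m0 : (0 < 2 ^ m)%N by rewrite expn_gt0.
  apply: (@le_trans _ _ (C * \sum_(2 ^ m <= k < 2 ^ M.+1) lam k%:R * k%:R `^ e)).
    by rewrite -sum_dyadic ?(leqW mM)// mulr_sumr; apply: ler_sum => n _; exact: HC.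
  rewrite -mulrA ler_wpM2l ?(ltW C0)//.
  apply: (@le_trans _ _ (K * dyadic_mass lam e m)); last first.
    by rewrite ler_wpM2r ?ler_norm// ltW.
  rewrite -lee_fin -sumEFin.
  have H := HK _ m0; rewrite -/e addrC -/(dyadic_mass lam e m) in H.
  apply: le_trans H.
  apply: nneseries_lim_ge => k mk _.
  by rewrite lee_fin F0// (leq_trans m0).
have [q q01 Hq] := geometric_tail w0 bound.
exists (C * `|K|), q; split => //.
by rewrite !mulr_ge0// ltW.
Qed.

(** Together, the two conditions on [lam] make the attenuation kernel decay
    geometrically away from the diagonal. *)
Lemma attenuation_geometric lam r p : pos_monotone_from1 lam -> dyadic_regular lam ->
  head_condition lam r p -> tail_condition lam r p ->
  exists C q, [/\ 0 <= C, 0 < q < 1 & forall n j,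
    dyadic_mass lam (r / p - r) n * attenuation n j `^ r
      <= C * q ^+ ((n - j) + (j - n)) * dyadic_mass lam (r / p - r) j].
Proof.
move=> hl hdy hh ht.
have [K1 [q1 [K10 /andP[q10 q11] H1]]] := head_geometric hl hdy hh.
have [K2 [q2 [K20 /andP[q20 q21] H2]]] := tail_geometric hl hdy ht.
set W := dyadic_mass lam (r / p - r).
have W0 n : 0 < W n by exact: dyadic_mass_gt0.
pose q := Num.max q1 q2.
have q1q d : q1 ^+ d <= q ^+ d.
  by apply: lerXn2r; rewrite ?nnegrE ?le_max ?lexx ?(ltW q10).
have q2q d : q2 ^+ d <= q ^+ d.
  by apply: lerXn2r; rewrite ?nnegrE ?le_max ?lexx ?(ltW q20) ?orbT.
exists (K1 + K2), q; split; first exact: addr_ge0.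
  by rewrite lt_max q10 gt_max q11 q21.
have q0 d : 0 <= q ^+ d by rewrite exprn_ge0// le_max (ltW q10).
move=> n j; have [nj|jn] := leqP n j.
  have -> : (n - j = 0)%N by apply/eqP; rewrite subn_eq0.
  rewrite add0n /attenuation (_ : (n - j)%N = 0%N); last by apply/eqP; rewrite subn_eq0.
  rewrite expr0 powR1 mulr1; have := H1 n (j - n)%N; rewrite subnKC// -/(W n) -/(W j).
  move=> /le_trans; apply; rewrite ler_wpM2r ?(ltW (W0 _))//.
  by rewrite ler_pM ?exprn_ge0 ?(ltW q10)// lerDl.
have -> : (j - n = 0)%N by apply/eqP; rewrite subn_eq0 ltnW.
rewrite addn0 /attenuation; set d := (n - j)%N.
have nE : n = (j + d)%N by rewrite subnKC// ltnW.
(* passing from the exponent r/p - r to r/p - 3r costs a factor 4^(-nr) *)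
have E m : dyadic_mass lam (r * (p^-1 - 3)) m = W m * (4^-1 ^+ m) `^ r.
  have N0 : (0 : R) < (2 ^ m)%:R by rewrite ltr0n expn_gt0.
  have -> : 4^-1 ^+ m = (2 ^ m)%:R `^ (- 2) :> R.
    rewrite powRN -[2]/(2%:R) powR_mulrn ?(ltW N0)// natrX -exprM mulnC exprM exprVn.
    by congr (_ ^+ _)^-1; ring.
  rewrite -powRrM /W /dyadic_mass -mulrA -powRD; last by rewrite (gt_eqF N0) implybT.
  by congr (_ * _ `^ _); ring.
have := H2 j d; rewrite -nE !E nE exprD powRM ?exprn_ge0// mulrCA => H.
have P : 0 < (4^-1 ^+ j) `^ r :> R by rewrite powR_gt0// exprn_gt0.
have {}H : W (j + d)%N * (4^-1 ^+ d) `^ r <= K2 * q2 ^+ d * W j.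
  by rewrite -(ler_pM2l P); lra.
apply: (le_trans H); rewrite ler_wpM2r ?(ltW (W0 _))//.
by rewrite ler_pM ?exprn_ge0 ?(ltW q20)// lerDr.
Qed.

(** Condensation: the weighted sums of the block norms are controlled by those
    of the coefficients. *)
Lemma block_norm_sum_le lam a p r : 1 < p -> 1 <= r ->
  pos_monotone_from1 lam -> dyadic_regular lam -> NBVS a ->
  exists2 C, 0 < C & forall J,
    \sum_(0 <= j < J) dyadic_mass lam (r / p - r) j * block_norm a p j `^ r
      <= C * \sum_(1 <= k < 2 ^ J.+1) lam k%:R * a k `^ r.
Proof.
move=> p1 r1 hl hdy aN; have [l0 _] := hl; have [a0 _] := aN.
have p0 : 0 < p by lra.
have [L L1 lamL] := lam_comparable hl hdy.
have L0 : 0 < L by lra.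
have [K K0 aK] := NBVS_power_window r1 aN.
pose F k := lam k%:R * a k `^ r.
have F0 k : (0 < k)%N -> 0 <= F k.
  by move=> k0; rewrite mulr_ge0 ?powR_ge0// ltW// l0// ler1n.
pose S J := \sum_(1 <= k < 2 ^ J) F k.
pose G j := \sum_(2 ^ j <= k < 2 ^ j.+1) F k.
have GS J : \sum_(0 <= j < J) G j = S J by exact: sum_dyadic.
have G0 j : 0 <= G j.
  rewrite /G big_nat_cond; apply: sumr_ge0 => k /andP[/andP[jk _] _].
  by apply: F0; rewrite (leq_trans _ jk)// expn_gt0.
pose X j := (2 ^ j)%:R * F (2 ^ j)%N.
have X0 j : 0 <= X j by rewrite mulr_ge0// F0// expn_gt0.
have XS j : X j.+1 <= 2 * (K * L) * (G j + G j.+1).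
  set N := (2 ^ j)%N; have N0 : (0 < N)%N by rewrite expn_gt0.
  have E : (2 ^ j.+1 = 2 * N)%N by rewrite expnS.
  have term n : (N <= n < 2 * N)%N -> F (2 * N)%N <= K * L * (F n + F (2 * n)%N).
    move=> /andP[Nn nN]; have n0 : (0 < n)%N by exact: leq_trans Nn.
    have nr1 : (1 : R) <= n%:R by rewrite ler1n.
    have N2 : (2 * N <= 2 * n)%N by rewrite leq_mul2l.
    have Nr1 : (1 : R) <= (2 * N)%:R by rewrite ler1n muln_gt0.
    have ak := aK n (2 * N)%N n0; rewrite (ltnW nN) N2 in ak.
    have [_ la] : lam n%:R <= L * lam (2 * N)%:R /\ lam (2 * N)%:R <= L * lam n%:R.
      by apply: lamL => //; rewrite -?natrM ler_nat// ltnW.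
    have [lb _] : lam (2 * N)%:R <= L * lam (2 * n)%:R /\ lam (2 * n)%:R <= L * lam (2 * N)%:R.
      apply: lamL => //; rewrite -?natrM ler_nat//.
      by rewrite leq_mul2l/= ltnW.
    have lN : 0 <= lam (2 * N)%:R by rewrite ltW// l0.
    have an := powR_ge0 (a n) r; have a2n := powR_ge0 (a (2 * n)%N) r.
    apply: (@le_trans _ _ (lam (2 * N)%:R * (K * (a n `^ r + a (2 * n)%N `^ r)))).
      by rewrite /F ler_wpM2l// ak.
    have h1 := ler_wpM2r an la; have h2 := ler_wpM2r a2n lb.
    rewrite mulrCA -mulrA ler_wpM2l ?(ltW K0)// /F; lra.
  have H : \sum_(N <= n < 2 * N) F (2 * N)%N
      <= \sum_(N <= n < 2 * N) K * L * (F n + F (2 * n)%N).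
    by apply: ler_sum_nat => n; exact: term.
  have S2 : \sum_(N <= n < 2 * N) F (2 * n)%N <= G j.+1.
    rewrite /G [(2 ^ j.+2)%N]expnS E; apply: sum_even_le => k Nk.
    by apply: F0; apply: leq_trans Nk; rewrite muln_gt0.
  move: H; rewrite sumr_const_nat -mulr_sumr big_split/= => H.
  have -> : X j.+1 = 2 * (F (2 * N)%N *+ (2 * N - N)).
    rewrite /X E natrM mul2n -addnn addnK -[_ *+ N]mulr_natr; ring.
  have KL := mulr_gt0 K0 L0.
  have h3 := ler_wpM2l (ltW KL) S2.
  have S1 : \sum_(N <= n < 2 * N) F n = G j by rewrite /G E.
  rewrite S1 in H; lra.
have Xsum J : \sum_(0 <= j < J.+1) X j <= (1 + 4 * (K * L)) * S J.+1.
  rewrite big_nat_recl//=.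
  have x0 : X 0%N <= S J.+1.
    rewrite -GS big_nat_recl//= /G /X expn0 mul1r expn1 big_nat1 lerDl.
    by apply: sumr_ge0 => j _; exact: G0.
  have H : \sum_(0 <= j < J) X j.+1 <= 2 * (K * L) * (\sum_(0 <= j < J) G j + \sum_(0 <= j < J) G j.+1).
    by rewrite -big_split mulr_sumr/=; apply: ler_sum => j _; exact: XS.
  have s1 : \sum_(0 <= j < J) G j <= S J.+1 by rewrite -GS big_nat_recr//= lerDl.
  have s2 : \sum_(0 <= j < J) G j.+1 <= S J.+1 by rewrite -GS big_nat_recl//= lerDr.
  have KL := mulr_gt0 K0 L0.
  have h1 := ler_wpM2l (ltW KL) s1; have h2 := ler_wpM2l (ltW KL) s2; lra.
have t0 : (0 : R) < 2 `^ (r - 1) by rewrite powR_gt0.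
have LS : 0 < 1 + 4 * (K * L) by have := mulr_gt0 K0 L0; lra.
exists (2 `^ (r - 1) * (1 + L) * (1 + 4 * (K * L))).
  by rewrite !mulr_gt0//; lra.
move=> J.
have term j : dyadic_mass lam (r / p - r) j * block_norm a p j `^ r
    <= 2 `^ (r - 1) * (X j + L * X j.+1).
  set N := (2 ^ j)%N; have N0 : (0 < N)%N by rewrite expn_gt0.
  have Nr : (0 : R) < N%:R by rewrite ltr0n.
  have Nr1 : (1 : R) <= N%:R by rewrite ler1n.
  have A0 : 0 <= block_size a j := block_size_ge0 j aN.
  have -> : dyadic_mass lam (r / p - r) j * block_norm a p j `^ r
      = N%:R * lam N%:R * block_size a j `^ r.
    rewrite /dyadic_mass /block_norm -/N powRM ?powR_ge0// -powRrM.
    have E1 : N%:R `^ (r / p - r + 1) * N%:R `^ ((1 - p^-1) * r) = N%:R.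
      rewrite -powRD; last by rewrite (gt_eqF Nr) implybT.
      have -> : r / p - r + 1 + (1 - p^-1) * r = 1 by ring.
      by rewrite powRr1// ltW.
    transitivity (lam N%:R * block_size a j `^ r
      * (N%:R `^ (r / p - r + 1) * N%:R `^ ((1 - p^-1) * r))); first by ring.
    by rewrite E1; ring.
  have lN : 0 <= lam N%:R by rewrite ltW// l0.
  have E : (2 ^ j.+1 = 2 * N)%N by rewrite expnS.
  have N21 : (N%:R : R) <= (2 * N)%:R by rewrite ler_nat leq_pmull.
  have N22 : ((2 * N)%:R : R) <= 2 * N%:R by rewrite natrM.
  have [la _] := lamL N%:R (2 * N)%:R Nr1 N21 N22.
  have aa : block_size a j `^ r <= 2 `^ (r - 1) * (a N `^ r + a (2 * N)%N `^ r).
    by apply: powRD_le => //; apply: a0 => //; rewrite muln_gt0.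
  apply: (le_trans (ler_wpM2l (mulr_ge0 (ltW Nr) lN) aa)).
  rewrite mulrCA ler_wpM2l ?(ltW t0)// /X /F E -/N natrM.
  have h := ler_wpM2r (mulr_ge0 (ltW Nr) (powR_ge0 (a (2 * N)%N) r)) la.
  have NF : 0 <= N%:R * (L * (lam (2 * N)%:R * a (2 * N)%N `^ r)).
    by rewrite mulr_ge0 ?(ltW Nr)// mulr_ge0 ?(ltW L0)//; apply: F0; rewrite muln_gt0.
  by move: h NF; rewrite natrM; lra.
apply: (le_trans (ler_sum _ (fun j _ => term j))).
rewrite -mulr_sumr -!mulrA ler_wpM2l ?(ltW t0)// big_split/= -mulr_sumr.
have SJ : S J.+1 = \sum_(1 <= k < 2 ^ J.+1) lam k%:R * a k `^ r by [].
rewrite -SJ; have := Xsum J => H.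
have s1 : \sum_(0 <= j < J) X j <= \sum_(0 <= j < J.+1) X j by rewrite big_nat_recr//= lerDl.
have s2 : \sum_(0 <= j < J) X j.+1 <= \sum_(0 <= j < J.+1) X j by rewrite [leRHS]big_nat_recl//= lerDr.
have h1 := ler_wpM2l (ltW L0) s2; have h2 := ler_wpM2l (ltW L0) H; lra.
Qed.

End weights.

(** * Almost everywhere convergence of the dyadic sums *)

Section convergence.
Context {R : realType}.
Local Notation mu := (@lebesgue_measure R).
Local Notation II := (`[(- (@pi R))%R, (@pi R)]%classic).
Local Notation I0 := (`[0%R, (@pi R)]%classic).
Implicit Types (f h : R -> R) (a : nat -> R) (p r t x : R) (k m n j J : nat).

Lemma powR_lipschitz p (M x y : R) : 1 <= p -> 0 <= x <= M -> 0 <= y <= M ->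
  `|x `^ p - y `^ p| <= p * M `^ (p - 1) * `|x - y|.
Proof.
move=> p1; have p0 : 0 <= p - 1 by lra.
have one (u v : R) : 0 <= u <= M -> 0 <= v -> u `^ p - v `^ p <= p * M `^ (p - 1) * `|u - v|.
  move=> /andP[u0 uM] v0.
  have T := powR_tangent p1 u0 v0.
  have up : u `^ p = u * u `^ (p - 1) by rewrite mulr_powRB1//; lra.
  have H : u `^ p - v `^ p <= p * u `^ (p - 1) * (u - v).
    by rewrite up in T *; lra.
  apply: (le_trans H); rewrite -!mulrA ler_wpM2l//; first lra.
  apply: (@le_trans _ _ (u `^ (p - 1) * `|u - v|)).
    by rewrite ler_wpM2l ?powR_ge0// ler_norm.
  by rewrite ler_wpM2r// ge0_ler_powR ?nnegrE// (le_trans u0).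
move=> xM yM; have /andP[x0 _] := xM; have /andP[y0 _] := yM.
have [xy|/ltW xy] := leP (y `^ p) (x `^ p).
  by rewrite ger0_norm ?subr_ge0// one.
by rewrite ler0_norm ?subr_le0// opprB distrC one.
Qed.

Lemma cvg_powR (u : nat -> R) (l : R) p : 1 <= p -> (forall n, 0 <= u n) ->
  u n @[n --> \oo] --> l -> u n `^ p @[n --> \oo] --> l `^ p.
Proof.
move=> p1 u0 ul.
have l0 : 0 <= l.
  by rewrite -(cvg_lim _ ul)//; apply: limr_ge; [exact: cvgP ul|exact: nearW].
have d0 : `|l - u n| @[n --> \oo] --> (0 : R).
  rewrite -(normr0 R) -(subrr l); apply: cvg_norm.
  by apply: cvgB => //; exact: cvg_cst.
apply/cvgrPdist_le => e e0.
have C0 : 0 < p * (l + 1) `^ (p - 1) by rewrite mulr_gt0 ?powR_gt0//; lra.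
near=> n.
have un : u n <= l + 1.
  near: n; apply: cvgr_le ul _ _; lra.
apply: (le_trans (@powR_lipschitz p (l + 1) l (u n) p1 _ _)).
- by rewrite l0/=; lra.
- by rewrite u0 un.
rewrite mulrC -ler_pdivlMr//.
near: n; apply: cvgr_le d0 _ _; exact: divr_gt0.
Unshelve. all: by end_near. Qed.

Lemma integrable_bounded_period (g : R -> R) (M : R) : measurable_fun II g ->
  (forall x, `|g x| <= M) -> mu.-integrable II (EFin \o g).
Proof.
move=> mg gM.
have i1 : mu.-integrable II (EFin \o (fun=> 1 : R)).
  apply: (@continuous_compact_integrable R (cst 1)); first exact: segment_compact.
  by apply: continuous_subspaceT => x; exact: cvg_cst.
have := integrable_bounded measurable_II i1 mg (fun x _ => gM x).
by congr (integrable _ _ _); apply/funext => x /=; rewrite mul1r.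
Qed.

Lemma integrable_cos (c d : R) : mu.-integrable II (EFin \o (fun x => cos (c * x + d))).
Proof.
apply: (@integrable_bounded_period _ 1); first exact: measurable_cos_affine.
by move=> x; exact: cos_max.
Qed.

(** A shift by half a wavelength changes the sign of the integrand. *)
Lemma integral_cos_null k th : (0 < k)%N ->
  \int[mu]_(x in II) (cos (k%:R * x + th)) = 0.
Proof.
move=> k0; have aux (v : R) : v = - 1 * v -> v = 0 by lra.
have kr : (k%:R : R) != 0 by rewrite pnatr_eq0 -lt0n.
pose g x : \bar R := (cos (k%:R * x + th))%:E.
have gm : measurable_fun [set: R] g by apply/measurable_EFinP; exact: measurable_cos_affine.
have gper x : g (x + pi *+ 2) = g x by rewrite /g cos_periodicn.
have H := integral_shift_periodic (pi / k%:R) gm gper.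
have E x : g (x + pi / k%:R) = (cos (k%:R * x + (th + pi)))%:E.
  rewrite /g; congr (cos _)%:E; field; exact: kr.
have {}H : \int[mu]_(x in II) (cos (k%:R * x + (th + pi)))
    = \int[mu]_(x in II) (cos (k%:R * x + th)).
  by rewrite /Rintegral -H; congr fine; apply: eq_integral => x _; rewrite E.
have N : \int[mu]_(x in II) (cos (k%:R * x + (th + pi)))
    = - 1 * \int[mu]_(x in II) (cos (k%:R * x + th)).
  rewrite -RintegralZl//; last exact: integrable_cos.
  by apply: eq_Rintegral => x _; rewrite addrA cosDpi mulN1r.
exact: aux (etrans (esym H) N).
Qed.

Lemma integral_cst_period (c : R) : \int[mu]_(x in II) c = c * (2 * pi).
Proof.
have pi0 : (0 : R) < pi by exact: pi_gt0.
have muII : mu II = (2 * pi)%:E.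
  rewrite lebesgue_measure_itv/= lte_fin.
  have -> : (- (pi : R) < pi) by lra.
  by rewrite -EFinB; congr EFin; ring.
by rewrite Rintegral_cst//; change (c * fine (mu II) = c * (2 * pi)); rewrite muII.
Qed.

Lemma integral_cos_cos j k th : (0 < j)%N ->
  \int[mu]_(x in II) (cos (j%:R * x) * cos (k%:R * x + th))
    = if j == k then pi * cos th else 0.
Proof.
move=> j0.
have prod2 (A B : R) : cos (A + B) + cos (A - B) = 2 * (cos B * cos A).
  by rewrite cosD cosB; ring.
have D : \int[mu]_(x in II) (cos (j%:R * x) * cos (k%:R * x + th))
    = 2^-1 * (\int[mu]_(x in II) cos ((j + k)%:R * x + th)
      + \int[mu]_(x in II) cos ((k%:R - j%:R) * x + th)).
  rewrite -RintegralD//; last 2 first.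
  - exact: integrable_cos.
  - exact: integrable_cos.
  rewrite -RintegralZl//; last by apply: integrableD_fun; exact: integrable_cos.
  apply: eq_Rintegral => x _.
  have -> : (j + k)%:R * x + th = (k%:R * x + th) + j%:R * x by rewrite natrD; ring.
  have -> : (k%:R - j%:R) * x + th = (k%:R * x + th) - j%:R * x by ring.
  by rewrite prod2; field.
rewrite D integral_cos_null ?addn_gt0 ?j0// add0r.
have [jk|jk|<-] := ltngtP j k.
- rewrite -natrB 1?ltnW// integral_cos_null ?mulr0//.
  by rewrite subn_gt0.
- transitivity (2^-1 * \int[mu]_(x in II) cos ((j - k)%:R * x + - th)).
    congr (_ * _); apply: eq_Rintegral => x _.
    by rewrite -cosN; congr cos; rewrite natrB 1?ltnW//; ring.
  by rewrite integral_cos_null ?mulr0// subn_gt0.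
- transitivity (2^-1 * \int[mu]_(x in II) cos th).
    by congr (_ * _); apply: eq_Rintegral => x _; congr cos; ring.
  by rewrite integral_cst_period; field.
Qed.

Lemma measurable_cos_sum a l u (D : set R) :
  measurable_fun D (fun x => \sum_(l <= k < u) a k * cos (k%:R * x)).
Proof.
apply: measurable_sum => k; apply: measurable_funM => //.
exact: measurable_cos_nat.
Qed.

Lemma integrable_cos_sum a l u :
  mu.-integrable II (EFin \o (fun x => \sum_(l <= k < u) a k * cos (k%:R * x))).
Proof.
apply: (@integrable_bounded_period _ (\sum_(l <= k < u) `|a k|)).
  exact: measurable_cos_sum.
move=> x; rewrite (le_trans (ler_norm_sum _ _ _))// ler_sum// => k _.
by rewrite normrM ler_piMr// cos_max.
Qed.

Lemma cos_sum_coef a u k th :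
  \int[mu]_(x in II) ((\sum_(1 <= j < u) a j * cos (j%:R * x)) * cos (k%:R * x + th))
    = if (0 < k < u)%N then pi * a k * cos th else 0.
Proof.
have z u' : (u' <= 1)%N ->
    \int[mu]_(x in II) ((\sum_(1 <= j < u') a j * cos (j%:R * x)) * cos (k%:R * x + th)) = 0.
  move=> u1; rewrite -[RHS](mul0r (2 * pi)) -(integral_cst_period 0).
  by apply: eq_Rintegral => x _; rewrite big_geq// mul0r.
elim: u => [|u IH]; first by rewrite z// andbF.
have [u0|u0] := leqP u 0.
  by rewrite z ?ltnS//; move: u0; rewrite leqn0 => /eqP ->; case: k {IH z} => //= -[].
transitivity (\int[mu]_(x in II) ((\sum_(1 <= j < u) a j * cos (j%:R * x)) * cos (k%:R * x + th))
    + a u * \int[mu]_(x in II) (cos (u%:R * x) * cos (k%:R * x + th))).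
  have cc : mu.-integrable II (EFin \o (fun x => cos (u%:R * x) * cos (k%:R * x + th))).
    have := integrable_mul_cos k%:R th (integrable_cos u%:R 0).
    by congr (integrable _ _ _); apply/funext => x /=; rewrite addr0.
  rewrite -RintegralZl// -RintegralD//.
  - by apply: eq_Rintegral => x _; rewrite big_nat_recr//=; ring.
  - by apply: integrable_mul_cos; exact: integrable_cos_sum.
  - exact: integrableZ_fun.
rewrite IH integral_cos_cos// ltnS.
have [ku|uk|->] := ltngtP k u.
- by rewrite mulr0 addr0.
- by rewrite andbF mulr0 addr0.
- by rewrite u0/= add0r; ring.
Qed.

Lemma dyadic_sumE a J x :
  dyadic_sum a J x = \sum_(1 <= k < 2 ^ J) a k * cos (k%:R * x).
Proof.
rewrite -(@sum_dyadic _ (fun k => a k * cos (k%:R * x)) 0)// /dyadic_sum.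
by apply: eq_bigr => j _; rewrite /dyadic_block expnS.
Qed.

Lemma measurable_dyadic_sum a J (D : set R) : measurable_fun D (dyadic_sum a J).
Proof.
rewrite (_ : dyadic_sum a J = fun x => \sum_(1 <= k < 2 ^ J) a k * cos (k%:R * x)).
  exact: measurable_cos_sum.
by apply/funext => x; exact: dyadic_sumE.
Qed.

(** The remainder of a cosine series has no frequency below $2^J$. *)
Lemma remainder_coef f a J k th : mu.-integrable II (EFin \o f) ->
  cosine_series_of f a -> (k < 2 ^ J)%N ->
  \int[mu]_(x in II) ((f x - dyadic_sum a J x) * cos (k%:R * x + th)) = 0.
Proof.
move=> fi fa kJ.
transitivity (\int[mu]_(x in II) (f x * cos (k%:R * x + th))
  - \int[mu]_(x in II) ((\sum_(1 <= j < 2 ^ J) a j * cos (j%:R * x)) * cos (k%:R * x + th))).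
  rewrite -RintegralB//.
  - by apply: eq_Rintegral => x _; rewrite dyadic_sumE mulrBl.
  - exact: integrable_mul_cos.
  - by apply: integrable_mul_cos; exact: integrable_cos_sum.
rewrite (cosine_series_coef _ _ fi fa) cos_sum_coef kJ andbT lt0n.
by case: eqP => //=; rewrite subrr.
Qed.

(** Multiplication by $1-\cos x$ spreads each frequency to its two neighbours
    only. *)
Lemma null_coef_one_sub_cos h n k th : mu.-integrable II (EFin \o h) ->
  (forall i th', (i <= n.+1)%N -> \int[mu]_(x in II) (h x * cos (i%:R * x + th')) = 0) ->
  (k <= n)%N -> \int[mu]_(x in II) ((1 - cos x) * h x * cos (k%:R * x + th)) = 0.
Proof.
move=> hi h0 kn.
have ik (c d : R) := integrable_mul_cos c d hi.
transitivity (\int[mu]_(x in II) (h x * cos (k%:R * x + th)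
   + - 2^-1 * (h x * cos (k.+1%:R * x + th) + h x * cos ((k%:R - 1) * x + th)))).
  apply: eq_Rintegral => x _.
  have -> : k.+1%:R * x + th = (k%:R * x + th) + x by rewrite -natr1; ring.
  have -> : (k%:R - 1) * x + th = (k%:R * x + th) - x by ring.
  have -> : h x * cos (k%:R * x + th + x) + h x * cos (k%:R * x + th - x)
      = h x * (2 * (cos (k%:R * x + th) * cos x)) by rewrite cosD cosB; ring.
  by field.
rewrite RintegralD//; last first.
  by apply: integrableZ_fun; apply: integrableD_fun; exact: ik.
rewrite RintegralZl//; last by apply: integrableD_fun; exact: ik.
rewrite RintegralD//.
rewrite (h0 k) ?leqW// (h0 k.+1)//.
suff -> : \int[mu]_(x in II) (h x * cos ((k%:R - 1) * x + th)) = 0 by rewrite addr0 mulr0 addr0.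
case: k kn => [|k] kn.
  rewrite -[RHS](h0 1%N (- th))//; apply: eq_Rintegral => x _.
  by rewrite -cosN; congr (_ * cos _); ring.
rewrite -[RHS](h0 k th); last by rewrite (leq_trans (ltnW kn)).
by apply: eq_Rintegral => x _; rewrite -natr1 addrK.
Qed.

Lemma one_sub_cos_block a p : 1 < p -> NBVS a -> exists2 K, 0 < K & forall j x,
  `|(1 - cos x) * dyadic_block a j x| <= K * block_norm a p j.
Proof.
move=> p1 aN; have [K K0 HK] := dyadic_block_le aN.
exists (4 * K) => [|j x]; first lra.
have A0 := block_size_ge0 j aN.
have N1 : (1 : R) <= (2 ^ j)%:R by rewrite ler1n expn_gt0.
have p10 : 0 <= 1 - p^-1 by rewrite subr_ge0 invf_le1; lra.
have AN : block_size a j <= block_norm a p j.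
  rewrite /block_norm ler_peMl//.
  have : 1 `^ (1 - p^-1) <= (2 ^ j)%:R `^ (1 - p^-1) by rewrite ge0_ler_powR ?nnegrE.
  by rewrite powR1.
set s := `|sin (x / 2)|.
have s0 : 0 <= s by exact: normr_ge0.
have cs : 1 - cos x = 2 * s ^+ 2.
  have := cos_mulr2n (x / 2); have := sin2cos2 (x / 2).
  have -> : (x / 2) *+ 2 = x by rewrite -mulr_natr divfK.
  rewrite /s real_normK ?num_real//; lra.
have s1 : s <= 1 by have := sin_max (x / 2).
have pk : (1 - cos x) * peak (2 ^ j) x <= 4.
  rewrite cs /peak -/s mulrA ler_pdivrMr ?peak_den_gt0//.
  have Ns : 0 <= (2 ^ j)%:R * s by rewrite mulr_ge0.
  have := ler_wpM2l Ns s1; lra.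
rewrite normrM ger0_norm ?one_sub_cos_ge0//.
apply: (le_trans (ler_wpM2l (one_sub_cos_ge0 x) (HK j x))).
have h := ler_wpM2l (mulr_ge0 (ltW K0) A0) pk.
have h2 := ler_wpM2l (ltW K0) AN; lra.
Qed.

(** If the block norms are summable then $1-\cos x$ times the dyadic partial
    sums converges at every point, and uniformly; the limit has the Fourier
    coefficients of $(1-\cos x)f$, hence equals it almost everywhere. *)
Lemma dyadic_sum_ae a f p (B : R) : 1 < p -> NBVS a ->
  (forall J, \sum_(0 <= j < J) block_norm a p j <= B) ->
  Lp2pi p f -> cosine_series_of f a ->
  exists G : R -> R, [/\ measurable_fun [set: R] G, periodic G (pi *+ 2),
    (forall x, (1 - cos x) * dyadic_sum a J x @[J --> \oo] --> G x) &
    {ae mu, forall x, II x -> (1 - cos x) * f x - G x = 0}].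
Proof.
move=> p1 aN cB fp fa; have [mf fper _] := fp; have fi := Lp2pi_integrable p1 fp.
have [K K0 HK] := one_sub_cos_block p1 aN.
have c0 j : 0 <= block_norm a p j := block_norm_ge0 p j aN.
pose g J x := (1 - cos x) * dyadic_sum a J x.
have gE J x : g J x = \sum_(0 <= j < J) (1 - cos x) * dyadic_block a j x.
  by rewrite /g /dyadic_sum mulr_sumr.
have gb J x : `|g J x| <= K * B.
  rewrite gE (le_trans (ler_norm_sum _ _ _))//.
  apply: (le_trans (ler_sum _ (fun j _ => HK j x))).
  by rewrite -mulr_sumr ler_wpM2l ?(ltW K0).
have gcvg x : cvgn (g ^~ x).
  have : cvgn (series (fun j => (1 - cos x) * dyadic_block a j x)).
    apply: normed_cvg; apply: (@series_le_cvg _ _ (fun j => K * block_norm a p j)).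
    - by move=> n; exact: normr_ge0.
    - by move=> n; rewrite mulr_ge0// ltW.
    - by move=> n; exact: HK.
    - apply: nondecreasing_is_cvgn.
        apply/nondecreasing_seqP => n; rewrite /series/= big_nat_recr//= lerDl.
        by rewrite mulr_ge0// ltW.
      exists (K * B) => _ [n _ <-]; rewrite /series/= -mulr_sumr.
      by rewrite ler_wpM2l// ltW.
  by congr (cvgn _); apply/funext => J; rewrite gE.
pose G x := limn (g ^~ x).
have gG x : g J x @[J --> \oo] --> G x := gcvg x.
have mcos : measurable_fun [set: R] (fun x : R => 1 - cos x).
  apply: measurable_funB => //.
  have -> : (cos : R -> R) = (fun x => cos (1 * x + 0)).
    by apply/funext => x; rewrite mul1r addr0.
  exact: measurable_cos_affine.
have mg J : measurable_fun [set: R] (g J).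
  by apply: measurable_funM => //; exact: measurable_dyadic_sum.
have mG : measurable_fun [set: R] G.
  by apply: (measurable_fun_cvg mg) => x _; exact: gG.
have Gper : periodic G (pi *+ 2).
  move=> x; rewrite /G; congr (limn _); apply/funext => J.
  rewrite /g !dyadic_sumE cosD2pi; congr (_ * _); apply: eq_bigr => k _.
  by have := cos_periodicn x k 0; rewrite !addr0 => ->.
have Gb x : `|G x| <= K * B.
  have nG : `|g J x| @[J --> \oo] --> `|G x| by apply: cvg_norm; exact: gG.
  rewrite -(cvg_lim _ nG)//; apply: limr_le; first exact: cvgP nG.
  by apply: nearW => J; exact: gb.
exists G; split => //.
have cosb (x : R) : `|1 - cos x| <= 2.
  by rewrite ger0_norm ?one_sub_cos_ge0//; have := cos_geN1 x; lra.
have cfi h : mu.-integrable II (EFin \o h) ->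
    mu.-integrable II (EFin \o (fun x => (1 - cos x) * h x)).
  move=> hi; have := integrable_bounded measurable_II hi
    (measurable_funS measurableT (@subsetT _ _) mcos) (fun x _ => cosb x).
  by congr (integrable _ _ _); apply/funext => x /=; rewrite mulrC.
have Gi : mu.-integrable II (EFin \o G).
  by apply: (integrable_bounded_period _ Gb); exact: measurable_funS mG.
have gi J : mu.-integrable II (EFin \o g J).
  by apply: (integrable_bounded_period _ (gb J)); exact: measurable_funS (mg J).
apply: fourier_null_ae; split.
  have := integrableD_fun (cfi _ fi) (integrableZ_fun (-1) Gi).
  by congr (integrable _ _ _); apply/funext => x /=; rewrite mulN1r.
move=> k th.
have -> : \int[mu]_(x in II) (((1 - cos x) * f x - G x) * cos (k%:R * x + th))
   = \int[mu]_(x in II) ((1 - cos x) * f x * cos (k%:R * x + th))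
     - \int[mu]_(x in II) (G x * cos (k%:R * x + th)).
  rewrite -RintegralB//.
  - by apply: eq_Rintegral => x _; rewrite mulrBl.
  - by apply: integrable_mul_cos; exact: cfi.
  - exact: integrable_mul_cos.
apply/eqP; rewrite subr_eq0; apply/eqP.
have lim1 : (\int[mu]_(x in II) (g J x * cos (k%:R * x + th))%:E @[J --> \oo]
    --> \int[mu]_(x in II) (G x * cos (k%:R * x + th))%:E)%E.
  have mc := @measurable_cos_affine R II k%:R th.
  have [] := @dominated_convergence _ _ _ mu II measurable_II
    (fun J x => (g J x * cos (k%:R * x + th))%:E)
    (fun x => (G x * cos (k%:R * x + th))%:E) (fun=> (K * B)%:E).
  - by move=> J; apply/measurable_EFinP; apply: measurable_funM => //; exact: measurable_funS (mg J).
  - by apply/measurable_EFinP; apply: measurable_funM => //; exact: measurable_funS mG.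
  - apply: aeW => x _; apply: cvg_EFin; first exact: nearW.
    by apply: cvgM; [exact: gG|exact: cvg_cst].
  - have KB : 0 <= K * B by apply: le_trans (gb 0%N 0).
    apply: (@integrable_bounded_period (fun=> K * B) (K * B)) => //.
    by move=> x; rewrite ger0_norm.
  - apply: aeW => x J _; rewrite /= lee_fin normrM.
    by rewrite (le_trans _ (gb J x))// ler_piMr// cos_max.
  - by move=> _ _; apply.
have lim2 : (\int[mu]_(x in II) (g J x * cos (k%:R * x + th))%:E @[J --> \oo]
    --> (\int[mu]_(x in II) ((1 - cos x) * f x * cos (k%:R * x + th)))%:E)%E.
  apply: cvg_near_cst; exists k.+2 => // J /= kJ.
  have k2J : (k.+2 <= 2 ^ J)%N by rewrite (leq_trans kJ)// ltnW// ltn_expl.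
  have gc : mu.-integrable II (EFin \o (fun x => g J x * cos (k%:R * x + th))).
    exact: integrable_mul_cos.
  transitivity (\int[mu]_(x in II) (g J x * cos (k%:R * x + th)))%:E.
    by rewrite /Rintegral fineK//; exact: (integrable_fin_num _ gc).
  congr EFin.
  apply/eqP; rewrite eq_sym -subr_eq0; apply/eqP.
  have Si : mu.-integrable II (EFin \o (fun x => f x - dyadic_sum a J x)).
    have Sint := integrable_cos_sum a 1 (2 ^ J).
    have := integrableD_fun fi (integrableZ_fun (-1) Sint).
    by congr (integrable _ _ _); apply/funext => x /=; rewrite mulN1r dyadic_sumE.
  have := @null_coef_one_sub_cos (fun x => f x - dyadic_sum a J x) k k th Si.
  have H i th' : (i <= k.+1)%N ->
      \int[mu]_(x in II) ((f x - dyadic_sum a J x) * cos (i%:R * x + th')) = 0.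
    by move=> ik; apply: remainder_coef => //; exact: leq_ltn_trans ik k2J.
  move=> /(_ H (leqnn k)) <-.
  rewrite -/(Rintegral mu II _) -RintegralB//.
  - by apply: eq_Rintegral => x _; rewrite /g; ring.
  - by apply: integrable_mul_cos; exact: cfi.
have := cvg_unique (@ereal_hausdorff R) lim2 lim1 => E.
by rewrite /Rintegral -E.
Qed.

End convergence.

(** * The upper bound of the integral *)

Section upper_bound.
Context {R : realType}.
Local Notation mu := (@lebesgue_measure R).
Local Notation II := (`[(- (@pi R))%R, (@pi R)]%classic).
Local Notation I0 := (`[0%R, (@pi R)]%classic).
Implicit Types (f lam : R -> R) (a : nat -> R) (p r t x : R) (k m n j J : nat).

Lemma one_sub_cos_gt0 y : 0 < `|y| < 2 * pi -> 0 < 1 - cos y :> R.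
Proof.
move=> /andP[y0 y2]; rewrite subr_gt0 -[ltRHS]cos0.
by apply: cos_lt_window; rewrite ?lexx ?pi_ge0// y0 subr0.
Qed.

Lemma ae_neq (c : R) : {ae mu, forall x, x != c}.
Proof.
have Z : mu.-negligible [set c].
  by apply/negligibleP; [exact: measurable_set1|exact: lebesgue_measure_set1].
apply: negligibleS Z => x /=; apply: contra_notP => xc.
by apply/eqP => E; apply: xc.
Qed.

Lemma second_diff_cvg_ae a f p (B : R) t : 1 < p -> NBVS a ->
  (forall J, \sum_(0 <= j < J) block_norm a p j <= B) ->
  Lp2pi p f -> cosine_series_of f a -> 0 < t <= 1 ->
  {ae mu, forall x, I0 x ->
     second_diff (dyadic_sum a J) t x @[J --> \oo] --> second_diff f t x}.
Proof.
move=> p1 aN cB fp fa /andP[t0 t1]; have [mf fper _] := fp.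
have [G [mG Gper gG FG]] := dyadic_sum_ae p1 aN cB fp fa.
pose F x := (1 - cos x) * f x - G x.
have mF : measurable_fun [set: R] F.
  apply: measurable_funB => //; apply: measurable_funM => //.
  apply: measurable_funB => //.
  have -> : (cos : R -> R) = (fun x => cos (1 * x + 0)).
    by apply/funext => x; rewrite mul1r addr0.
  exact: measurable_cos_affine.
have Fper : periodic F (pi *+ 2) by move=> x; rewrite /F cosD2pi fper Gper.
have F1 := ae_periodic_shift t mF Fper FG.
have F2 := ae_periodic_shift (- t) mF Fper FG.
have pi2 := pi_ge2 R.
have conv y : 0 < `|y| < 2 * pi -> F y = 0 -> dyadic_sum a J y @[J --> \oo] --> f y.
  move=> yp /eqP; rewrite /F subr_eq0 => /eqP Fy.
  have c0 := one_sub_cos_gt0 yp.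
  have -> : f y = (1 - cos y)^-1 * G y by rewrite -Fy mulKf// gt_eqF.
  have -> : (fun J => dyadic_sum a J y)
      = (fun J => (1 - cos y)^-1 * ((1 - cos y) * dyadic_sum a J y)).
    by apply/funext => J; rewrite mulKf// gt_eqF.
  by apply: cvgM; [exact: cvg_cst|exact: gG].
have FF : {ae mu, forall x, I0 x -> [/\ F x = 0, F (x + t) = 0 & F (x - t) = 0]}.
  move: FG F1 F2; apply: (@filterS3 _ _ (ae_filter_ringOfSetsType mu)) => x h1 h2 h3 /=.
  rewrite in_itv/= => /andP[x0 xpi].
  have xII : II x by rewrite /= in_itv/=; lra.
  by split; [exact: h1|exact: h2|exact: h3].
move: FF (ae_neq 0) (ae_neq t).
apply: (@filterS3 _ _ (ae_filter_ringOfSetsType mu)) => x h xn0 xnt /[dup] /h [h1 h2 h3] /=.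
rewrite in_itv/= => /andP[x0 xpi].
have {xn0} x0' : 0 < x by rewrite lt_neqAle eq_sym xn0.
have xt : 0 < `|x - t| by rewrite normr_gt0 subr_eq0.
rewrite /second_diff.
have c1 : dyadic_sum a J (x + t) @[J --> \oo] --> f (x + t).
  by apply: conv => //; rewrite gtr0_norm; lra.
have c2 : dyadic_sum a J (x - t) @[J --> \oo] --> f (x - t).
  by apply: conv => //; rewrite xt/= ltr_norml; lra.
have c3 : dyadic_sum a J x @[J --> \oo] --> f x.
  by apply: conv => //; rewrite gtr0_norm; lra.
by apply: cvgB; [exact: cvgD|apply: cvgM; [exact: cvg_cst|exact: c3]].
Qed.

(** Fatou's lemma for a sequence that converges almost everywhere. *)
Lemma fatou_ae (D : set R) (u : nat -> R -> \bar R) (h : R -> \bar R) (c : \bar R) :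
  measurable D -> (forall n, measurable_fun D (u n)) -> measurable_fun D h ->
  (forall n x, 0 <= u n x)%E ->
  {ae mu, forall x, D x -> u n x @[n --> \oo] --> h x} ->
  (forall n, \int[mu]_(x in D) u n x <= c)%E -> (\int[mu]_(x in D) h x <= c)%E.
Proof.
move=> mD mu_ mh u0 uh uc.
have mlim : measurable_fun D (fun x => limn_einf (u ^~ x)).
  have E : (fun x => limn_einf (u ^~ x)) = (fun x => - limn_esup (fun n => - u n x))%E.
    apply/funext => x; rewrite -[LHS]oppeK; congr (- _)%E.
    by rewrite -limn_esupN.
  rewrite E; apply: measurableT_comp => //.
  by apply: measurable_fun_limn_esup => n; apply: measurableT_comp.
have -> : (\int[mu]_(x in D) h x = \int[mu]_(x in D) limn_einf (u ^~ x))%E.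
  apply: ae_eq_integral => //.
  move: uh; apply: (@filterS _ _ (ae_filter_ringOfSetsType mu)) => x ux Dx.
  by rewrite (cvg_limn_einf_sup (ux Dx)).1.
apply: (le_trans (fatou mu mD mu_ (fun n x _ => u0 n x))).
rewrite limn_einf_lim; apply: lime_le; first exact: is_cvg_einfs.
apply: nearW => n; apply: le_trans (uc n).
by apply: ereal_inf_lbound; exists n => //=.
Qed.

(** The bound for the dyadic partial sums passes to the function itself. *)
Lemma diff_integral_le a p : 1 < p -> NBVS a -> exists2 K, 0 < K &
  forall f (B b : R) n t, Lp2pi p f -> cosine_series_of f a ->
  (forall J, \sum_(0 <= j < J) block_norm a p j <= B) ->
  (forall J, \sum_(0 <= j < J) attenuation n j * block_norm a p j <= b) ->
  0 < t <= 1 -> t <= 2^-1 ^+ n ->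
  (diff_integral f p t <= (K * b `^ p)%:E)%E.
Proof.
move=> p1 aN; have [K K0 HK] := diff_integral_dyadic_sum p1 aN.
have p0 : 0 < p by lra.
exists K => // f B b n t fp fa cB cb /[dup] t01 /andP[t0 t1] tn; have [mf _ _] := fp.
have b0 : 0 <= b by have := cb 0%N; rewrite big_geq.
apply: (@fatou_ae I0 (fun J x => (`|second_diff (dyadic_sum a J) t x| `^ p)%:E)).
- exact: measurable_I0.
- by move=> J; apply: measurable_second_diff_powR; exact: measurable_dyadic_sum.
- exact: measurable_second_diff_powR.
- by move=> J x; rewrite lee_fin powR_ge0.
- move: (second_diff_cvg_ae p1 aN cB fp fa t01).
  apply: (@filterS _ _ (ae_filter_ringOfSetsType mu)) => x H xI.
  apply: cvg_EFin; first exact: nearW.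
  apply: cvg_powR; [exact: ltW| |].
    by move=> J; exact: normr_ge0.
  by apply: cvg_norm; exact: H.
- move=> J; apply: (le_trans (HK n J t _)); first by rewrite (ltW t0).
  rewrite lee_fin ler_wpM2l ?(ltW K0)// ge0_ler_powR ?nnegrE ?(ltW p0)//.
  by apply: sumr_ge0 => j _; rewrite mulr_ge0 ?attenuation_ge0// block_norm_ge0.
Qed.

Lemma partial_sum_le_weighted_sum lam a r (s : R) m : pos_monotone_from1 lam ->
  weighted_sum lam a r = s%:E -> \sum_(1 <= k < m) lam k%:R * a k `^ r <= s.
Proof.
move=> [l0 _] sE.
rewrite -lee_fin -sE -sumEFin /weighted_sum.
apply: nneseries_lim_ge => k k1 _.
by rewrite lee_fin mulr_ge0 ?powR_ge0// ltW// l0// ler1n.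
Qed.

Lemma exp2V_double n : 2^-1 ^+ n = 2 * 2^-1 ^+ n.+1 :> R.
Proof. by rewrite exprS mulrA mulfV ?mul1r. Qed.

(** On the dyadic interval $]2^{-n-1}, 2^{-n}]$ the powers of [t] and the weight
    are comparable to their values at $2^{-n}$. *)
Lemma integral_I_dyadic_le lam p r : 1 < p -> 1 <= r ->
  pos_monotone_from1 lam -> dyadic_regular lam -> exists2 D, 0 < D &
  forall f n (K b : R), measurable_fun [set: R] f -> 0 <= K -> 0 <= b ->
  (forall t, 0 < t <= 1 -> t <= 2^-1 ^+ n -> (diff_integral f p t <= (K * b `^ p)%:E)%E) ->
  (\int[mu]_(t in `](2^-1 ^+ n.+1)%R, (2^-1 ^+ n)%R]) I_integrand f lam r p t
    <= (D * (K `^ (r / p) * (dyadic_mass lam (r / p - r) n * b `^ r)))%:E)%E.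
Proof.
move=> p1 r1 hl hdy; have [l0 _] := hl.
have p0 : 0 < p by lra.
have rp0 : 0 <= r / p by apply: divr_ge0; lra.
have [L L1 lamL] := lam_comparable hl hdy.
have L0 : 0 < L by lra.
pose e := r - 2 - r / p.
exists (L * 2 `^ `|e|) => [|f n K b mf K0 b0 H]; first by rewrite mulr_gt0 ?powR_gt0.
set h := 2^-1 ^+ n; have h0 : 0 < h by rewrite exprn_gt0.
have h1 : h <= 1 by rewrite exprn_ile1//; lra.
have hE : h = 2 * 2^-1 ^+ n.+1 by exact: exp2V_double.
set h' := 2^-1 ^+ n.+1 in hE *.
have h'0 : 0 < h' by rewrite exprn_gt0.
set E := (X in (\int[_]_(_ in X) _)%E).
have NE : (2 ^ n)%:R = h^-1 by rewrite /h exprVn invrK natrX.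
have ES : E `<=` (`]0%R, 1%R]%classic : set R).
  by move=> t; rewrite /E/= !in_itv/= => /andP[th ht]; apply/andP; split; lra.
have mE : measurable E by exact: measurable_itv.
have N1 : 1 <= (2 ^ n)%:R :> R by rewrite ler1n expn_gt0.
pose c := L * lam (2 ^ n)%:R * (2 `^ `|e| * h `^ e) * (K `^ (r / p) * b `^ r).
have lN : 0 < lam (2 ^ n)%:R by exact: l0.
have c0 : 0 <= c by rewrite /c !mulr_ge0 ?powR_ge0// ltW.
have pw t : E t -> (I_integrand f lam r p t <= c%:E)%E.
  rewrite /E/= in_itv/= => /andP[th ht]; have t0 : 0 < t by lra.
  have t01 : 0 < t <= 1 by rewrite t0 (le_trans ht).
  have tV1 : (2 ^ n)%:R <= 1 / t by rewrite NE div1r lef_pV2.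
  have tV2 : 1 / t <= 2 * (2 ^ n)%:R.
    rewrite NE ler_pdivrMr// mulrAC ler_pdivlMr// mul1r; lra.
  have [_ la] := lamL _ _ N1 tV1 tV2.
  have [te _] : t `^ e <= 2 `^ `|e| * h `^ e /\ h `^ e <= 2 `^ `|e| * t `^ e.
    by apply: powR_comparable => //; lra.
  have lt0 : 0 <= lam (1 / t) by rewrite ltW// l0// (le_trans N1).
  have Dt : (diff_integral f p t `^ (r / p) <= (K `^ (r / p) * b `^ r)%:E)%E.
    have -> : K `^ (r / p) * b `^ r = (K * b `^ p) `^ (r / p).
      rewrite powRM ?powR_ge0// -powRrM; congr (_ * _ `^ _).
      by field; rewrite gt_eqF.
    rewrite -poweR_EFin; apply: gt0_ler_poweR => //.
    - by rewrite in_itv/= leey diff_integral_ge0.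
    - by rewrite in_itv/= leey lee_fin mulr_ge0 ?powR_ge0.
    - exact: H.
  rewrite /I_integrand -/e /c [in leRHS]EFinM.
  apply: lee_pmul => //.
  - by rewrite lee_fin mulr_ge0 ?powR_ge0.
  - exact: poweR_ge0.
  - by rewrite lee_fin ler_pM ?powR_ge0.
have muE : mu E = (h - h')%:E.
  rewrite /E lebesgue_measure_itv/= lte_fin.
  have -> : h' < h by lra.
  by rewrite -EFinB.
apply: (@le_trans _ _ (\int[mu]_(t in E) c%:E)%E).
  apply: ge0_le_integral => //.
  - by move=> t /ES /=; rewrite in_itv/=; exact: I_integrand_ge0.
  - exact: measurable_funS (measurable_I_integrand r p hl mf).
rewrite integral_cst//; change (c%:E * mu E <= (L * 2 `^ `|e| *
  (K `^ (r / p) * (dyadic_mass lam (r / p - r) n * b `^ r)))%:E)%E.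
rewrite muE -EFinM lee_fin.
have Wn : dyadic_mass lam (r / p - r) n = lam (2 ^ n)%:R * (h `^ e * h).
  rewrite /dyadic_mass NE -(powR_inv1 (ltW h0)) -powRrM; congr (_ * _).
  rewrite -[X in _ = _ * X](powRr1 (ltW h0)) -powRD; last by rewrite (gt_eqF h0) implybT.
  by congr (_ `^ _); rewrite /e; ring.
rewrite Wn.
have -> : L * 2 `^ `|e| * (K `^ (r / p) * (lam (2 ^ n)%:R * (h `^ e * h) * b `^ r)) = c * h.
  by rewrite /c; ring.
by rewrite ler_wpM2l//; lra.
Qed.

Lemma cvg_exp2V : (2^-1 : R) ^+ n @[n --> \oo] --> (0 : R).
Proof. by apply: cvg_expr; rewrite ger0_norm//; lra. Qed.

(** When the weighted sum is finite, the attenuated sums of the block norms are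
    bounded, by their limits [b n], and these satisfy Hardy's inequality. *)
Lemma attenuated_sum_limit lam a p r : 1 < p -> 1 <= r ->
  pos_monotone_from1 lam -> dyadic_regular lam -> NBVS a ->
  head_condition lam r p -> tail_condition lam r p ->
  exists2 C, 0 < C & forall s, weighted_sum lam a r = s%:E ->
  exists b : nat -> R, (forall n, 0 <= b n) /\
    (forall n J, \sum_(0 <= j < J) attenuation n j * block_norm a p j <= b n) /\
    forall M, \sum_(0 <= n < M) dyadic_mass lam (r / p - r) n * b n `^ r <= C * s.
Proof.
move=> p1 r1 hl hdy aN hh ht.
set W := dyadic_mass lam (r / p - r).
have W0 n : 0 < W n by exact: dyadic_mass_gt0.
have r0 : 0 < r by lra.
have [C [q [C0 q01 HW]]] := attenuation_geometric hl hdy hh ht.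
have [C' C'0 hardy] := weighted_hardy r1 q01 C0 W0 attenuation_ge0 HW.
have [C1 C10 HS] := block_norm_sum_le p1 r1 hl hdy aN.
exists ((C' + 1) * C1) => [|s sE]; first by rewrite mulr_gt0//; lra.
have c0 j : 0 <= block_norm a p j := block_norm_ge0 p j aN.
have Ss m := partial_sum_le_weighted_sum m hl sE.
have s0 : 0 <= s by have := Ss 0%N; rewrite big_geq.
pose T := (C' + 1) * C1 * s.
have T0 : 0 <= T by rewrite !mulr_ge0//; lra.
pose bJ n J := \sum_(0 <= j < J) attenuation n j * block_norm a p j.
have bJ0 n J : 0 <= bJ n J.
  by apply: sumr_ge0 => j _; rewrite mulr_ge0 ?attenuation_ge0.
have hT M J : \sum_(0 <= n < M) W n * bJ n J `^ r <= T.
  apply: (le_trans (hardy _ M J c0)).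
  have h1 := le_trans (HS J) (ler_wpM2l (ltW C10) (Ss _)).
  have h2 := ler_wpM2l C'0 h1.
  have h3 := mulr_ge0 (ltW C10) s0.
  apply: (le_trans h2); rewrite /T; lra.
have bd n J : bJ n J <= (T / W n) `^ r^-1.
  have H : W n * bJ n J `^ r <= T.
    apply: le_trans (hT n.+1 J); rewrite big_nat_recr//= lerDr.
    by apply: sumr_ge0 => i _; rewrite mulr_ge0 ?powR_ge0// ltW.
  have -> : bJ n J = (bJ n J `^ r) `^ r^-1 by rewrite -powRrM mulfV ?gt_eqF// powRr1.
  rewrite ge0_ler_powR ?nnegrE ?powR_ge0 ?invr_ge0 ?(ltW r0)//.
    by rewrite divr_ge0// ltW.
  by rewrite ler_pdivlMr// mulrC.
have bnd n : nondecreasing_seq (bJ n).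
  apply/nondecreasing_seqP => J; rewrite /bJ big_nat_recr//= lerDl.
  by rewrite mulr_ge0 ?attenuation_ge0.
have bcvg n : cvgn (bJ n).
  apply: nondecreasing_is_cvgn; first exact: bnd.
  by exists ((T / W n) `^ r^-1) => _ [J _ <-]; exact: bd.
exists (fun n => limn (bJ n)); split; last split.
- by move=> n; apply: limr_ge; [exact: bcvg|exact: nearW].
- by move=> n J; exact: nondecreasing_cvgn_le.
move=> M.
have lim : \sum_(0 <= n < M) W n * bJ n J `^ r @[J --> \oo]
    --> \sum_(0 <= n < M) W n * limn (bJ n) `^ r.
  apply: cvg_big => [|n _]; first exact: add_continuous.
  apply: cvgM; first exact: cvg_cst.
  by apply: cvg_powR => //; exact: bcvg.
rewrite -(cvg_lim _ lim)//; apply: limr_le; first exact: cvgP lim.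
by apply: nearW => J; exact: hT.
Qed.

(** The second inequality. Nothing is to be proved if the weighted sum is
    infinite. *)
Lemma I_le_weighted_sum (p r : R) lam a : 1 < p -> 1 <= r ->
  pos_monotone_from1 lam -> dyadic_regular lam -> NBVS a ->
  head_condition lam r p -> tail_condition lam r p ->
  exists K : R, 0 < K /\
     forall f : R -> R, Lp2pi p f -> cosine_series_of f a ->
       (I_int f lam r p <= K%:E * weighted_sum lam a r)%E.
Proof.
move=> p1 r1 hl hdy aN hh ht; have [a0 _] := aN; have [l0 _] := hl.
have [C C0 HC] := attenuated_sum_limit p1 r1 hl hdy aN hh ht.
have [K K0 HK] := diff_integral_le p1 aN.
have [D D0 HD] := integral_I_dyadic_le p1 r1 hl hdy.
pose K1 := D * K `^ (r / p).
have K10 : 0 < K1 by rewrite mulr_gt0 ?powR_gt0.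
exists (K1 * C); split; first exact: mulr_gt0.
move=> f fp fa; have [mf _ _] := fp.
have S0 : (0 <= weighted_sum lam a r)%E.
  rewrite /weighted_sum nneseries_from1; last first.
    by move=> n n0; rewrite mulr_ge0 ?powR_ge0// ltW// l0// ler1n.
  apply: nneseries_ge0 => n _ _.
  by rewrite lee_fin mulr_ge0 ?powR_ge0// ltW// l0// ler1n.
case sE : (weighted_sum lam a r) S0 => [s| |] // S0; last first.
  by rewrite gt0_muley ?leey// lte_fin mulr_gt0.
have [b [b0 [bsum bW]]] := HC s sE.
rewrite (@integral_I_partition _ _ _ _ _ (fun n => 2^-1 ^+ n))//; last 2 first.
- by move=> n; rewrite exprS ler_piMl ?exprn_ge0//; lra.
- exact: cvg_exp2V.
pose W := dyadic_mass lam (r / p - r).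
have W0 n : 0 < W n by exact: dyadic_mass_gt0.
have Bb J : \sum_(0 <= j < J) block_norm a p j <= b 0%N.
  rewrite (le_trans _ (bsum 0%N J))//; apply: ler_sum => j _.
  by rewrite /attenuation sub0n expr0 mul1r.
apply: (@le_trans _ _ (\sum_(n <oo) (K1 * (W n * b n `^ r))%:E)%E).
  apply: lee_nneseries => [n _ _|n _].
    apply: integral_ge0 => t /=; rewrite in_itv/= => /andP[t0 t1].
    apply: I_integrand_ge0 => //; rewrite (lt_trans _ t0) ?exprn_gt0//=.
    by rewrite (le_trans t1)// exprn_ile1//; lra.
  apply: (le_trans (HD f n K (b n) mf (ltW K0) (b0 n) _)).
    by move=> t t01 tn; exact: (HK f (b 0%N) (b n) n t fp fa Bb (bsum n) t01 tn).
  by rewrite lee_fin /K1 -!mulrA.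
apply: lime_le.
  apply: is_cvg_nneseries => n _ _.
  have Wb : 0 <= W n * b n `^ r by rewrite mulr_ge0 ?powR_ge0// ltW.
  by rewrite lee_fin mulr_ge0// ltW.
apply: nearW => M; rewrite sumEFin -EFinM lee_fin -mulr_sumr -[leRHS]mulrA.
by apply: ler_wpM2l; [exact: ltW|exact: bW].
Qed.

End upper_bound.

Unset Implicit Arguments.

Theorem theorem2 (R : realType) (p r : R) (lam : R -> R) (a : nat -> R)
    (hp : 1 < p) (hr : 1 <= r)
    (hlam : pos_monotone_from1 lam) (hdy : dyadic_regular lam)
    (ha : NBVS a) :
  (exists K : R, 0 < K /\
     forall f : R -> R, Lp2pi p f -> cosine_series_of f a ->
       (weighted_sum lam a r <= K%:E * I_int f lam r p)%E) /\
  (summable_Delta a -> head_condition lam r p -> tail_condition lam r p ->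
   exists K : R, 0 < K /\
     forall f : R -> R, Lp2pi p f -> cosine_series_of f a ->
       (I_int f lam r p <= K%:E * weighted_sum lam a r)%E).
Proof.
split; first exact: weighted_sum_le_I.
by move=> _ hh ht; exact: I_le_weighted_sum.
Qed.
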